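(* For every $g \geq 4$, the linearization map $\Phi\colon \mathfrak{K}_g^a \rightarrow \mathcal{K}_g^a$, defined on generators by $\Phi([\![\kappa_1,\kappa_2]\!]_a) = \kappa_1 \wedge \kappa_2$, is an isomorphism of $\mathbb{Q}$-vector spaces.
   Context: $H = \mathbb{Q}^{2g}$, $H_{\mathbb{Z}} = \mathbb{Z}^{2g}\subset H$, and $\omega\colon H \times H \to \mathbb{Q}$ is the standard symplectic form. Using $\omega$ to identify $H$ with its dual, $\omega$ is regarded as the element $\omega = a_1\wedge b_1+\cdots+a_g\wedge b_g \in \wedge^2 H_{\mathbb{Z}}$, where $\{a_1,b_1,\ldots,a_g,b_g\}$ is any symplectic basis. $(\wedge^2 H)/\mathbb{Q}$ is the quotient of $\wedge^2 H$ by the $\mathbb{Q}$-span of $\omega$, and $(\wedge^2 H_{\mathbb{Z}})/\mathbb{Z}$ is the quotient of $\wedge^2 H_{\mathbb{Z}}$ by the $\mathbb{Z}$-span of $\omega$, a lattice in $(\wedge^2 H)/\mathbb{Q}$. For $x,y\in H$, $x\wedge y$ also denotes its image in $(\wedge^2 H)/\mathbb{Q}$. The symmetric contraction is the alternating bilinear map $\mathfrak{c}\colon ((\wedge^2 H)/\mathbb{Q})\times((\wedge^2 H)/\mathbb{Q})\to \operatorname{Sym}^2(H)$ given by $$\mathfrak{c}(x\wedge y,z\wedge w)=\omega(x,z)\,y\cdot w-\omega(x,w)\,y\cdot z-\omega(y,z)\,x\cdot w+\omega(y,w)\,x\cdot z\qquad (x,y,z,w\in H)$$ (this is well defined on the quotient).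 The symmetric kernel $\mathcal{K}_g^a$ is the kernel of the induced linear map $\wedge^2((\wedge^2 H)/\mathbb{Q})\to\operatorname{Sym}^2(H)$. Elements $\kappa_1,\kappa_2\in(\wedge^2 H)/\mathbb{Q}$ are sym-orthogonal if $\mathfrak{c}(\kappa_1,\kappa_2)=0$. A symplectic pair is an element of $(\wedge^2 H_{\mathbb{Z}})/\mathbb{Z}$ of the form $a\wedge b$ with $a,b\in H_{\mathbb{Z}}$ and $\omega(a,b)=1$. $\mathfrak{K}_g^a$ is the $\mathbb{Q}$-vector space with the following presentation. Generators: a formal symbol $[\![\kappa_1,\kappa_2]\!]_a$ for all sym-orthogonal $\kappa_1,\kappa_2\in(\wedge^2 H)/\mathbb{Q}$ such that $\kappa_1$ or $\kappa_2$ (or both) is a symplectic pair. Relations: (1) for all generators, $[\![\kappa_2,\kappa_1]\!]_a=-[\![\kappa_1,\kappa_2]\!]_a$; (2) for all symplectic pairs $a\wedge b$, all $\kappa_1,\kappa_2\in(\wedge^2 H)/\mathbb{Q}$ that are sym-orthogonal to $a\wedge b$, and all $\lambda_1,\lambda_2\in\mathbb{Q}$, $[\![a\wedge b,\lambda_1\kappa_1+\lambda_2\kappa_2]\!]_a=\lambda_1[\![a\wedge b,\kappa_1]\!]_a+\lambda_2[\![a\wedge b,\kappa_2]\!]_a$. The formula for $\Phi$ takes relations to relations, so it gives a well-defined linear map $\mathfrak{K}_g^a\to\wedge^2((\wedge^2 H)/\mathbb{Q})$ with image in $\mathcal{K}_g^a$. *)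

(* Defs.v *)
(* MathComp, with the classical layer of MathComp-Analysis. *)
From HB Require Import structures.
From mathcomp Require Import all_boot all_order all_algebra.
From mathcomp Require Import finmap.
From mathcomp Require Import boolp classical_sets.
From mathcomp Require Import monalg.
From mathcomp Require Import ring.

Set Implicit Arguments.
Unset Strict Implicit.
Unset Printing Implicit Defensive.

Import GRing.Theory Num.Theory Quotient.

Local Open Scope ring_scope.
Local Open Scope quotient_scope.

Section FreeModule.
Variables (R : nzRingType) (K : choiceType) (U : lmodType R) (f : K -> U).

Definition flift (u : {malg R[K]}) : U := \sum_(k <- msupp u) u@_k *: f k.

Lemma fliftEw (u : {malg R[K]}) (d : {fset K}) :
  (msupp u `<=` d)%fset -> flift u = \sum_(k <- d) u@_k *: f k.
Proof.
move=> le_ud; rewrite /flift (big_fset_incl _ le_ud) //= => k _.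
move/mcoeff_outdom ->.
by rewrite scale0r.
Qed.

Lemma flift_is_linear : linear flift.
Proof.
move=> a u v; pose d := (msupp u `|` msupp v `|` msupp (a *: u + v))%fset.
have leu : (msupp u `<=` d)%fset by rewrite /d -fsetUA fsubsetUl.
have lev : (msupp v `<=` d)%fset by rewrite /d fsetUAC fsubsetUr.
have leuv : (msupp (a *: u + v) `<=` d)%fset by rewrite /d fsubsetUr.
rewrite (fliftEw leu) (fliftEw lev) (fliftEw leuv) scaler_sumr -big_split /=.
by apply: eq_bigr => k _; rewrite mcoeffD mcoeffZ scalerDl scalerA.
Qed.
HB.instance Definition _ :=
  GRing.isLinear.Build R {malg R[K]} U _ flift flift_is_linear.

Lemma fliftU k : flift << k >> = f k.
Proof.
rewrite /flift msuppU oner_eq0 big_seq_fset1 mcoeffUU.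
by rewrite scale1r.
Qed.

End FreeModule.

Lemma malg_lin_ind (R : nzRingType) (K : choiceType) (P : {malg R[K]} -> Prop) :
  P 0 -> (forall a u v, P u -> P v -> P (a *: u + v)) ->
  (forall k, P << k >>) -> forall u, P u.
Proof.
move=> P0 PD PU u; rewrite (monalgE u).
elim: (msupp u : seq K) => [|k s IHs]; first by rewrite big_nil.
rewrite big_cons; suff -> : << u@_k *g k >> = u@_k *: << k >> :> {malg R[K]}.
  exact: PD.
by apply/malgP => k'; rewrite mcoeffZ !mcoeffU mulrnAr mulr1.
Qed.

Section Span.
Variables (R : nzRingType) (V : lmodType R).

(* The smallest submodule containing [S]. *)
Definition lspan (S : set V) : {pred V} := fun v =>
  `[< forall W : {pred V}, submod_closed W -> (forall s, S s -> s \in W) ->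
        v \in W >].

Lemma lspan_submod (S : set V) : submod_closed (lspan S).
Proof.
split=> [|a u v /asboolP Su /asboolP Sv]; apply/asboolP => W cW SW.
  exact: cW.1.
by apply: cW.2; [exact: Su | exact: Sv].
Qed.
HB.instance Definition _ S :=
  GRing.isSubmodClosed.Build R V (lspan S) (lspan_submod S).

Lemma mem_lspan (S : set V) s : S s -> s \in lspan S.
Proof. by move=> Ss; apply/asboolP => W _; apply. Qed.

Lemma lspan_kill (S : set V) (U : lmodType R) (f : {linear V -> U}) :
  (forall s, S s -> f s = 0) -> forall v, v \in lspan S -> f v = 0.
Proof.
move=> fS v /asboolP /(_ [pred u | f u == 0]) /= Sv; apply/eqP/Sv.
  split=> [|a x y]; rewrite !inE ?linear0 // => /eqP fx /eqP fy.
  by rewrite linearP fx fy scaler0 addr0.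
by move=> s /fS /eqP; rewrite inE.
Qed.

End Span.

(* The library only makes [{quot _}] a Z-module.  The projection and the
   operations are locked: otherwise unification of terms in the iterated
   quotients below unfolds them down to representatives. *)
Definition quotspan (R : nzRingType) (V : lmodType R) (S : set V) :=
  {quot lspan S}.
HB.instance Definition _ R V S := Choice.on (@quotspan R V S).

HB.lock Definition qpi (R : nzRingType) (V : lmodType R) (S : set V) (v : V)
  : quotspan S := \pi_{quot lspan S} v.
HB.lock Definition qrepr (R : nzRingType) (V : lmodType R) (S : set V)
  (q : quotspan S) : V := repr q.
HB.lock Definition qzero (R : nzRingType) (V : lmodType R) (S : set V)
  : quotspan S := qpi S 0.
HB.lock Definition qopp (R : nzRingType) (V : lmodType R) (S : set V)
  (q : quotspan S) : quotspan S := qpi S (- qrepr q).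
HB.lock Definition qadd (R : nzRingType) (V : lmodType R) (S : set V)
  (p q : quotspan S) : quotspan S := qpi S (qrepr p + qrepr q).
HB.lock Definition qscale (R : nzRingType) (V : lmodType R) (S : set V)
  (a : R) (q : quotspan S) : quotspan S := qpi S (a *: qrepr q).

Section QuotientBySpan.
Variables (R : nzRingType) (V : lmodType R) (S : set V).
Local Notation quotspan := (quotspan S).
Local Notation qpi := (qpi S).
Local Notation qzero := (qzero S).
Local Notation qopp := (@qopp R V S).
Local Notation qadd := (@qadd R V S).
Local Notation qscale := (@qscale R V S).

Lemma qreprK (q : quotspan) : qpi (qrepr q) = q.
Proof. by rewrite qpi.unlock qrepr.unlock reprK. Qed.

Lemma qpi_surj q : exists v, q = qpi v.
Proof. by exists (qrepr q); rewrite qreprK. Qed.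

Lemma qpi_eqE u v : (qpi u == qpi v) = (u - v \in lspan S).
Proof. by rewrite qpi.unlock idealrBE. Qed.

Lemma qrepr_pi v : qrepr (qpi v) - v \in lspan S.
Proof. by rewrite -qpi_eqE qreprK. Qed.

Let qoppE v : qopp (qpi v) = qpi (- v).
Proof. by apply/eqP; rewrite qopp.unlock qpi_eqE -opprD rpredN qrepr_pi. Qed.
Let qaddE u v : qadd (qpi u) (qpi v) = qpi (u + v).
Proof.
by apply/eqP; rewrite qadd.unlock qpi_eqE opprD addrACA rpredD ?qrepr_pi.
Qed.
Let qscaleE a v : qscale a (qpi v) = qpi (a *: v).
Proof.
by apply/eqP; rewrite qscale.unlock qpi_eqE -scalerBr rpredZ ?qrepr_pi.
Qed.

Let qaddA : associative qadd.
Proof.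
by move=> p q r; rewrite -(qreprK p) -(qreprK q) -(qreprK r) !qaddE addrA.
Qed.
Let qaddC : commutative qadd.
Proof. by move=> p q; rewrite -(qreprK p) -(qreprK q) !qaddE addrC. Qed.
Let qadd0 : left_id qzero qadd.
Proof. by move=> p; rewrite -(qreprK p) qzero.unlock qaddE add0r. Qed.
Let qaddN : left_inverse qzero qopp qadd.
Proof. by move=> p; rewrite -(qreprK p) qoppE qaddE addNr qzero.unlock. Qed.

HB.instance Definition _ :=
  GRing.isZmodule.Build quotspan qaddA qaddC qadd0 qaddN.

Let qscaleA a b q : qscale a (qscale b q) = qscale (a * b) q.
Proof. by rewrite -(qreprK q) !qscaleE scalerA. Qed.
Let qscale1 : left_id 1 qscale.
Proof. by move=> q; rewrite -(qreprK q) qscaleE scale1r. Qed.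
Let qscaleDr : right_distributive qscale +%R.
Proof.
move=> a p q; rewrite -(qreprK p) -(qreprK q) [_ + _]qaddE !qscaleE.
by rewrite scalerDr -qaddE.
Qed.
Let qscaleDl q : {morph qscale^~ q : a b / a + b}.
Proof. by move=> a b; rewrite -(qreprK q) !qscaleE scalerDl -qaddE. Qed.

HB.instance Definition _ := GRing.Zmodule_isLmodule.Build R quotspan
  qscaleA qscale1 qscaleDr qscaleDl.

Lemma qpi_is_linear : linear qpi.
Proof. by move=> a u v; rewrite -qaddE -qscaleE. Qed.
HB.instance Definition _ :=
  GRing.isLinear.Build R V quotspan _ qpi qpi_is_linear.

Lemma qpi_span v : v \in lspan S -> qpi v = 0.
Proof. by move=> Wv; apply/eqP; rewrite -(linear0 qpi) qpi_eqE subr0. Qed.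

Lemma qpi_rel v : S v -> qpi v = 0.
Proof. by move=> Sv; apply/qpi_span/mem_lspan. Qed.

Variables (U : lmodType R) (f : {linear V -> U}).

Definition qlift of (forall s, S s -> f s = 0) : quotspan -> U :=
  fun q => f (qrepr q).

Hypothesis fS : forall s, S s -> f s = 0.

Lemma qliftE v : qlift fS (qpi v) = f v.
Proof.
apply/subr0_eq; rewrite /qlift -linearB.
exact/(lspan_kill fS)/qrepr_pi.
Qed.

Lemma qlift_is_linear : linear (qlift fS).
Proof.
move=> a p q; have [[u ->] [v ->]] := (qpi_surj p, qpi_surj q).
by rewrite -linearP !qliftE linearP.
Qed.
HB.instance Definition _ :=
  GRing.isLinear.Build R quotspan U _ (qlift fS) qlift_is_linear.

End QuotientBySpan.

Section LinearClosure.
Variables (R : comNzRingType) (V U : lmodType R).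

Lemma lin_add (f1 f2 : V -> U) :
  linear f1 -> linear f2 -> linear (fun v => f1 v + f2 v).
Proof. by move=> l1 l2 a u v; rewrite l1 l2 scalerDr addrACA. Qed.

Lemma lin_sub (f1 f2 : V -> U) :
  linear f1 -> linear f2 -> linear (fun v => f1 v - f2 v).
Proof. by move=> l1 l2 a u v; rewrite l1 l2 opprD scalerBr addrACA. Qed.

Lemma lin_scale c (f : V -> U) : linear f -> linear (fun v => c *: f v).
Proof. by move=> l1 a u v; rewrite l1 scalerDr !scalerA mulrC. Qed.

Lemma lin_scalar (p : V -> R) (m : U) : scalar p -> linear (fun v => p v *: m).
Proof. by move=> lp a u v; rewrite lp scalerDl scalerA. Qed.

End LinearClosure.

(* The tensor square is the free module on pairs modulo bilinearity; the
   exterior and symmetric squares are quotients of it. *)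
Inductive tensor2_rel (R : comNzRingType) (V : lmodType R)
  : set {malg R[(V * V)%type]} :=
| Tensor2Linl a x1 x2 y : tensor2_rel
    (<< (a *: x1 + x2, y) >> - (a *: << (x1, y) >> + << (x2, y) >>))
| Tensor2Linr a x y1 y2 : tensor2_rel
    (<< (x, a *: y1 + y2) >> - (a *: << (x, y1) >> + << (x, y2) >>)).

Definition tensor2 (R : comNzRingType) (V : lmodType R) :=
  quotspan (@tensor2_rel R V).
HB.instance Definition _ R V := GRing.Lmodule.on (@tensor2 R V).

HB.lock Definition tens (R : comNzRingType) (V : lmodType R) (x y : V)
  : tensor2 V := qpi _ << (x, y) >>.

Section Squares.
Variables (R : comNzRingType) (V : lmodType R).
Local Notation tensor2 := (tensor2 V).
Local Notation tens := (@tens R V).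
Local Notation tensor2_rel := (@tensor2_rel R V).

Inductive wedge2_rel : set tensor2 := Wedge2Alt x : wedge2_rel (tens x x).
Definition wedge2 := quotspan wedge2_rel.
HB.instance Definition _ := GRing.Lmodule.on wedge2.

Definition wedge (x y : V) : wedge2 := qpi _ (tens x y).

Inductive sym2_rel : set tensor2 :=
  Sym2Comm x y : sym2_rel (tens x y - tens y x).
Definition sym2 := quotspan sym2_rel.
HB.instance Definition _ := GRing.Lmodule.on sym2.

Definition smul (x y : V) : sym2 := qpi _ (tens x y).

Definition bilin (U : lmodType R) (f : V -> V -> U) :=
  (forall y, linear (f^~ y)) /\ (forall x, linear (f x)).

Lemma tens_bilin : bilin tens.
Proof.
split=> [y a x1 x2|x a y1 y2]; rewrite tens.unlock.
  have := qpi_rel (Tensor2Linl a x1 x2 y); rewrite linearB => /subr0_eq ->.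
  by rewrite linearP.
have := qpi_rel (Tensor2Linr a x y1 y2); rewrite linearB => /subr0_eq ->.
by rewrite linearP.
Qed.

Lemma wedge_bilin : bilin wedge.
Proof.
split=> [y a x1 x2|x a y1 y2]; rewrite /wedge.
  by rewrite tens_bilin.1 linearP.
by rewrite tens_bilin.2 linearP.
Qed.

Lemma smul_bilin : bilin smul.
Proof.
split=> [y a x1 x2|x a y1 y2]; rewrite /smul.
  by rewrite tens_bilin.1 linearP.
by rewrite tens_bilin.2 linearP.
Qed.

Lemma wedgexx x : wedge x x = 0.
Proof. exact: qpi_rel (Wedge2Alt x). Qed.

Lemma wedgeC x y : wedge y x = - wedge x y.
Proof.
have := wedgexx (1 *: x + y); rewrite wedge_bilin.1 !wedge_bilin.2 !wedgexx.
by rewrite !scale1r add0r addr0 => /addr0_eq ->.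
Qed.

Lemma smulC x y : smul x y = smul y x.
Proof.
by have := qpi_rel (Sym2Comm x y); rewrite linearB => /subr0_eq.
Qed.

HB.instance Definition _ x :=
  GRing.isLinear.Build R V wedge2 _ (wedge x) (wedge_bilin.2 x).
HB.instance Definition _ x :=
  GRing.isLinear.Build R V sym2 _ (smul x) (smul_bilin.2 x).

Section Lift.
Variables (U : lmodType R) (f : V -> V -> U).
Hypotheses (fB : bilin f) (fA : forall x, f x x = 0).

Fact tlift_subproof r : tensor2_rel r -> flift (fun p => f p.1 p.2) r = 0.
Proof.
by case=> [a x1 x2 y|a x y1 y2];
  rewrite linearB linearP /= !fliftU ?fB.1 ?fB.2 subrr.
Qed.
Definition tlift : tensor2 -> U := qlift tlift_subproof.
HB.instance Definition _ := GRing.Linear.on tlift.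

Lemma tliftE x y : tlift (tens x y) = f x y.
Proof. by rewrite tens.unlock /tlift qliftE /= fliftU. Qed.

Fact wlift_subproof r : wedge2_rel r -> tlift r = 0.
Proof. by case=> x; rewrite tliftE. Qed.
Definition wlift : wedge2 -> U := qlift wlift_subproof.
HB.instance Definition _ := GRing.Linear.on wlift.

Lemma wliftE x y : wlift (wedge x y) = f x y.
Proof. exact: etrans (qliftE _ _) (tliftE _ _). Qed.

End Lift.

Lemma wedge2_ind (P : wedge2 -> Prop) :
  P 0 -> (forall a u v, P u -> P v -> P (a *: u + v)) ->
  (forall x y, P (wedge x y)) -> forall w, P w.
Proof.
move=> P0 PD Pw w; have [t ->] := qpi_surj w; have [u ->] := qpi_surj t.
elim/malg_lin_ind: u => [|a u v Pu Pv|[x y]].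
- by rewrite !linear0.
- by rewrite !linearP; apply: PD.
- by have := Pw x y; rewrite /wedge tens.unlock.
Qed.

End Squares.

Section Kernel.
Variables (R : nzRingType) (U V : lmodType R) (f : {linear U -> V}).

Definition kerp : {pred U} := [pred u | f u == 0].

Lemma kerp_submod : submod_closed kerp.
Proof.
split=> [|a x y]; rewrite !inE ?linear0 // => /eqP fx /eqP fy.
by rewrite linearP fx fy scaler0 addr0.
Qed.
HB.instance Definition _ := GRing.isSubmodClosed.Build R U kerp kerp_submod.

Definition lkernel := {u : U | u \in kerp}.
HB.instance Definition _ := SubChoice.on lkernel.
HB.instance Definition _ := [SubChoice_isSubLmodule of lkernel by <:].

End Kernel.

Section SymplecticSpace.
Variable g : nat.

Definition H := 'rV[rat]_(g + g).
HB.instance Definition _ := GRing.Lmodule.on H.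

Definition baseA (i : 'I_g) : H := delta_mx 0 (lshift g i).
Definition baseB (i : 'I_g) : H := delta_mx 0 (rshift g i).

(* [baseA i] and [baseB i] form the standard symplectic basis. *)
Definition omega (x y : H) : rat :=
  \sum_(i < g) (x 0 (lshift g i) * y 0 (rshift g i)
                - x 0 (rshift g i) * y 0 (lshift g i)).

(* The form [omega] seen as a bivector. *)
Definition omega2 : wedge2 H := \sum_(i < g) wedge (baseA i) (baseB i).

(* The exterior square of [H] modulo the line spanned by [omega2]. *)
Definition W2 := quotspan [set omega2]%classic.
HB.instance Definition _ := GRing.Lmodule.on W2.

Definition wedgeW (x y : H) : W2 := qpi _ (wedge x y).

Lemma wedgeW_bilin : bilin wedgeW.
Proof.
split=> [y a x1 x2|x a y1 y2]; rewrite /wedgeW.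
  by rewrite (wedge_bilin H).1 linearP.
by rewrite (wedge_bilin H).2 linearP.
Qed.

Lemma wedgeWxx x : wedgeW x x = 0.
Proof. by rewrite /wedgeW wedgexx linear0. Qed.

Lemma W2_ind (P : W2 -> Prop) :
  P 0 -> (forall a u v, P u -> P v -> P (a *: u + v)) ->
  (forall x y, P (wedgeW x y)) -> forall k, P k.
Proof.
move=> P0 PD Pw k; have [w ->] := qpi_surj k.
elim/wedge2_ind: w => [|a u v Pu Pv|x y]; last exact: Pw.
  by rewrite linear0.
by rewrite linearP; apply: PD.
Qed.

Lemma omega_bilin :
  (forall y, scalar (omega^~ y)) /\ (forall x, scalar (omega x)).
Proof.
split=> [y a x1 x2|x a y1 y2]; rewrite /omega mulr_sumr -big_split /=;
  by apply: eq_bigr => i _; rewrite !mxE; ring.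
Qed.

Lemma omegaC x y : omega y x = - omega x y.
Proof. by rewrite /omega -sumrN; apply: eq_bigr => i _; ring. Qed.

Lemma omega_baseA x i : omega x (baseA i) = - x 0 (rshift g i).
Proof.
rewrite /omega (bigD1 i) //= big1 => [|j ne_ji]; rewrite !mxE /=.
  by rewrite eq_rlshift !eqxx mulr0 mulr1 sub0r addr0.
by rewrite eq_rlshift eq_lshift (negPf ne_ji) !mulr0 subr0.
Qed.

Lemma omega_baseB x i : omega x (baseB i) = x 0 (lshift g i).
Proof.
rewrite /omega (bigD1 i) //= big1 => [|j ne_ji]; rewrite !mxE /=.
  by rewrite eq_lrshift !eqxx mulr0 mulr1 subr0 addr0.
by rewrite eq_lrshift eq_rshift (negPf ne_ji) !mulr0 subr0.
Qed.

Lemma base_sum (x : H) :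
  x = \sum_(i < g) (x 0 (lshift g i) *: baseA i + x 0 (rshift g i) *: baseB i).
Proof. by rewrite {1}[x]row_sum_delta big_split_ord big_split. Qed.

Definition contr_form (x y z w : H) : sym2 H :=
  omega x z *: smul y w - omega x w *: smul y z
  - omega y z *: smul x w + omega y w *: smul x z.

Lemma contr_formC x y z w : contr_form z w x y = - contr_form x y z w.
Proof.
rewrite /contr_form (omegaC x z) (omegaC y z) (omegaC x w) (omegaC y w).
rewrite (smulC w y) (smulC w x) (smulC z y) (smulC z x) !scaleNr !opprD !opprK.
by congr (_ + _); rewrite addrAC.
Qed.

Lemma contr_form_linr x y z : linear (contr_form x y z).
Proof.
rewrite /contr_form; apply: lin_add; first apply: lin_sub; first apply: lin_sub.
- exact/lin_scale/(smul_bilin _).2.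
- exact/lin_scalar/omega_bilin.2.
- exact/lin_scale/(smul_bilin _).2.
- exact/lin_scalar/omega_bilin.2.
Qed.

Lemma contr_form_bilin x y : bilin (contr_form x y).
Proof.
split=> [w|z]; last exact: contr_form_linr.
rewrite /contr_form; apply: lin_add; first apply: lin_sub; first apply: lin_sub.
- exact/lin_scalar/omega_bilin.2.
- exact/lin_scale/(smul_bilin _).2.
- exact/lin_scalar/omega_bilin.2.
- exact/lin_scale/(smul_bilin _).2.
Qed.

Lemma contr_form_alt x y z : contr_form x y z z = 0.
Proof. by rewrite /contr_form subrr sub0r addNr. Qed.

Lemma contr_form_omega2 x y :
  wlift (contr_form_bilin x y) (contr_form_alt x y) omega2 = 0.
Proof.
rewrite /omega2 linear_sum /=.
pose s (u v : H) := \sum_(i < g) (u 0 (lshift g i) *: smul v (baseA i)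
                                  + u 0 (rshift g i) *: smul v (baseB i)).
have sE u v : s u v = smul v u.
  rewrite {2}[u]base_sum linear_sum; apply: eq_bigr => i _.
  by rewrite linearD !linearZ.
transitivity (s y x - s x y); last by rewrite !sE smulC subrr.
rewrite /s -sumrB; apply: eq_bigr => i _.
rewrite wliftE /contr_form !omega_baseA !omega_baseB !scaleNr opprK.
by rewrite [RHS]addrC opprD [in RHS](addrC (- _)) addrA [LHS]addrAC -!addrA.
Qed.

Fact contr_inner_subproof x y r : [set omega2]%classic r ->
  wlift (contr_form_bilin x y) (contr_form_alt x y) r = 0.
Proof. by move=> ->; exact: contr_form_omega2. Qed.

Definition contr_inner (x y : H) : W2 -> sym2 H :=
  qlift (contr_inner_subproof x y).
HB.instance Definition _ x y := GRing.Linear.on (contr_inner x y).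

Lemma contr_innerE x y z w : contr_inner x y (wedgeW z w) = contr_form x y z w.
Proof. exact: etrans (qliftE _ _) (wliftE _ _ _ _). Qed.

Lemma contr_inner_linear x y : linear (contr_inner x y).
Proof. exact: linearP. Qed.

Lemma contr_inner_bilin k : bilin (fun x y => contr_inner x y k).
Proof.
split=> [y a x1 x2|x a y1 y2]; elim/W2_ind: k => [|b u v Pu Pv|z w].
- by rewrite !linear0 addr0.
- by rewrite !contr_inner_linear Pu Pv !scalerDr !scalerA [b * a]mulrC addrACA.
- rewrite !contr_innerE !(contr_formC z w) (contr_form_bilin z w).1.
  by rewrite opprD scalerN.
- by rewrite !linear0 addr0.
- by rewrite !contr_inner_linear Pu Pv !scalerDr !scalerA [b * a]mulrC addrACA.
- rewrite !contr_innerE !(contr_formC z w) (contr_form_bilin z w).2.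
  by rewrite opprD scalerN.
Qed.

Lemma contr_inner_alt k x : contr_inner x x k = 0.
Proof.
elim/W2_ind: k => [|b u v Pu Pv|z w]; first by rewrite linear0.
  by rewrite contr_inner_linear Pu Pv scaler0 addr0.
by rewrite contr_innerE (contr_formC z w) contr_form_alt oppr0.
Qed.

Lemma contr_inner_omega2 k :
  wlift (contr_inner_bilin k) (contr_inner_alt k) omega2 = 0.
Proof.
rewrite /omega2 linear_sum /=; under eq_bigr do rewrite wliftE.
elim/W2_ind: k => [|b u v Pu Pv|z w].
- by apply: big1 => i _; rewrite linear0.
- under eq_bigr do rewrite contr_inner_linear.
  by rewrite big_split /= -scaler_sumr Pu Pv scaler0 addr0.
- under eq_bigr do rewrite contr_innerE (contr_formC z w).
  rewrite sumrN; apply/eqP; rewrite oppr_eq0; apply/eqP.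
  rewrite -[RHS](contr_form_omega2 z w) /omega2 linear_sum /=.
  by apply: eq_bigr => i _; rewrite wliftE.
Qed.

Fact contr_subproof k r : [set omega2]%classic r ->
  wlift (contr_inner_bilin k) (contr_inner_alt k) r = 0.
Proof. by move=> ->; exact: contr_inner_omega2. Qed.

(* The symmetric contraction; [contrE] is its defining formula. *)
Definition contr (k1 k2 : W2) : sym2 H := qlift (contr_subproof k2) k1.

Lemma contrE x y z w :
  contr (wedgeW x y) (wedgeW z w) =
    omega x z *: smul y w - omega x w *: smul y z
    - omega y z *: smul x w + omega y w *: smul x z.
Proof.
exact: etrans (qliftE _ _) (etrans (wliftE _ _ _ _) (contr_innerE _ _ _ _)).
Qed.

Lemma contr_linl k2 : linear (contr^~ k2).
Proof. by move=> a u v; rewrite /contr linearP. Qed.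

Lemma contr_wedgel x y k : contr (wedgeW x y) k = contr_inner x y k.
Proof. exact: etrans (qliftE _ _) (wliftE _ _ _ _). Qed.

Lemma contr_linr k1 : linear (contr k1).
Proof.
move=> a u v; elim/W2_ind: k1 => [|b k l Pk Pl|x y].
- by rewrite /contr !linear0 addr0.
- by rewrite !contr_linl Pk Pl !scalerDr !scalerA [b * a]mulrC addrACA.
- by rewrite !contr_wedgel linearP.
Qed.

Lemma contr_bilin : bilin contr.
Proof. by split; [exact: contr_linl | exact: contr_linr]. Qed.

HB.instance Definition _ k1 :=
  GRing.isLinear.Build rat W2 (sym2 H) _ (contr k1) (contr_linr k1).

Lemma contrC k1 k2 : contr k2 k1 = - contr k1 k2.
Proof.
elim/W2_ind: k1 k2 => [|a k l Pk Pl|x y] k2.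
- by rewrite linear0 /contr linear0 oppr0.
- by rewrite contr_linr contr_linl Pk Pl opprD scalerN.
- elim/W2_ind: k2 => [|a k l Pk Pl|z w].
  + by rewrite contr_wedgel linear0 oppr0 /contr linear0.
  + by rewrite contr_linr contr_linl Pk Pl opprD scalerN.
  + by rewrite !contr_wedgel !contr_innerE contr_formC.
Qed.

Lemma contr_alt k : contr k k = 0.
Proof.
have e : (1 + 1 : rat) *: contr k k = 0.
  by rewrite scalerDl scale1r {1}contrC addNr.
by rewrite -[LHS](scalerK (_ : (1 + 1 : rat) != 0)) // e scaler0.
Qed.

Definition contr2 : wedge2 W2 -> sym2 H := wlift contr_bilin contr_alt.
HB.instance Definition _ := GRing.Linear.on contr2.

Lemma contr2E k1 k2 : contr2 (wedge k1 k2) = contr k1 k2.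
Proof. exact: wliftE. Qed.

Definition symker := lkernel contr2.
HB.instance Definition _ := GRing.SubLmodule.on symker.

Definition integral : {pred H} := mxOver Num.int.

(* For integral [a] and [b], [wedgeW a b] lies in the integral lattice of [W2],
   so membership in that lattice is not a separate condition. *)
Definition symplectic_pair (k : W2) : Prop :=
  exists a b : H, [/\ a \in integral, b \in integral, omega a b = 1
                    & k = wedgeW a b].

Definition sym_orthogonal (k1 k2 : W2) : Prop := contr k1 k2 = 0.

Definition is_gen (k1 k2 : W2) : Prop :=
  sym_orthogonal k1 k2 /\ (symplectic_pair k1 \/ symplectic_pair k2).

Definition gen := {p : W2 * W2 | `[< is_gen p.1 p.2 >]}.

End SymplecticSpace.

HB.lock Definition fsymb (g : nat) (k1 k2 : W2 g) (h : is_gen k1 k2)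
  : {malg rat[gen g]} := << (exist _ (k1, k2) (asboolT h) : gen g) >>.

Section Linearization.
Variable g : nat.
Local Notation W2 := (W2 g).
Local Notation gen := (gen g).
Local Notation symker := (symker g).

(* Each relation says that its first term minus the other ones vanishes.  In
   [KrelLin] the hypotheses [h1] and [h2] amount to [k1] and [k2] being
   sym-orthogonal to the symplectic pair [s], and they imply [h]. *)
Inductive Krel : set {malg rat[gen]} :=
| KrelAnti k1 k2 (h12 : is_gen k1 k2) (h21 : is_gen k2 k1) :
    Krel (fsymb h21 - (- fsymb h12))
| KrelLin s k1 k2 (l1 l2 : rat) (h1 : is_gen s k1) (h2 : is_gen s k2)
    (h : is_gen s (l1 *: k1 + l2 *: k2)) of symplectic_pair s :
    Krel (fsymb h - (l1 *: fsymb h1 + l2 *: fsymb h2)).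

Definition Kpres := quotspan Krel.
HB.instance Definition _ := GRing.Lmodule.on Kpres.

Definition symb k1 k2 (h : is_gen k1 k2) : Kpres := qpi Krel (fsymb h).

Definition gen_wedge (p : gen) : wedge2 W2 := wedge (val p).1 (val p).2.

Lemma flift_fsymb k1 k2 (h : is_gen k1 k2) :
  flift gen_wedge (fsymb h) = wedge k1 k2.
Proof. by rewrite fsymb.unlock; exact: fliftU. Qed.

Fact Phi0_subproof r : Krel r -> flift gen_wedge r = 0.
Proof.
pose f : {linear {malg rat[gen]} -> wedge2 W2} := flift gen_wedge.
have fE k1 k2 (h : is_gen k1 k2) : f (fsymb h) = wedge k1 k2.
  exact: flift_fsymb.
change (Krel r -> f r = 0).
case=> [k1 k2 h12 h21|s k1 k2 l1 l2 h1 h2 h _].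
  by rewrite (linearB f) (linearN f) !fE wedgeC subrr.
rewrite (linearB f) (linearP f) (linearZ_LR f) !fE.
by rewrite (linearP (wedge s)) (linearZ_LR (wedge s)) subrr.
Qed.

Definition Phi0 : Kpres -> wedge2 W2 := qlift Phi0_subproof.
HB.instance Definition _ := GRing.Linear.on Phi0.

Lemma Phi0E k1 k2 (h : is_gen k1 k2) : Phi0 (symb h) = wedge k1 k2.
Proof. exact: etrans (qliftE _ _) (flift_fsymb h). Qed.

Lemma Phi0_ker u : Phi0 u \in kerp (@contr2 g).
Proof.
have [v ->] := qpi_surj u; elim/malg_lin_ind: v => [|a v w Pv Pw|[[k1 k2] h]].
- by rewrite !linear0 rpred0.
- rewrite (linearP (qpi Krel)) (linearP Phi0).
  exact: ((kerp_submod (@contr2 g)).2 a _ _ Pv Pw).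
have /asboolP [/= o12 _] := h; rewrite inE; apply/eqP.
apply: etrans o12; rewrite -contr2E; congr (contr2 _).
have -> : << (exist _ (k1, k2) h : gen) >> = fsymb (asboolW h)
    :> {malg rat[gen]}.
  by rewrite fsymb.unlock; congr (<< exist _ _ _ >>); exact: bool_irrelevance.
exact: etrans (qliftE _ _) (flift_fsymb _).
Qed.

(* The linearization map; [PhiE] is its formula on generators. *)
Definition Phi (u : Kpres) : symker := exist _ (Phi0 u) (Phi0_ker u).

Lemma Phi_is_linear : linear Phi.
Proof. by move=> a u v; apply: val_inj; rewrite linearP /= linearP. Qed.
HB.instance Definition _ :=
  GRing.isLinear.Build rat Kpres symker _ Phi Phi_is_linear.

Lemma PhiE k1 k2 (h : is_gen k1 k2) : val (Phi (symb h)) = wedge k1 k2.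
Proof. exact: Phi0E. Qed.

End Linearization.

(* Main.v *)
(* Write [M] for the presented space.  The relations make the symbol
   [ph p q u w] of [wedgeW p q] and [wedgeW u w], for an integral pair [p, q] and
   [u, w] orthogonal to it, bilinear alternating in [u, w].  The point
   is to extend these symbols to a form [B x y z w] with values in [M], linear in
   each variable.

   For fixed [x, y] the values [- ph p q x y] at the integral pairs [p, q]
   orthogonal to [x, y] come from a bilinear alternating form on the orthogonal
   of [x, y]: for integral [v] dual to [x], rewriting [y] as a multiple of [v]
   plus a vector [r] orthogonal to [x] expresses them through the symbols of the
   pairs [x, v] and [x, v + r] on the orthogonal of [x, y, v], and six such forms
   glue.  This gives a function of orthogonal quadruples ([x, y] orthogonal to
   [z, w]), linear in each variable.  In dimension at least 8 such a function,
   whatever its target, is the restriction of a multilinear form: subtract forms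
   until it vanishes on the quadruples built from a frame, then show that this
   vanishing is stable under elementary transvections and so holds everywhere.

   Antisymmetrized, [B] kills the bivector [omega2], hence descends to a left
   inverse of the linearization map.  For surjectivity, apply the same kind of
   argument to [wedge (wedgeW x y) (wedgeW z w)] modulo the image: it vanishes on
   orthogonal quadruples, which forces it to be a combination of partial traces,
   that is, to factor through the symmetric contraction. *)

Require Import Defs.
From HB Require Import structures.
From mathcomp Require Import all_boot all_order all_algebra.
From mathcomp Require Import finmap boolp classical_sets monalg.
From mathcomp Require Import ring.

Set Implicit Arguments.
Unset Strict Implicit.
Unset Printing Implicit Defensive.

Import Order.TTheory GRing.Theory Num.Theory.

Local Open Scope ring_scope.

(** * Identities between linear combinations *)

(** Integrality is the obstacle: a pair [[x, y]] that is not integral has no symbol, and the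
    relations are linear only against a fixed symplectic pair. The remedy is uniqueness: an
    alternating form on the orthogonal of a list of vectors is determined by its values on integral
    pairs, as soon as that orthogonal contains one. Hence forms found for each [[x, y]] separately
    are automatically linear in [[x, y]]. The ground field matters too. If a field has a nonzero
    derivation [d], the sum of the [x_i * d z_i] is linear in each variable on orthogonal pairs and
    vanishes at all pairs with coordinates 0, 1, -1, but it is not zero. The rationals have no such
    derivation. The bound on [g] is room: it provides an integral pair orthogonal to three given
    vectors, or to four when two of them form an integral pair; four orthogonal hyperbolic planes
    supply the six dual vectors of the gluing; and dimension 8 leaves fresh indices in a frame. *)

Inductive mexp := MVar of nat | MZero | MAdd of mexp & mexp | MOpp of mexp
  | MScale of rat & mexp.

Section LinearReflection.
Variable M : lmodType rat.

Fixpoint meval (env : seq M) t : M :=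
  match t with
  | MVar i => nth 0 env i
  | MZero => 0
  | MAdd a b => meval env a + meval env b
  | MOpp a => - meval env a
  | MScale k a => k *: meval env a
  end.

Fixpoint mcoef t (i : nat) : rat :=
  match t with
  | MVar j => if eqn i j then 1 else 0
  | MZero => 0
  | MAdd a b => mcoef a i + mcoef b i
  | MOpp a => - mcoef a i
  | MScale k a => k * mcoef a i
  end.

Lemma meval_coef env t :
  meval env t = \sum_(i < size env) mcoef t i *: nth 0 env i.
Proof.
have eE i j : eqn i j = (i == j) by [].
elim: t => [j||a IHa c IHc|a IHa|k a IHa] /=; rewrite ?IHa ?IHc.
- have [ltj|gej] := ltnP j (size env).
    rewrite (bigD1 (Ordinal ltj)) //= eE eqxx scale1r big1 ?addr0 // => i.
    by rewrite -val_eqE /= eE => /negPf ->; rewrite scale0r.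
  rewrite nth_default // big1 // => i _; rewrite eE ltn_eqF ?scale0r //.
  exact: leq_trans gej.
- by rewrite big1 // => i _; rewrite scale0r.
- by rewrite -big_split; apply: eq_bigr => i _; rewrite scalerDl.
- by rewrite -sumrN; apply: eq_bigr => i _; rewrite scaleNr.
- by rewrite scaler_sumr; apply: eq_bigr => i _; rewrite scalerA.
Qed.

Fixpoint mcoef_eq n t u : Prop :=
  if n is m.+1 then mcoef t m = mcoef u m /\ mcoef_eq m t u else True.

Lemma meval_eq env t u : mcoef_eq (size env) t u -> meval env t = meval env u.
Proof.
rewrite !meval_coef => E; apply: eq_bigr => -[i /= lti] _; congr (_ *: _).
elim: (size env) lti E => //= m IHm; rewrite ltnS leq_eqVlt.
by case/predU1P => [-> []//|lti [_ /(IHm lti)]].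
Qed.

End LinearReflection.

Ltac midx x env :=
  lazymatch env with
  | x :: _ => constr:(0%N)
  | _ :: ?r => let k := midx x r in constr:(S k)
  end.
Ltac mvars t env :=
  lazymatch t with
  | (?a + ?b)%R => let env := mvars a env in mvars b env
  | (- ?a)%R => mvars a env
  | (_ *: ?a)%R => mvars a env
  | 0%R => env
  | _ => lazymatch env with
         | context [t :: _] => env
         | _ => constr:(t :: env)
         end
  end.
Ltac mreify t env :=
  lazymatch t with
  | (?a + ?b)%R => let a := mreify a env in let b := mreify b env in constr:(MAdd a b)
  | (- ?a)%R => let a := mreify a env in constr:(MOpp a)
  | (?k *: ?a)%R => let a := mreify a env in constr:(MScale k a)
  | 0%R => constr:(MZero)
  | _ => let i := midx t env in constr:(MVar i)
  end.
(* [ring] does not apply to modules: compare the coefficients of each atom. *)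
Ltac lmod :=
  lazymatch goal with
  | |- ?t = ?u =>
    let T := type of t in
    let env := mvars t (@nil T) in
    let env := mvars u env in
    let t' := mreify t env in
    let u' := mreify u env in
    apply: (@meval_eq _ env t' u'); rewrite /=; repeat split; try by [|ring|field]
  end.

(** * Functions of orthogonal quadruples *)

(* [G] is a function on orthogonal pairs in dimension 3.  The values
   [r c] at the pairs [e1 + c e3, c f1 - f3] satisfy the Leibniz rule
   [r (k c) = k r c + c r k] and [r (1 + c) = r c], hence [r] is a derivation of
   [rat] and vanishes. *)
Lemma tri_vanish (M : lmodType rat)
    (G : rat -> rat -> rat -> rat -> rat -> rat -> M) :
  (forall k a b c a' b' c' r s t,
     a * r + b * s + c * t = 0 -> a' * r + b' * s + c' * t = 0 ->
     G (k * a + a') (k * b + b') (k * c + c') r s t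
     = k *: G a b c r s t + G a' b' c' r s t) ->
  (forall k a b c r s t r' s' t',
     a * r + b * s + c * t = 0 -> a * r' + b * s' + c * t' = 0 ->
     G a b c (k * r + r') (k * s + s') (k * t + t')
     = k *: G a b c r s t + G a b c r' s' t') ->
  G 1 0 0 0 1 0 = 0 -> G 1 0 0 0 0 1 = 0 -> G 0 1 0 1 0 0 = 0 ->
  G 0 1 0 0 0 1 = 0 -> G 0 0 1 1 0 0 = 0 -> G 0 0 1 0 1 0 = 0 ->
  G 1 1 0 1 (-1) 0 = 0 -> G 1 0 1 1 0 (-1) = 0 -> G 0 1 1 0 1 (-1) = 0 ->
  forall a b, G a b 0 b (- a) 0 = 0.
Proof.
move=> HL0 HR0 g12 g13 g21 g23 g31 g32 d12 d13 d23.
have HL k a b c a' b' c' a'' b'' c'' r s t :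
    a'' = k * a + a' -> b'' = k * b + b' -> c'' = k * c + c' ->
    a * r + b * s + c * t = 0 -> a' * r + b' * s + c' * t = 0 ->
    G a'' b'' c'' r s t = k *: G a b c r s t + G a' b' c' r s t.
  by move=> -> -> ->; exact: HL0.
have HR k a b c r s t r' s' t' r'' s'' t'' :
    r'' = k * r + r' -> s'' = k * s + s' -> t'' = k * t + t' ->
    a * r + b * s + c * t = 0 -> a * r' + b * s' + c * t' = 0 ->
    G a b c r'' s'' t'' = k *: G a b c r s t + G a b c r' s' t'.
  by move=> -> -> ->; exact: HR0.
clear HL0.
have ZL r s t : G 0 0 0 r s t = 0.
  have := HL 1 0 0 0 0 0 0 0 0 0 r s t.
  rewrite scale1r => H; apply/(addrI (G 0 0 0 r s t)).
  by rewrite addr0 -H //; ring.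
have ZR a b c : G a b c 0 0 0 = 0.
  have := HR 1 a b c 0 0 0 0 0 0 0 0 0.
  rewrite scale1r => H; apply/(addrI (G a b c 0 0 0)).
  by rewrite addr0 -H //; ring.
have SL k a b c r s t : a * r + b * s + c * t = 0 ->
    G (k * a) (k * b) (k * c) r s t = k *: G a b c r s t.
  by move=> o; rewrite (HL k a b c 0 0 0) ?ZL ?addr0 //; ring.
have SR k a b c r s t : a * r + b * s + c * t = 0 ->
    G a b c (k * r) (k * s) (k * t) = k *: G a b c r s t.
  by move=> o; rewrite (HR k a b c r s t 0 0 0) ?ZR ?addr0 //; ring.
have e1 s t : G 1 0 0 0 s t = 0.
  rewrite (HR s 1 0 0 0 1 0 0 0 t); [|ring..].
  rewrite g12 scaler0 add0r -[X in G _ _ _ X](mulr0 t) -[X in G _ _ _ _ X](mulr0 t).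
  by rewrite -[X in G _ _ _ _ _ X](mulr1 t) SR ?g13 ?scaler0 //; ring.
have e2 r t : G 0 1 0 r 0 t = 0.
  rewrite (HR r 0 1 0 1 0 0 0 0 t); [|ring..].
  rewrite g21 scaler0 add0r -[X in G _ _ _ X](mulr0 t) -[X in G _ _ _ _ X](mulr0 t).
  by rewrite -[X in G _ _ _ _ _ X](mulr1 t) SR ?g23 ?scaler0 //; ring.
have e3 r s : G 0 0 1 r s 0 = 0.
  rewrite (HR r 0 0 1 1 0 0 0 s 0); [|ring..].
  rewrite g31 scaler0 add0r -[X in G _ _ _ X](mulr0 s) -[X in G _ _ _ _ _ X](mulr0 s).
  by rewrite -[X in G _ _ _ _ X](mulr1 s) SR ?g32 ?scaler0 //; ring.
pose q12 a b := G a b 0 b (- a) 0.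
pose q13 a c := G a 0 c c 0 (- a).
pose q23 b c := G 0 b c 0 c (- b).
have h13 a b c : G a b c c 0 (- a) = q13 a c.
  rewrite (HL b 0 1 0 a 0 c) ?e2 ?scaler0 ?add0r //; ring.
have h12 a b c : G a b c b (- a) 0 = q12 a b.
  rewrite (HL c 0 0 1 a b 0) ?e3 ?scaler0 ?add0r //; ring.
have h23 a b c : G a b c 0 c (- b) = q23 b c.
  rewrite (HL a 1 0 0 0 b c) ?e1 ?scaler0 ?add0r //; ring.
(* The vector [(a, b, c)] is orthogonal to its three cross vectors, and these satisfy [c (b, -a, 0)
   + a (0, c, -b) = b (c, 0, -a)]. *)
have R1 a b c : c *: q12 a b + a *: q23 b c = b *: q13 a c.
  rewrite -(h12 a b c) -(h23 a b c) -(h13 a b c).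
  rewrite -(SR a) -?(SR b); [|ring..].
  by rewrite -HR0; [congr (G _ _ _ _ _ _); ring | ring | ring].
have hom12 k a b : q12 (k * a) (k * b) = (k * k) *: q12 a b.
  rewrite /q12 -scalerA -SR -?SL; [|ring..].
  by congr (G _ _ _ _ _ _); ring.
have hom23 k a b : q23 (k * a) (k * b) = (k * k) *: q23 a b.
  rewrite /q23 -scalerA -SR -?SL; [|ring..].
  by congr (G _ _ _ _ _ _); ring.
pose r c := q13 1 c.
have E23 c : q23 1 c = r c.
  by have := R1 1 1 c; rewrite (_ : q12 1 1 = 0) // !scale1r scaler0 add0r.
have r12 c : q12 1 c = r c.
  have [->|nz] := eqVneq c 0.
    by rewrite /q12 /r /q13 !e1.
  have := R1 1 c c; rewrite scale1r.
  have -> : q23 c c = 0.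
    by rewrite -[c]mulr1 hom23 /q23 d23 scaler0.
  by rewrite addr0 => /(scalerI nz).
have E23' b c : q23 b c = b *: r c - c *: r b.
  by rewrite -[X in _ = _ - _ *: X]r12 -(R1 1 b c) scale1r addrC addKr.
have E1 s : r (- s) + r (1 + s) = 0.
  (* One value, two splittings. On the right, [(s, -1-s, 1) = s (1, -1, 0) + (0, -1, 1)] gives 0; on
     the left, [(1, 1, 1) = (1, 0, -s) + (0, 1, 1+s)] gives [- r (-s) - r (1+s)]. *)
  have k0 : G 1 1 1 s (-1 - s) 1 = 0.
    rewrite (HR s 1 1 1 1 (-1) 0 0 (-1) 1); [|ring..].
    rewrite (HL 1 0 0 1 1 1 0); [|ring..].
    rewrite d12 e3 scaler0 add0r scaler0 add0r.
    rewrite (HL 1 1 0 0 0 1 1); [|ring..].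
    rewrite e1 scaler0 add0r.
    have -> : G 0 1 1 0 (-1) 1 = - 1 *: G 0 1 1 0 1 (-1).
      by rewrite -SR; [congr (G _ _ _ _ _ _); ring | ring].
    by rewrite d23 scaler0.
  have : - r (- s) - r (1 + s) = 0.
    rewrite -k0 (HL 1 1 0 (- s) 0 1 (1 + s)); [|ring..].
    rewrite scale1r; congr (_ + _).
      rewrite (HR (-1 - s) 1 0 (- s) 0 1 0 s 0 1); [|ring..].
      rewrite [X in _ *: X + _](_ : _ = 0) ?scaler0 ?add0r.
        rewrite /r /q13 -scaleN1r -SR; [|ring..].
        by congr (G _ _ _ _ _ _); ring.
      rewrite (HL (- s) 0 0 1 1 0 0); [|ring..].
      by rewrite e3 e1 scaler0 addr0.
    rewrite (HR s 0 1 (1 + s) 1 0 0 0 (- 1 - s) 1); [|ring..].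
    rewrite [X in _ *: X + _](_ : _ = 0) ?scaler0 ?add0r.
      rewrite -E23 /q23 -scaleN1r -SR; [|ring..].
      by congr (G _ _ _ _ _ _); ring.
    rewrite (HL (1 + s) 0 0 1 0 1 0); [|ring..].
    by rewrite e3 e2 scaler0 addr0.
  by move/eqP; rewrite -opprD oppr_eq0 => /eqP.
have rM k c : k != 0 -> r (k * c) = k *: r c + c *: r k.
  move=> nz; apply: (scalerI nz); rewrite scalerDr scalerA [k *: (c *: _)]scalerA.
  have := hom23 k 1 c; rewrite mulr1 E23' E23 => /eqP.
  by rewrite subr_eq => /eqP.
have r1 : r 1 = 0 by rewrite /r /q13 d13.
have rN1 : r (-1) = 0.
  have /esym := @rM (-1) (-1) isT; rewrite mulrNN mulr1 r1 -scalerDl => /eqP.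
  by rewrite scaler_eq0 => /orP[/eqP//|/eqP].
have rN c : r (- c) = - r c.
  by rewrite -mulN1r rM // rN1 scaler0 addr0 scaleN1r.
have rS s : r (1 + s) = r s.
  by apply/eqP; rewrite -subr_eq0 -rN addrC E1.
have rn (n : nat) : r n%:R = 0.
  elim: n => [|n IHn]; last by rewrite -natr1 addrC rS.
  by rewrite -[RHS]r1 -[X in _ = r X]addr0 rS.
have rz (z : int) : r z%:~R = 0.
  by case: z => n; [exact: rn | rewrite NegzE rmorphN /= rN rn oppr0].
have r0 c : r c = 0.
  have nz : (denq c)%:~R != 0 :> rat by rewrite intr_eq0 denq_neq0.
  have := @rM (denq c)%:~R c nz; rewrite rz scaler0 addr0.
  by rewrite mulrC -numqE rz => /esym/eqP; rewrite scaler_eq0 (negPf nz) => /eqP.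
move=> a b; have [->|nz] := eqVneq a 0.
  rewrite oppr0 -[X in G X](mulr0 b) -[X in G _ _ X](mulr0 b) -{2}[b]mulr1 SL; last by ring.
  by rewrite e2 scaler0.
rewrite -/(q12 a b).
have -> : q12 a b = q12 (a * 1) (a * (b / a)) by rewrite mulr1 mulrC divfK.
by rewrite hom12 r12 r0 scaler0.
Qed.

Lemma fresh_ord n (s : seq 'I_n) : (size s < n)%N -> exists m, m \notin s.
Proof.
move=> lt_sn; apply/existsP; apply: contraLR lt_sn.
rewrite negb_exists -leqNgt => /forallP s_all.
apply: (@leq_trans #|s|); last exact: card_size.
rewrite -[X in (X <= _)%N](card_ord n); apply/subset_leq_card/fintype.subsetP => i _.
by have := s_all i; rewrite negbK.
Qed.

Ltac neqs U :=
  move: U; rewrite /= !inE ?negb_or ?andbT;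
  repeat match goal with
  | |- is_true (_ && _) -> _ => let H := fresh in let K := fresh in
      move=> /andP[H K]; move: H K
  | |- is_true (?a != ?c) -> _ => let H := fresh "ne" in
      move=> H; have [] := (negPf H, etrans (eq_sym c a) (negPf H));
      clear H
  | |- _ = false -> _ => let H := fresh "ne" in move=> H
  end.

Ltac simpneq :=
  rewrite ?eqxx;
  repeat match goal with H : (?a == ?c) = false |- context[?a == ?c] =>
    rewrite H end;
  rewrite /= ?mulr0n ?mulr1n.

Ltac bothneq := repeat match goal with
  H : (?a == ?c) = false |- _ => lazymatch goal with
    | K : (c == a) = false |- _ => fail
    | _ => let K := fresh "ne" in have K := etrans (eq_sym c a) H
    end end.
Ltac uq := first [assumption | by rewrite /= ?inE; simpneq].
Ltac fresh_index m s :=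
  lazymatch goal with n8 : is_true (7 < ?n)%N |- _ =>
    have [m] := @fresh_ord n s (leq_trans (isT : is_true (size s < 8)%N) n8) end.

Section OrthForms.
Variables (A C M : lmodType rat).

Section Pairing.
Variable b : A -> C -> rat.

Definition perp4 x y z w :=
  [&& b x z == 0, b x w == 0, b y z == 0 & b y w == 0].

(** [F] is total, but its values matter only at orthogonal quadruples. The two sides are different
    modules, so that exchanging [[x, y]] and [[z, w]] amounts to transposing the pairing. *)
Record orthlin (F : A -> A -> C -> C -> M) : Prop := OrthLin {
  orthlinl : forall k x x' y z w, perp4 x y z w -> perp4 x' y z w ->
    F (k *: x + x') y z w = k *: F x y z w + F x' y z w;
  orthlinlC : forall x y z w, perp4 x y z w -> F y x z w = - F x y z w;
  orthlinr : forall k x y z z' w, perp4 x y z w -> perp4 x y z' w ->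
    F x y (k *: z + z') w = k *: F x y z w + F x y z' w;
  orthlinrC : forall x y z w, perp4 x y z w -> F x y w z = - F x y z w }.

Record frame n (e : 'I_n -> A) (f : 'I_n -> C) : Prop := Frame {
  frameE : forall i j, b (e i) (f j) = (i == j)%:R;
  framel : forall x, x = \sum_i b x (f i) *: e i;
  framer : forall z, z = \sum_i b (e i) z *: f i }.

End Pairing.

Section Forms.
Variable b : A -> C -> rat.
Hypothesis bb : (forall z, scalar (b^~ z)) /\ (forall x, scalar (b x)).
Let bl := bb.1.
Let br := bb.2.

Lemma pair0l z : b 0 z = 0.
Proof. by have /= := bl z (-1) 0 0; rewrite scaler0 addr0 mulN1r addNr. Qed.
Lemma pair0r x : b x 0 = 0.
Proof. by have /= := br x (-1) 0 0; rewrite scaler0 addr0 mulN1r addNr. Qed.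
Lemma pairZl k x z : b (k *: x) z = k * b x z.
Proof. by rewrite -[k *: x]addr0 bl pair0l addr0. Qed.
Lemma pairZr k x z : b x (k *: z) = k * b x z.
Proof. by rewrite -[k *: z]addr0 br pair0r addr0. Qed.
Lemma pairDl x y z : b (x + y) z = b x z + b y z.
Proof. by rewrite -{1}[x]scale1r bl mul1r. Qed.
Lemma pairDr x y z : b x (y + z) = b x y + b x z.
Proof. by rewrite -{1}[y]scale1r br mul1r. Qed.
Lemma pairNl x z : b (- x) z = - b x z.
Proof. by rewrite -scaleN1r pairZl mulN1r. Qed.
Lemma pairNr x z : b x (- z) = - b x z.
Proof. by rewrite -scaleN1r pairZr mulN1r. Qed.
Lemma pair_suml I (r : seq I) P (X : I -> A) z :
  b (\sum_(i <- r | P i) X i) z = \sum_(i <- r | P i) b (X i) z.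
Proof. by elim/big_rec2: _ => [|i u v _ <-]; rewrite ?pair0l ?pairDl. Qed.
Lemma pair_sumr I (r : seq I) P x (Z : I -> C) :
  b x (\sum_(i <- r | P i) Z i) = \sum_(i <- r | P i) b x (Z i).
Proof. by elim/big_rec2: _ => [|i u v _ <-]; rewrite ?pair0r ?pairDr. Qed.

Definition pairE :=
  (pairDl, pairDr, pairZl, pairZr, pairNl, pairNr, pair0l, pair0r).

Variable F : A -> A -> C -> C -> M.
Hypothesis olF : orthlin b F.

Lemma perp4Cl x y z w : perp4 b y x z w = perp4 b x y z w.
Proof. by rewrite /perp4; apply/idP/idP => /and4P[-> -> -> ->]. Qed.
Lemma perp4Cr x y z w : perp4 b x y w z = perp4 b x y z w.
Proof. by rewrite /perp4; apply/idP/idP => /and4P[-> -> -> ->]. Qed.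

Lemma orthlin2 k x x' y z w : perp4 b y x z w -> perp4 b y x' z w ->
  F y (k *: x + x') z w = k *: F y x z w + F y x' z w.
Proof.
move=> o o'; have o1 : perp4 b x y z w by rewrite perp4Cl.
have o2 : perp4 b x' y z w by rewrite perp4Cl.
have o2p : perp4 b (k *: x + x') y z w.
  move: o1 o2 => /and4P[/eqP a1 /eqP a2 a3 a4] /and4P[/eqP b1 /eqP b2 _ _].
  by rewrite /perp4 !pairE a1 a2 b1 b2 a3 a4 mulr0 addr0 eqxx.
rewrite (orthlinlC olF o2p) (orthlinl olF) // (orthlinlC olF o1) (orthlinlC olF o2).
by rewrite scalerN opprD.
Qed.

Lemma orthlin4 k x y z w w' : perp4 b x y z w -> perp4 b x y z w' ->
  F x y z (k *: w + w') = k *: F x y z w + F x y z w'.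
Proof.
move=> o o'; have o1 : perp4 b x y w z by rewrite perp4Cr.
have o2 : perp4 b x y w' z by rewrite perp4Cr.
have o2p : perp4 b x y (k *: w + w') z.
  move: o1 o2 => /and4P[/eqP a1 a2 /eqP a3 a4] /and4P[/eqP b1 _ /eqP b3 _].
  by rewrite /perp4 !pairE a1 a3 b1 b3 a2 a4 mulr0 addr0 eqxx.
rewrite (orthlinrC olF o2p) (orthlinr olF) // (orthlinrC olF o1) (orthlinrC olF o2).
by rewrite scalerN opprD.
Qed.

(** Bundling orthogonality with vanishing makes null quadruples stable under combinations in each
    slot, without orthogonality side conditions. *)
Definition null4 x y z w := perp4 b x y z w /\ F x y z w = 0.

Lemma null4l x y z w : null4 x y z w -> null4 y x z w.
Proof.
case=> o F0; split; last by rewrite (orthlinlC olF) // F0 oppr0.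
by move: o; rewrite /perp4 => /and4P[-> -> -> ->].
Qed.

Lemma null4r x y z w : null4 x y z w -> null4 x y w z.
Proof.
case=> o F0; split; last by rewrite (orthlinrC olF) // F0 oppr0.
by move: o; rewrite /perp4 => /and4P[-> -> -> ->].
Qed.

Lemma null40l y z w : b y z = 0 -> b y w = 0 -> null4 0 y z w.
Proof.
move=> yz yw; have o : perp4 b 0 y z w by rewrite /perp4 !pairE yz yw eqxx.
split=> //; have := orthlinl olF 1 o o; rewrite scaler0 add0r scale1r => H.
by apply: (addrI (F 0 y z w)); rewrite addr0 -H.
Qed.

Lemma null40r x y w : b x w = 0 -> b y w = 0 -> null4 x y 0 w.
Proof.
move=> xw yw; have o : perp4 b x y 0 w by rewrite /perp4 !pairE xw yw eqxx.
split=> //; have := orthlinr olF 1 o o; rewrite scaler0 add0r scale1r => H.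
by apply: (addrI (F x y 0 w)); rewrite addr0 -H.
Qed.

Lemma orthlinZ2 k x y z w : perp4 b x y z w -> F x (k *: y) z w = k *: F x y z w.
Proof.
move=> o; have /and4P[/eqP xz /eqP xw _ _] := o.
have [o0 F0] := null4l (null40l xz xw).
by rewrite -[k *: y]addr0 orthlin2 // F0 addr0.
Qed.

Lemma orthlinZ3 k x y z w : perp4 b x y z w -> F x y (k *: z) w = k *: F x y z w.
Proof.
move=> o; have /and4P[_ /eqP xw _ /eqP yw] := o.
have [o0 F0] := null40r xw yw.
by rewrite -[k *: z]addr0 (orthlinr olF) // F0 addr0.
Qed.

Lemma orthlinZ4 k x y z w : perp4 b x y z w -> F x y z (k *: w) = k *: F x y z w.
Proof.
move=> o; have /and4P[/eqP xz _ /eqP yz _] := o.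
have [o0 F0] := null4r (null40r xz yz).
by rewrite -[k *: w]addr0 orthlin4 // F0 addr0.
Qed.

Lemma null4Pl k x x' y z w :
  null4 x y z w -> null4 x' y z w -> null4 (k *: x + x') y z w.
Proof.
move=> [o F0] [o' F0']; split; last by rewrite (orthlinl olF) // F0 F0' scaler0 addr0.
move: o o' => /and4P[/eqP a1 /eqP a2 a3 a4] /and4P[/eqP b1 /eqP b2 b3 b4].
by rewrite /perp4 !pairE a1 a2 b1 b2 mulr0 addr0 eqxx a3 a4.
Qed.

Lemma null4Pr k x y z z' w :
  null4 x y z w -> null4 x y z' w -> null4 x y (k *: z + z') w.
Proof.
move=> [o F0] [o' F0']; split; last by rewrite (orthlinr olF) // F0 F0' scaler0 addr0.
move: o o' => /and4P[/eqP a1 a2 /eqP a3 a4] /and4P[/eqP b1 b2 /eqP b3 b4].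
by rewrite /perp4 !pairE a1 a3 b1 b3 mulr0 addr0 eqxx a2 a4.
Qed.

Lemma null4_perp x y z w : null4 x y z w ->
  [/\ b x z = 0, b x w = 0, b y z = 0 & b y w = 0].
Proof. by case=> /and4P[/eqP ? /eqP ? /eqP ? /eqP ?] _; split. Qed.

Lemma null4Zl k x y z w : null4 x y z w -> null4 (k *: x) y z w.
Proof.
move=> N; rewrite -[k *: x]addr0; apply: null4Pl => //.
by have [_ _ ? ?] := null4_perp N; exact: null40l.
Qed.

Lemma null4Zr k x y z w : null4 x y z w -> null4 x y (k *: z) w.
Proof.
move=> N; rewrite -[k *: z]addr0; apply: null4Pr => //.
by have [_ ? _ ?] := null4_perp N; exact: null40r.
Qed.

Lemma null4_lin1 k k' x x' x'' y z w : x'' = k *: x + k' *: x' ->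
  null4 x y z w -> null4 x' y z w -> null4 x'' y z w.
Proof. by move=> -> N N'; apply: null4Pl => //; exact: null4Zl. Qed.

Lemma null4_lin2 k k' x x' x'' y z w : x'' = k *: x + k' *: x' ->
  null4 y x z w -> null4 y x' z w -> null4 y x'' z w.
Proof. by move=> E /null4l N /null4l N'; apply/null4l/(null4_lin1 E). Qed.

Lemma null4_lin3 k k' x y z z' z'' w : z'' = k *: z + k' *: z' ->
  null4 x y z w -> null4 x y z' w -> null4 x y z'' w.
Proof. by move=> -> N N'; apply: null4Pr => //; exact: null4Zr. Qed.

Lemma null4_lin4 k k' x y z z' z'' w : z'' = k *: z + k' *: z' ->
  null4 x y w z -> null4 x y w z' -> null4 x y w z''.
Proof. by move=> E /null4r N /null4r N'; apply/null4r/(null4_lin3 E). Qed.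

Lemma null4_sum2 I (r : seq I) (P : pred I) (c : I -> rat) (Y : I -> A) x z w :
  b x z = 0 -> b x w = 0 ->
  (forall i, P i -> c i = 0 \/ null4 x (Y i) z w) ->
  null4 x (\sum_(i <- r | P i) c i *: Y i) z w.
Proof.
move=> xz xw N; elim/big_rec: _ => [|i u Pi Nu].
  by apply/null4l/null40l.
case: (N i Pi) => [->|Ni]; first by rewrite scale0r add0r.
by apply: (@null4_lin2 (c i) 1 (Y i) u) => //; rewrite scale1r.
Qed.

Lemma null4_sum3 I (r : seq I) (P : pred I) (c : I -> rat) (Z : I -> C) x y w :
  b x w = 0 -> b y w = 0 ->
  (forall i, P i -> c i = 0 \/ null4 x y (Z i) w) ->
  null4 x y (\sum_(i <- r | P i) c i *: Z i) w.
Proof.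
move=> xw yw N; elim/big_rec: _ => [|i u Pi Nu].
  by apply/null40r.
case: (N i Pi) => [->|Ni]; first by rewrite scale0r add0r.
by apply: (@null4_lin3 (c i) 1 _ _ (Z i) u) => //; rewrite scale1r.
Qed.

Lemma null4_altl x z w : b x z = 0 -> b x w = 0 -> null4 x x z w.
Proof.
move=> xz xw; have o : perp4 b x x z w by rewrite /perp4 xz xw eqxx.
split=> //; have /eqP := orthlinlC olF o; rewrite -addr_eq0 -mulr2n -scaler_nat.
by rewrite scaler_eq0 pnatr_eq0 => /eqP.
Qed.

Lemma null4_altr x y z : b x z = 0 -> b y z = 0 -> null4 x y z z.
Proof.
move=> xz yz; have o : perp4 b x y z z by rewrite /perp4 xz yz eqxx.
split=> //; have /eqP := orthlinrC olF o; rewrite -addr_eq0 -mulr2n -scaler_nat.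
by rewrite scaler_eq0 pnatr_eq0 => /eqP.
Qed.

Definition goodl x := forall y z w, perp4 b x y z w -> null4 x y z w.
Definition goodr z := forall x y w, perp4 b x y z w -> null4 x y z w.

Variables (n : nat) (e : 'I_n -> A) (f : 'I_n -> C).
Hypothesis fr : frame b e f.

Lemma frame_eql x x' : (forall j, b x (f j) = b x' (f j)) -> x = x'.
Proof.
by move=> E; rewrite (framel fr x) (framel fr x'); apply: eq_bigr => j _; rewrite E.
Qed.
Lemma frame_eqr z z' : (forall j, b (e j) z = b (e j) z') -> z = z'.
Proof.
by move=> E; rewrite (framer fr z) (framer fr z'); apply: eq_bigr => j _; rewrite E.
Qed.

Lemma frame_pair y z : b y z = \sum_j b y (f j) * b (e j) z.
Proof.
by rewrite {1}(framer fr z) pair_sumr; apply: eq_bigr => j _; rewrite pairZr mulrC.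
Qed.

(** The two-index vectors [y_i f_j - y_j f_i] span the orthogonal of [y] once [y_i] is nonzero. This
    is how right arguments are cut down to few indices. *)
Lemma frame_perpr y z i : b y z = 0 -> b y (f i) != 0 ->
  z = \sum_j (b (e j) z / b y (f i)) *: (b y (f i) *: f j - b y (f j) *: f i).
Proof.
move=> yz nz; under eq_bigr do rewrite scalerBr !scalerA divfK // mulrAC.
rewrite sumrB -(framer fr z) -scaler_suml -mulr_suml.
have -> : \sum_j b (e j) z * b y (f j) = 0.
  by rewrite -[RHS]yz (frame_pair y z); apply: eq_bigr => j _; rewrite mulrC.
by rewrite mul0r scale0r subr0.
Qed.

Ltac pperp := rewrite /perp4; apply/and4P; split; apply/eqP;
  rewrite ?pairE ?(frameE fr); simpneq; try ring.
Ltac veql := let j := fresh "jj" in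
  apply: frame_eql => j; rewrite ?pairE; ring.
Ltac veqr := let j := fresh "jj" in
  apply: frame_eqr => j; rewrite ?pairE; ring.

(** For fixed [y] and [w], restricting the other two arguments to the spans of three frame vectors
    gives a function as in [tri_vanish]. The index [m] is absent from the conclusion but supplies
    the third dimension: in dimension 2 orthogonality leaves only homogeneity. *)
Lemma null4_scale i k m y w : uniq [:: i; k; m] ->
  (forall a c, a \in [:: i; k; m] -> c \in [:: i; k; m] -> a != c ->
     null4 (e a) y (f c) w) ->
  (forall a c, a \in [:: i; k; m] -> c \in [:: i; k; m] -> a != c ->
     null4 (e a + e c) y (f a - f c) w) ->
  forall u v, null4 (u *: e i + v *: e k) y (v *: f i - u *: f k) w.
Proof.
move=> U N1 N2 u v.
have ni : i \in [:: i; k; m] by rewrite !inE eqxx.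
have nk : k \in [:: i; k; m] by rewrite !inE eqxx orbT.
have nm : m \in [:: i; k; m] by rewrite !inE eqxx !orbT.
have U' := U; neqs U'.
have N1' a c ha hc (h : (a == c) = false) := N1 a c ha hc (negbT h).
have N2' a c ha hc (h : (a == c) = false) := N2 a c ha hc (negbT h).
have [_ iw yk yw] := null4_perp (N1' i k ni nk ltac:(assumption)).
have [_ kw yi _] := null4_perp (N1' k i nk ni ltac:(assumption)).
have [_ mw _ _] := null4_perp (N1' m i nm ni ltac:(assumption)).
have [_ _ ym _] := null4_perp (N1' i m ni nm ltac:(assumption)).
split.
  by pperp; rewrite ?iw ?kw ?mw ?yi ?yk ?ym ?yw; ring.
pose X a c d := a *: e i + c *: e k + d *: e m.
pose Z a c d := a *: f i + c *: f k + d *: f m.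
have oXZ a c d r s t : a * r + c * s + d * t = 0 ->
    perp4 b (X a c d) y (Z r s t) w.
  move=> o; pperp; rewrite ?iw ?kw ?mw ?yi ?yk ?ym ?yw; try ring.
  by rewrite -[RHS]o; ring.
pose G a c d r s t := F (X a c d) y (Z r s t) w.
have eX a c d : a *: e i + c *: e k + d *: e m = X a c d by [].
have E (x x' : A) (z z' : C) : x = x' -> z = z' -> F x' y z' w = 0 ->
    F x y z w = 0 by move=> -> ->.
have := @tri_vanish M G _ _ _ _ _ _ _ _ _ _ _ u v; rewrite /G.
have -> : X u v 0 = u *: e i + v *: e k by rewrite /X scale0r addr0.
have -> : Z v (- u) 0 = v *: f i - u *: f k by rewrite /Z scale0r addr0 scaleNr.
apply.
- move=> c0 a c d a' c' d' r s t o o'; rewrite -(orthlinl olF) ?oXZ //.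
  by congr (F _ _ _ _); rewrite /X; veql.
- move=> c0 a c d r s t r' s' t' o o'; rewrite -(orthlinr olF) ?oXZ //.
  by congr (F _ _ _ _); rewrite /Z; veqr.
- by apply: (E _ (e i) _ (f k)); [rewrite /X; veql | rewrite /Z; veqr | case: (N1' i k)].
- by apply: (E _ (e i) _ (f m)); [rewrite /X; veql | rewrite /Z; veqr | case: (N1' i m)].
- by apply: (E _ (e k) _ (f i)); [rewrite /X; veql | rewrite /Z; veqr | case: (N1' k i)].
- by apply: (E _ (e k) _ (f m)); [rewrite /X; veql | rewrite /Z; veqr | case: (N1' k m)].
- by apply: (E _ (e m) _ (f i)); [rewrite /X; veql | rewrite /Z; veqr | case: (N1' m i)].
- by apply: (E _ (e m) _ (f k)); [rewrite /X; veql | rewrite /Z; veqr | case: (N1' m k)].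
- by apply: (E _ (e i + e k) _ (f i - f k)); [rewrite /X; veql | rewrite /Z; veqr | case: (N2' i k)].
- by apply: (E _ (e i + e m) _ (f i - f m)); [rewrite /X; veql | rewrite /Z; veqr | case: (N2' i m)].
- by apply: (E _ (e k + e m) _ (f k - f m)); [rewrite /X; veql | rewrite /Z; veqr | case: (N2' k m)].
Qed.

Hypothesis n8 : (7 < n)%N.

Definition twisted := forall i k j l, uniq [:: i; k; j; l] ->
  null4 (e i + e k) (e j + e l) (f i - f k) (f j - f l).

(** The invariant carried along by transvections. [twisted] concerns quadruples none of whose
    entries is a frame vector, which the first two clauses do not reach. *)
Definition good_frame :=
  [/\ forall i, goodl (e i), forall i, goodr (f i) & twisted].

Lemma goodlZ k x : goodl x -> goodl (k *: x).
Proof.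
move=> gx y z w; have [->|nz] := eqVneq k 0.
  by rewrite scale0r => /and4P[_ _ /eqP ? /eqP ?]; exact: null40l.
move=> /and4P[xz xw yz yw]; apply/null4Zl/gx; rewrite /perp4 yz yw.
by move: xz xw; rewrite !pairE !mulf_eq0 (negPf nz) /= => -> ->.
Qed.

(** The coefficients are freed one plane at a time, by [null4_scale] with a fresh third index: those
    of [i, k] while the others are 1, then those of [j, l]. *)
Lemma twisted_scale : good_frame -> forall i k j l u v u' v',
  uniq [:: i; k; j; l] ->
  null4 (u *: e i + v *: e k) (u' *: e j + v' *: e l)
        (v *: f i - u *: f k) (v' *: f j - u' *: f l).
Proof.
move=> [gl gr tw] i k j l u v u' v' U.
have S1 j' l' u0 v0 : uniq [:: i; k; j'; l'] ->
    null4 (u0 *: e i + v0 *: e k) (e j' + e l')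
          (v0 *: f i - u0 *: f k) (f j' - f l').
  move=> U1; fresh_index m [:: i; k; j'; l'] => Um.
  have U2 : uniq [:: m; i; k; j'; l'] by rewrite /= in U1 *; rewrite U1 Um.
  clear Um; have U3 := U2; neqs U3.
  apply: (@null4_scale i k m).
  - by rewrite /=; rewrite !inE; simpneq.
  - move=> a c; rewrite !inE => /or3P[]/eqP-> /or3P[]/eqP->; rewrite ?eqxx // => _;
    apply: gl; pperp.
  - move=> a c; rewrite !inE => /or3P[]/eqP-> /or3P[]/eqP->; rewrite ?eqxx // => _;
    apply: tw; by rewrite /= !inE; simpneq.
fresh_index m [:: i; k; j; l] => Um.
have U2 : uniq [:: m; i; k; j; l] by rewrite /= in U *; rewrite U Um.
clear Um; have U3 := U2; neqs U3.
apply/null4l/null4r/(@null4_scale j l m).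
- by rewrite /=; rewrite !inE; simpneq.
- move=> a c; rewrite !inE => /or3P[]/eqP-> /or3P[]/eqP->; rewrite ?eqxx // => _;
  apply: gl; pperp.
- move=> a c; rewrite !inE => /or3P[]/eqP-> /or3P[]/eqP->; rewrite ?eqxx // => _;
  apply/null4l/null4r/S1; by rewrite /= !inE; simpneq.
Qed.

(** Alternation clears first [y_p], by subtracting a multiple of [x], then the coordinate at [p] of
    one right argument, by subtracting a multiple of the other. Orthogonality to [x] then clears its
    coordinate at [q] as well, so it is a combination of vectors [y_i f_j - y_j f_i] with [i, j]
    away from [p, q], or of good [f j]. *)
Lemma goodl_add2 : good_frame -> forall p q a c, p != q ->
  goodl (a *: e p + c *: e q).
Proof.
move=> gf p q a c npq; have [gl gr tw] := gf.
have [->|nza] := eqVneq a 0; first by rewrite scale0r add0r; apply: goodlZ.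
have [->|nzc] := eqVneq c 0; first by rewrite scale0r addr0; apply: goodlZ.
set x := a *: e p + c *: e q.
have Upq : uniq [:: p; q] by rewrite /= inE npq.
have neqs0 := Upq; neqs neqs0.
have xf j : b x (f j) = a * (p == j)%:R + c * (q == j)%:R.
  by rewrite /x !pairE !(frameE fr).
have xE z : b x z = a * b (e p) z + c * b (e q) z by rewrite /x !pairE.
have Ex : x = a *: e p + c *: e q by [].
clearbody x.
have core y w i j : uniq [:: p; q; i; j] -> b y (f p) = 0 ->
    b x w = 0 -> b y w = 0 ->
    null4 x y (b y (f i) *: f j - b y (f j) *: f i) w.
  move=> U yp xw yw; set d := (_ - _).
  have U1 := U; neqs U1.
  have yd : b y d = 0 by rewrite /d !pairE; ring.
  have xd : b x d = 0 by rewrite /d !pairE !xf; simpneq; ring.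
  have epd : b (e p) d = 0 by rewrite /d !pairE !(frameE fr); simpneq; ring.
  have eqd : b (e q) d = 0 by rewrite /d !pairE !(frameE fr); simpneq; ring.
  have [wq0|nzw] := eqVneq (b (e q) w) 0.
    have wp0 : b (e p) w = 0.
      apply/eqP; move/eqP: xw.
      by rewrite xE wq0 mulr0 addr0 mulf_eq0 (negPf nza).
    apply: (null4_lin1 Ex); apply: gl; rewrite /perp4 ?epd ?eqd ?wp0 ?wq0 yd yw eqxx //.
  (* Each [Y k] is orthogonal to [w], and [y] is the sum of the [y_k Y_k] because [y] is: thus [y]
     can be cut into pieces that stay orthogonal to [w]. *)
  pose Y k := e k - (b (e k) w / b (e q) w) *: e q.
  have Yq : Y q = 0 by rewrite /Y divff // scale1r subrr.
  have Yw k : b (Y k) w = 0 by rewrite /Y !pairE; field.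
  have EY : y = \sum_k b y (f k) *: Y k.
    rewrite /Y; under eq_bigr do rewrite scalerBr scalerA mulrA.
    rewrite sumrB -(framel fr y) -scaler_suml -mulr_suml -(frame_pair y w) yw.
    by rewrite mul0r scale0r subr0.
  rewrite EY (bigD1 i) // (bigD1 j) /=; last by simpneq.
  rewrite addrA; apply: (@null4_lin2 1 1 (b y (f i) *: Y i + b y (f j) *: Y j)
    (\sum_(k | (k != i) && (k != j)) b y (f k) *: Y k)); first by rewrite !scale1r.
  - clear EY; set Y0 := (_ + _).
    set wi := b (e i) w; set wj := b (e j) w.
    set yi := b y (f i) in d yd xd epd eqd Y0 *.
    set yj := b y (f j) in d yd xd epd eqd Y0 *.
    pose c' := (yi * wi + yj * wj) / b (e q) w.
    have EY0 : Y0 = yi *: e i + yj *: e j - c' *: e q.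
      by rewrite /Y0 /Y /c' /wi /wj; veql.
    have Ed : d = yi *: f j + (- yj) *: f i by rewrite scaleNr.
    have Y0w : b Y0 w = 0 by rewrite EY0 !pairE /c' -/wi -/wj; field.
    clearbody Y0 d; subst Y0 d.
    have Y0d : b (yi *: e i + yj *: e j - c' *: e q) (yi *: f j + - yj *: f i) = 0.
      by rewrite !pairE !(frameE fr); simpneq; ring.
    (* The coordinates of [w] outside [p, q, i, j] are disposed of by the goodness of the
       corresponding [f k]. *)
    pose W := b (e p) w *: f p + (b (e q) w *: f q + (wi *: f i + wj *: f j)).
    have Ew : w = 1 *: W
        + 1 *: \sum_(k | k \notin [:: p; q; i; j]) b (e k) w *: f k.
      rewrite !scale1r {1}(framer fr w) (bigID (fun k => k \in [:: p; q; i; j])) /=.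
      by rewrite -big_uniq // !big_cons big_nil /= addr0.
    apply: (null4_lin4 Ew); last first.
      apply/null4r/null4_sum3 => // k; rewrite !inE !negb_or => /and4P[n1 n2 n3 n4].
      right; apply: gr; rewrite /perp4 xd Y0d !eqxx !andbT /=.
      rewrite xf !pairE !(frameE fr) ![_ == k]eq_sym.
      rewrite (negPf n1) (negPf n2) (negPf n3) (negPf n4) /=.
      by apply/andP; split; apply/eqP; ring.
    (* The component of the left vector along [e q] ties the plane of [p, q] to that of [i, j].
       Adding the good vector [f m] to [W] allows trading it for a component along [e m]; between
       the two planes only a scaled twisted quadruple remains. *)
    fresh_index m [:: p; q; i; j] => Um.
    have U2 : uniq [:: m; p; q; i; j] by rewrite cons_uniq Um U.
    clear Um; have U3 := U2; neqs U3.
    have xW : b x W = 0.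
      rewrite /W !pairE !xf; simpneq.
      by rewrite -[RHS]xw xE; ring.
    have xm : b x (f m) = 0 by rewrite xf; simpneq; ring.
    have dE k : b (e k) (yi *: f j + - yj *: f i) = yi * (k == j)%:R - yj * (k == i)%:R.
      by rewrite !pairE !(frameE fr) mulNr.
    have wE k : b (e k) W = b (e p) w * (k == p)%:R + b (e q) w * (k == q)%:R
        + wi * (k == i)%:R + wj * (k == j)%:R.
      by rewrite /W !pairE !(frameE fr) !addrA.
    have EW : W = b (e p) w *: f p + (b (e q) w *: f q + (wi *: f i + wj *: f j)) by [].
    clearbody W.
    have cw : c' * b (e q) w = yi * wi + yj * wj by rewrite /c' divfK.
    have NYm : null4 x (yi *: e i + yj *: e j - c' *: e q)
        (yi *: f j + - yj *: f i) (f m).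
      apply/null4r/gr; rewrite /perp4 xd xm Y0d eqxx /= andbT.
      by rewrite !pairE !(frameE fr); simpneq; apply/eqP; ring.
    apply: (@null4_lin4 1 (-1) _ _ (W + f m) (f m)) => //.
      by rewrite scaleN1r scale1r addrK.
    apply: (@null4_lin2 1 1 (yi *: e i + yj *: e j - (c' * b (e q) w) *: e m)
                            ((c' * b (e q) w) *: e m - c' *: e q)).
    + by veql.
    + have N1 : null4 x (yi *: e i + yj *: e j - (c' * b (e q) w) *: e m)
          (yi *: f j + - yj *: f i) (b (e p) w *: f p + b (e q) w *: f q).
        apply: (@null4_lin2 1 (- (c' * b (e q) w)) (yi *: e i + yj *: e j) (e m)).
        * by veql.
        * have -> : b (e p) w *: f p + b (e q) w *: f q
             = (- b (e q) w / a) *: (c *: f p - a *: f q).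
            have -> : b (e p) w = - c * b (e q) w / a.
              by apply: (mulfI nza); move: xw; rewrite xE => /eqP;
                 rewrite addr_eq0 => /eqP ->; field.
            by apply: frame_eqr => jj; rewrite ?pairE; field.
          apply/null4r/null4Zr.
          have -> : yi *: f j + - yj *: f i = (-1) *: (yj *: f i - yi *: f j) by veqr.
          apply/null4r/null4Zr/null4r; rewrite Ex.
          exact: twisted_scale.
        * apply/null4l/gl; rewrite /perp4 xd dE eqxx; simpneq.
          rewrite !pairE !(frameE fr) !xf; simpneq.
          apply/and3P; split; apply/eqP; try ring.
          by rewrite -[RHS]xw xE; ring.
      have N2 : null4 x (yi *: e i + yj *: e j - (c' * b (e q) w) *: e m)
          (yi *: f j + - yj *: f i) (wi *: f i + wj *: f j + f m).
        apply: (null4_lin1 Ex); apply: gl; rewrite cw; pperp.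
      by apply: (null4_lin4 _ N1 N2 (k := 1) (k' := 1)); rewrite EW; veqr.
    + have o : b ((c' * b (e q) w) *: e m - c' *: e q) (W + f m) = 0.
        by rewrite !pairE !wE !(frameE fr); simpneq; ring.
      have xWm : b x (W + f m) = 0 by rewrite pairDr xW xm addr0.
      apply: null4_lin3 (erefl _) _ _; apply: gr; rewrite /perp4 o xWm !eqxx !xf
        !pairE !(frameE fr); simpneq; rewrite ?andbT /=;
        by apply/andP; split; apply/eqP; ring.
  apply: null4_sum2 => // k /andP[nki nkj]; right.
  have [->|nkq] := eqVneq k q; first by rewrite Yq; apply/null4l/null40l.
  have Yf l : b (Y k) (f l) = (k == l)%:R - b (e k) w / b (e q) w * (q == l)%:R.
    by rewrite /Y !pairE !(frameE fr).
  have -> : d = b y (f i) *: f j + (- b y (f j)) *: f i by rewrite scaleNr.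
  apply: null4_lin3 (erefl _) _ _; apply: gr;
    rewrite /perp4 xw Yw !eqxx !xf !Yf ?(negPf nki) ?(negPf nkj); simpneq;
    by rewrite ?andbT /=; apply/andP; split; apply/eqP; ring.
have main y z w : b y (f p) = 0 -> b (e p) z = 0 -> perp4 b x y z w -> null4 x y z w.
  move=> yp zp /and4P[/eqP xz /eqP xw /eqP yz /eqP yw].
  have zq : b (e q) z = 0.
    by apply/eqP; move/eqP: xz; rewrite xE zp mulr0 add0r mulf_eq0 (negPf nzc).
  have [i /and3P[nip niq nzi]|y0] := pickP [pred i | [&& i != p, i != q & b y (f i) != 0]].
    rewrite (frame_perpr yz nzi); apply: null4_sum3 => // j _.
    have [->|nji] := eqVneq j i; first by right; rewrite subrr; apply: null40r.
    have [->|njp] := eqVneq j p; first by left; rewrite zp mul0r.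
    have [->|njq] := eqVneq j q; first by left; rewrite zq mul0r.
    right; apply: core => //; rewrite /= !inE !negb_or npq.
    by rewrite ![p == _]eq_sym ![q == _]eq_sym nip niq njp njq eq_sym nji.
  rewrite (framer fr z); apply: null4_sum3 => // j _.
  have [->|njp] := eqVneq j p; first by left.
  have [->|njq] := eqVneq j q; first by left.
  right; apply: gr; rewrite /perp4 xw yw eqxx xf ![_ == j]eq_sym.
  rewrite (negPf njp) (negPf njq) /= !mulr0 addr0 eqxx /= andbT.
  by have := y0 j; rewrite /= njp njq /= => /negbFE.
have main2 y z w : b y (f p) = 0 -> perp4 b x y z w -> null4 x y z w.
  move=> yp o; have /and4P[/eqP xz /eqP xw /eqP yz /eqP yw] := o.
  have [zp|nz] := eqVneq (b (e p) z) 0; first exact: main.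
  apply: (@null4_lin4 (b (e p) w / b (e p) z) 1 _ _ z
            (w - (b (e p) w / b (e p) z) *: z)).
  - by rewrite scale1r addrC subrK.
  - exact: null4_altr.
  apply/null4r/main => //; first by rewrite !pairE divfK // subrr.
  by rewrite /perp4 !pairE xz xw yz yw !mulr0 subr0 !eqxx.
move=> y z w /and4P[/eqP xz /eqP xw /eqP yz /eqP yw].
apply: (@null4_lin2 (b y (f p) / a) 1 x (y - (b y (f p) / a) *: x)).
- by rewrite scale1r addrC subrK.
- exact: null4_altl.
apply: main2; last by rewrite /perp4 !pairE xz xw yz yw !mulr0 subr0 !eqxx.
by rewrite !pairE xf; simpneq; field.
Qed.

End Forms.
End OrthForms.

Lemma sum_delta n (c : 'I_n -> rat) j : \sum_i c i * (i == j)%:R = c j.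
Proof.
rewrite (bigD1 j) //= eqxx mulr1 big1 ?addr0 // => i /negPf ->.
by rewrite mulr0.
Qed.

Section Transpose.
Variables (A C M : lmodType rat) (b : A -> C -> rat).

Definition tpair z x := b x z.

Lemma perp4_tr x y z w : perp4 tpair z w x y = perp4 b x y z w.
Proof. by rewrite /perp4 /tpair; congr (_ && _); rewrite andbCA. Qed.

Definition tform (F : A -> A -> C -> C -> M) z w x y := F x y z w.

Lemma orthlin_tr F : orthlin b F -> orthlin tpair (tform F).
Proof.
case=> h1 h2 h3 h4; split; rewrite /tform => *.
- by apply: h3; rewrite -perp4_tr.
- by apply: h4; rewrite -perp4_tr.
- by apply: h1; rewrite -perp4_tr.
- by apply: h2; rewrite -perp4_tr.
Qed.

Lemma frame_tr n (e : 'I_n -> A) f : frame b e f -> frame tpair f e.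
Proof.
case=> h1 h2 h3; split=> [i j|z|x]; rewrite /tpair //.
by rewrite h1 eq_sym.
Qed.

Lemma null4_tr F x y z w : null4 tpair (tform F) z w x y <-> null4 b F x y z w.
Proof. by rewrite /null4 perp4_tr. Qed.

End Transpose.

(** * Good frames and transvections *)

Section GoodFrames.
Variables (A C M : lmodType rat) (b : A -> C -> rat).
Hypothesis bb : (forall z, scalar (b^~ z)) /\ (forall x, scalar (b x)).
Variable F : A -> A -> C -> C -> M.
Hypothesis olF : orthlin b F.
Variable n : nat.
Hypothesis n8 : (7 < n)%N.

(** Transposition exchanges the sums and the differences in a twisted quadruple; [twisted_scale]
    with coefficients 1 and -1 absorbs the change of signs. *)
Lemma good_frame_tr (e : 'I_n -> A) f : frame b e f ->
  good_frame b F e f -> good_frame (tpair b) (tform F) f e.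
Proof.
move=> fr gf; have [gl gr tw] := gf; split=> [i x y z|i x y z|i k j l U].
- by rewrite perp4_tr null4_tr => o; apply: gr.
- by rewrite perp4_tr null4_tr => o; apply: gl.
apply/null4_tr.
have /= := twisted_scale bb olF fr n8 gf 1 (-1) 1 (-1) U.
rewrite !scale1r !scaleN1r => /(null4Zr bb olF (-1)).
move=> /(null4r olF) /(null4Zr bb olF (-1)) /(null4r olF).
by rewrite !scaleN1r !opprB !opprK [f k + _]addrC [f l + _]addrC.
Qed.

Lemma goodr_sub2 (e : 'I_n -> A) f p q a c : frame b e f ->
  good_frame b F e f -> p != q -> goodr b F (a *: f p + c *: f q).
Proof.
move=> fr gf npq x y w o; apply/null4_tr.
apply: (goodl_add2 (b := tpair b) (conj bb.2 bb.1) (orthlin_tr olF) (frame_tr fr) n8) => //.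
  exact: good_frame_tr.
by rewrite perp4_tr.
Qed.

Definition shearl (e : 'I_n -> A) p q t i := e i + ((i == p)%:R * t) *: e q.
Definition shearr (f : 'I_n -> C) p q t i := f i - ((i == q)%:R * t) *: f p.

Lemma shear_frame (e : 'I_n -> A) f p q t : p != q ->
  frame b e f -> frame b (shearl e p q t) (shearr f p q t).
Proof.
move=> npq fr; have E := frameE fr.
split=> [i j|x|z].
- rewrite /shearl /shearr !(pairE bb) !E.
  have [->|nip] := eqVneq i p; have [->|njq] := eqVneq j q;
    rewrite ?eqxx ?(negPf npq) ?[q == p]eq_sym ?(negPf npq) ?(negPf nip)
      ?[q == j]eq_sym ?(negPf njq) /=; try ring.
- apply: (frame_eql fr) => j; rewrite (pair_suml bb).
  transitivity (\sum_i (b x (f i) - (i == q)%:R * t * b x (f p)) * (i == j)%:R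
      + \sum_i ((b x (f i) - (i == q)%:R * t * b x (f p)) * (t * (q == j)%:R))
          * (i == p)%:R); last first.
    rewrite -big_split /=; apply: eq_bigr => i _.
    by rewrite /shearl /shearr !(pairE bb) !E; ring.
  by rewrite !sum_delta (negPf npq) [q == j]eq_sym /=; ring.
- apply: (frame_eqr fr) => j; rewrite (pair_sumr bb).
  transitivity (\sum_i (b (e i) z + (i == p)%:R * t * b (e q) z) * (i == j)%:R
      - \sum_i ((b (e i) z + (i == p)%:R * t * b (e q) z) * (t * (j == p)%:R))
          * (i == q)%:R); last first.
    rewrite -sumrB /=; apply: eq_bigr => i _.
    by rewrite /shearl /shearr !(pairE bb) !E [j == i]eq_sym; ring.
  by rewrite !sum_delta [q == p]eq_sym (negPf npq) /=; ring.
Qed.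

Lemma frame_perp4 (e : 'I_n -> A) f i k j l : frame b e f ->
  uniq [:: i; k; j; l] -> perp4 b (e i + e k) (e j + e l) (f i - f k) (f j - f l).
Proof.
move=> fr U; neqs U; rewrite /perp4 !(pairE bb) !(frameE fr).
by apply/and4P; split; apply/eqP; simpneq; ring.
Qed.

(* A good basis vector stays good after adding a multiple of another one, and a
   twisted quadruple involves the sheared index in at most one of its two pairs. *)
Lemma shear_good (e : 'I_n -> A) f p q t : p != q -> frame b e f ->
  good_frame b F e f -> good_frame b F (shearl e p q t) (shearr f p q t).
Proof.
move=> npq fr gf; have [gl gr tw] := gf.
have fr' := shear_frame t npq fr; have E := frameE fr'.
split=> [i|i|i k j l U].
- rewrite /shearl; have [->|nip] := eqVneq i p.
    rewrite mul1r -[e p]scale1r.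
    by apply: (goodl_add2 bb olF fr n8 gf).
  by rewrite mul0r scale0r addr0.
- rewrite /shearr; have [->|niq] := eqVneq i q.
    rewrite mul1r -scaleNr -[f q]scale1r.
    by apply: goodr_sub2 (fr) (gf) _; rewrite eq_sym.
  by rewrite mul0r scale0r subr0.
have key i' k' j' l' : uniq [:: i'; k'; j'; l'] -> p \notin [:: i'; k'] ->
    null4 b F (shearl e p q t i' + shearl e p q t k')
      (shearl e p q t j' + shearl e p q t l')
      (shearr f p q t i' - shearr f p q t k')
      (shearr f p q t j' - shearr f p q t l').
  move=> U'; have Eik : i' != k'.
    by move: U'; rewrite /= !inE !negb_or => /andP[/andP[]].
  rewrite !inE negb_or => /andP[npi npk].
  have Es i0 : p != i0 -> shearl e p q t i0 = e i0.
    by move=> n0; rewrite /shearl eq_sym (negPf n0) mul0r scale0r addr0.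
  have G : goodl b F (shearl e p q t i' + shearl e p q t k').
    rewrite !Es // -[e i']scale1r -[e k']scale1r.
    exact: (goodl_add2 bb olF fr n8 gf).
  exact/G/frame_perp4.
have [pik|npik] := boolP (p \in [:: i; k]); last exact: key.
apply/(null4l olF)/(null4r olF)/key; last first.
  move: pik; rewrite !inE => pik; neqs U.
  by case/orP: pik => /eqP->; simpneq.
by neqs U; simpneq.
Qed.

(* Shears bring the number of nonzero coordinates of [x] down to one. *)
Lemma good_frame_goodl (e : 'I_n -> A) f : frame b e f ->
  good_frame b F e f -> forall x, goodl b F x.
Proof.
move=> fr gf x; move: {2}_.+1 (ltnSn #|[pred i | b x (f i) != 0]|) => m.
elim: m e f fr gf => // m IHm e f fr gf; rewrite ltnS => ltm.
have [gl gr tw] := gf.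
have [p px|x0] := pickP [pred i | b x (f i) != 0]; last first.
  have -> : x = 0 *: e (Ordinal (leq_trans (isT : (0 < 8)%N) n8)).
    rewrite scale0r (framel fr x) big1 // => i _.
    by have /= := x0 i => /negbFE/eqP->; rewrite scale0r.
  exact: goodlZ.
have [q /andP[nqp qx]|x1] := pickP [pred i | (i != p) && (b x (f i) != 0)]; last first.
  have -> : x = b x (f p) *: e p.
    rewrite {1}(framel fr x) (bigD1 p) //= big1 ?addr0 // => i nip.
    by have /= := x1 i; rewrite nip /= => /negbFE/eqP->; rewrite scale0r.
  exact: goodlZ.
rewrite eq_sym in nqp; pose t := b x (f q) / b x (f p).
apply: (IHm _ _ (shear_frame t nqp fr) (shear_good t nqp fr gf)).
apply: leq_trans ltm; apply: proper_card; apply/properP; split.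
  apply/fintype.subsetP => i; rewrite !inE /shearr; have [->|niq] := eqVneq i q => //.
  by rewrite mul0r scale0r subr0.
exists q => //; rewrite !inE /shearr eqxx mul1r !(pairE bb) negbK /t divfK //.
by rewrite subrr.
Qed.

Lemma good_frame_vanish (e : 'I_n -> A) f : frame b e f ->
  good_frame b F e f -> forall x y z w, perp4 b x y z w -> F x y z w = 0.
Proof. by move=> fr gf x y z w o; have [] := good_frame_goodl fr gf o. Qed.

End GoodFrames.

(** * Goodness of the frame vectors *)

Section BasisGood.
Variables (A C M : lmodType rat) (b : A -> C -> rat).
Hypothesis bb : (forall z, scalar (b^~ z)) /\ (forall x, scalar (b x)).
Variable F : A -> A -> C -> C -> M.
Hypothesis olF : orthlin b F.
Variables (n : nat) (e : 'I_n -> A) (f : 'I_n -> C).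
Hypothesis fr : frame b e f.
Hypothesis n8 : (7 < n)%N.
Hypothesis H1 : forall i j k l, i != k -> i != l -> j != k -> j != l ->
  null4 b F (e i) (e j) (f k) (f l).
Hypothesis H2 : forall i m j l, uniq [:: i; m; j; l] ->
  null4 b F (e i + e m) (e j) (f i - f m) (f l).

Local Notation N := (null4 b F).
Local Notation lin1 := (null4_lin1 bb olF).
Local Notation lin2 := (null4_lin2 bb olF).
Local Notation lin3 := (null4_lin3 bb olF).
Local Notation lin4 := (null4_lin4 bb olF).

Ltac veql := let j := fresh "jj" in
  apply: (frame_eql fr) => j; rewrite ?(pairE bb); ring.
Ltac veqr := let j := fresh "jj" in
  apply: (frame_eqr fr) => j; rewrite ?(pairE bb); ring.

Lemma mid_scale i k j l u v : uniq [:: i; k; j; l] ->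
  N (u *: e i + v *: e k) (e j) (v *: f i - u *: f k) (f l).
Proof.
move=> U; fresh_index m [:: i; k; j; l] => Um.
have U2 : uniq [:: m; i; k; j; l] by rewrite cons_uniq Um U.
clear Um; neqs U2.
apply: (null4_scale bb olF fr (m := m)).
- by rewrite /= !inE; simpneq.
- move=> a c; rewrite !inE => /or3P[]/eqP-> /or3P[]/eqP->; rewrite ?eqxx // => _;
  apply: H1; by simpneq.
- move=> a c; rewrite !inE => /or3P[]/eqP-> /or3P[]/eqP->; rewrite ?eqxx // => _;
  apply: H2; by rewrite /= !inE; simpneq.
Qed.

Lemma basis_perp p y z : b (e p) z = 0 -> b (y - b y (f p) *: e p) z = b y z.
Proof. by move=> pz; rewrite !(pairE bb) pz mulr0 subr0. Qed.

Lemma basis_reduce p y z w : b (e p) z = 0 -> b (e p) w = 0 ->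
  N (e p) (y - b y (f p) *: e p) z w -> N (e p) y z w.
Proof.
move=> pz pw; apply: (lin2 (k := b y (f p)) (k' := 1) (x := e p)).
  by rewrite scale1r addrC subrK.
exact: (null4_altl olF).
Qed.

(** Alternation allows [y_p = 0] and [z_k = 0]. Then [z] is a combination of vectors
    [y_i f_j - y_j f_i]; against each of them, the part of [y] along [e i] and [e j] is covered by
    [mid_scale] and the rest by [H1]. *)
Lemma basis_rcol p k y z : p != k -> perp4 b (e p) y z (f k) ->
  N (e p) y z (f k).
Proof.
move=> npk; wlog yp : y / b y (f p) = 0.
  move=> wl /and4P[/eqP pz /eqP pk /eqP yz /eqP yk].
  apply: basis_reduce => //; apply: wl.
    by rewrite !(pairE bb) (frameE fr) eqxx mulr1 subrr.
  by rewrite /perp4 pz pk !basis_perp // yz yk eqxx.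
wlog zk : z / b (e k) z = 0.
  move=> wl /and4P[/eqP pz /eqP pk /eqP yz /eqP yk].
  apply: (lin3 (k := b (e k) z) (k' := 1) (z := f k) (z' := z - b (e k) z *: f k)).
  - by rewrite scale1r addrC subrK.
  - exact: (null4_altr olF).
  - apply: wl; first by rewrite !(pairE bb) (frameE fr) eqxx mulr1 subrr.
    by rewrite /perp4 !(pairE bb) pz pk yz yk !mulr0 subr0 eqxx.
move=> /and4P[/eqP pz /eqP pk /eqP yz /eqP yk].
have [i /= nzi|y0] := pickP [pred i | b y (f i) != 0]; last first.
  have -> : y = 0.
    by rewrite (framel fr y) big1 // => i _; have /= /negbFE/eqP-> := y0 i; rewrite scale0r.
  exact/(null4l olF)/(null40l bb olF).
rewrite (frame_perpr bb fr yz nzi); apply: (null4_sum3 bb olF) => // j _.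
have [->|nji] := eqVneq j i; first by right; rewrite subrr; apply: (null40r bb olF).
have [->|njp] := eqVneq j p; first by left; rewrite pz mul0r.
have [->|njk] := eqVneq j k; first by left; rewrite zk mul0r.
right.
have nip : i != p by apply: contraNneq nzi => ->; rewrite yp.
have nik : i != k by apply: contraNneq nzi => ->; rewrite yk.
have U : uniq [:: i; j; p; k].
  by rewrite /= !inE !negb_or nip nik njp njk npk [i == j]eq_sym nji.
have U' := U; neqs U'.
have dp : b (e p) (b y (f i) *: f j - b y (f j) *: f i) = 0.
  by rewrite !(pairE bb) !(frameE fr); simpneq; ring.
rewrite {1}[y](framel fr y) (bigD1 i) // (bigD1 j) //= addrA.
apply: (lin2 (k := 1) (k' := 1)
  (x := b y (f i) *: e i + b y (f j) *: e j)); first by rewrite !scale1r.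
  have := mid_scale (b y (f i)) (b y (f j)) U.
  move=> /(null4l olF) /(null4Zr bb olF (-1)).
  by rewrite scaleN1r opprB.
apply: (null4_sum2 bb olF) => // m /andP[nmi nmj].
have [->|nmk] := eqVneq m k; first by left.
right; apply: (lin3 (k := b y (f i)) (k' := - b y (f j)) (z := f j) (z' := f i)).
- by rewrite scaleNr.
- by apply: H1 => //; rewrite eq_sym.
- by apply: H1 => //; rewrite eq_sym.
Qed.

(** The obstruction left over when both right arguments are expanded by [frame_perpr]: two of its
    spanning vectors against the part of [y] that meets them. *)
Definition trif p i j l u v t :=
  F (e p) (u *: e i + v *: e j + t *: e l)
    (u *: f j - v *: f i) (u *: f l - t *: f i).

Lemma trif_perp p i j l u v t : uniq [:: p; i; j; l] ->
  perp4 b (e p) (u *: e i + v *: e j + t *: e l)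
    (u *: f j - v *: f i) (u *: f l - t *: f i).
Proof.
move=> U; neqs U; rewrite /perp4 !(pairE bb) !(frameE fr).
by apply/and4P; split; apply/eqP; simpneq; ring.
Qed.

Lemma basis_lcol p k y w : p != k -> perp4 b (e p) y (f k) w ->
  N (e p) y (f k) w.
Proof.
by move=> npk o; apply/(null4r olF)/basis_rcol => //; rewrite perp4Cr.
Qed.

Ltac pp := rewrite /perp4 ?(pairE bb) ?(frameE fr); apply/and4P; split;
  apply/eqP; simpneq; rewrite ?oppr0 ?add0r ?addr0; by field.

(** Replacing [l] by a fresh [m] rescales [t] by an arbitrary nonzero [c], so comparing two such
    moves gives homogeneity in [t]. The bridge is [w = c u f_m + d_l = u f_l + c d_m]: it differs
    from [d_l] and from [c d_m] by a multiple of a frame vector, which is null by [basis_rcol], and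
    it is orthogonal to [y2], the difference of the two middle vectors. *)
Lemma trif_move p i j l m u v t c : uniq [:: m; p; i; j; l] -> u != 0 -> c != 0 ->
  trif p i j l u v t = c *: trif p i j m u v (t / c).
Proof.
move=> U nu nc; rewrite /trif.
have U1 : uniq [:: p; i; j; l] by move: U; rewrite cons_uniq => /andP[].
have U2 : uniq [:: p; i; j; m] by neqs U; simpneq.
have U3 := U; neqs U3.
have npm : p != m by apply/negbT.
have npl : p != l by apply/negbT.
have npi : p != i by apply/negbT.
have npj : p != j by apply/negbT.
set y := _ + t *: e l; set dj := u *: f j - _; set dl := u *: f l - _.
set y1 := _ + (t / c) *: e m; set dm := u *: f m - _.
have o1 : perp4 b (e p) y dj dl := trif_perp u v t U1.
have o2 : perp4 b (e p) y1 dj dm := trif_perp u v (t / c) U2.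
pose y2 := t *: e l - (t / c) *: e m.
pose w := (c * u) *: f m + dl.
have [om Fm] : N (e p) y dj (f m).
  apply: basis_rcol => //; rewrite ?/w ?/y ?/y1 ?/y2 /dj ?/dl; pp.
have ow : perp4 b (e p) y dj w.
  rewrite /w /y /dj /dl; pp.
have -> : F (e p) y dj dl = F (e p) y dj w.
  by rewrite [RHS](orthlin4 bb olF) // Fm scaler0 add0r.
have Ey : y = 1 *: y2 + y1 by rewrite /y /y1 /y2; veql.
have o2w : perp4 b (e p) y2 dj w.
  rewrite /w /y2 /dj /dl; pp.
have o1w : perp4 b (e p) y1 dj w.
  rewrite /w /y1 /dj /dl; pp.
have [_ F2] : N (e p) y2 dj w.
  apply: (lin3 (k := u) (k' := - v) (z := f j) (z' := f i)).
  - by rewrite /dj scaleNr.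
  - apply: basis_lcol => //; rewrite ?/w ?/y ?/y1 ?/y2 /dj ?/dl; pp.
  - apply: basis_lcol => //; rewrite ?/w ?/y ?/y1 ?/y2 /dj ?/dl; pp.
rewrite Ey (orthlin2 bb olF) // F2 scaler0 add0r.
have Ew : w = u *: f l + c *: dm.
  by rewrite /w /dl /dm; apply: (frame_eqr fr) => jj; rewrite ?(pairE bb); field.
have [ol Fl] : N (e p) y1 dj (f l).
  apply: basis_rcol => //; rewrite ?/w ?/y ?/y1 ?/y2 /dj ?/dl; pp.
have ocm : perp4 b (e p) y1 dj (c *: dm).
  rewrite /perp4; move: o2 => /and4P[-> /eqP a1 -> /eqP a2].
  by rewrite ![b _ (c *: dm)](pairZr bb) a1 a2 !mulr0 eqxx.
by rewrite Ew (orthlin4 bb olF) // Fl scaler0 add0r (orthlinZ4 bb olF).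
Qed.

Lemma trifC p i j l u v t : uniq [:: p; i; j; l] ->
  trif p i l j u t v = - trif p i j l u v t.
Proof.
move=> U; rewrite /trif -(orthlinrC olF) ?trif_perp //.
by congr (F _ _ _ _); rewrite addrAC.
Qed.

(** This rests on [u (v f_l - t f_j) = v d_l - t d_j], where a repeated [d_j] contributes nothing.
    It is what converts the degree in [v] into the degree in [u]. *)
Lemma trif_swap p i j l u v t : uniq [:: p; i; j; l] ->
  u *: trif p j i l v u t = - v *: trif p i j l u v t.
Proof.
move=> U; have := trif_perp u v t U; rewrite /trif.
have -> : v *: e j + u *: e i + t *: e l = u *: e i + v *: e j + t *: e l by veql.
set y := _ + _; set dj := u *: f j - _; set dl := u *: f l - _ => o.
have [_ Fd] : N (e p) y dj dj.
  by move: o => /and4P[/eqP ? _ /eqP ? _]; apply: (null4_altr olF).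
have -> : v *: f i - u *: f j = (-1) *: dj by rewrite /dj; veqr.
have o1 : perp4 b (e p) y dj dj.
  by rewrite /perp4; move: o => /and4P[-> _ -> _].
have o2 : perp4 b (e p) y ((-1) *: dj) (v *: f l - t *: f j).
  by rewrite /y /dj; neqs U; pp.
rewrite -(orthlinZ4 bb olF) //.
have -> : u *: (v *: f l - t *: f j) = v *: dl + (- t) *: dj.
  by rewrite /dj /dl; veqr.
have o3 : perp4 b (e p) y dj ((- t) *: dj).
  rewrite /perp4; move: o => /and4P[/eqP a1 _ /eqP a2 _].
  by rewrite ![b _ (_ *: dj)](pairZr bb) a1 a2 !mulr0 eqxx.
have o4 : perp4 b (e p) y dj (v *: dl).
  rewrite /perp4; move: o => /and4P[-> /eqP a1 -> /eqP a2].
  by rewrite ![b _ (_ *: dl)](pairZr bb) a1 a2 !mulr0 eqxx.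
rewrite (orthlinZ3 bb olF); last first.
  rewrite /perp4; move: o => /and4P[/eqP a1 /eqP a3 /eqP a2 /eqP a4].
  rewrite ![b _ (_ *: dl + _)](pairDr bb) ![b _ (_ *: dj)](pairZr bb).
  by rewrite ![b _ (_ *: dl)](pairZr bb) a1 a2 a3 a4 !mulr0 addr0 eqxx.
rewrite (orthlin4 bb olF) // (orthlinZ4 bb olF) // Fd scaler0 addr0.
by rewrite scaleN1r scaleNr.
Qed.

(* [trif p i j l] is homogeneous of degree 1 in [v], 1 in [t] and 2 in [u], but of
   total degree 3 by multilinearity. *)
Lemma trif_eq0 p i j l u v t : uniq [:: p; i; j; l] -> u != 0 ->
  trif p i j l u v t = 0.
Proof.
move=> U nu; have U3 := U; neqs U3.
have npi : p != i by apply/negbT.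
have npj : p != j by apply/negbT.
have npl : p != l by apply/negbT.
have o := trif_perp u v t U.
have [v0|nv] := eqVneq v 0.
  have : N (e p) (u *: e i + v *: e j + t *: e l) (u *: f j - v *: f i)
     (u *: f l - t *: f i); last by case.
  have -> : u *: f j - v *: f i = u *: f j by rewrite v0 scale0r subr0.
  apply: (null4Zr bb olF); apply: basis_lcol => //.
  by rewrite v0; pp.
have [t0|nt] := eqVneq t 0.
  have : N (e p) (u *: e i + v *: e j + t *: e l) (u *: f j - v *: f i)
     (u *: f l - t *: f i); last by case.
  have -> : u *: f l - t *: f i = u *: f l by rewrite t0 scale0r subr0.
  apply/(null4r olF)/(null4Zr bb olF); apply: basis_lcol => //.
  by rewrite t0; pp.
have h1 i' j' l' u' v' t' k : uniq [:: p; i'; j'; l'] -> u' != 0 -> t' != 0 ->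
    k != 0 -> trif p i' j' l' u' v' (k * t') = k *: trif p i' j' l' u' v' t'.
  move=> U' nu' nt' nk; fresh_index m [:: p; i'; j'; l'] => Um.
  have U2 : uniq [:: m; p; i'; j'; l'] by rewrite cons_uniq Um U'.
  rewrite (trif_move v' (k * t') U2 nu' (c := k * t')) ?mulf_neq0 //.
  by rewrite (trif_move v' t' U2 nu' nt') !divff ?mulf_neq0 // scalerA.
have h2 i' j' l' u' v' t' k : uniq [:: p; i'; j'; l'] -> u' != 0 -> v' != 0 ->
    k != 0 -> trif p i' j' l' u' (k * v') t' = k *: trif p i' j' l' u' v' t'.
  move=> U' nu' nv' nk.
  have U2 : uniq [:: p; i'; l'; j'] by neqs U'; simpneq.
  by rewrite !(trifC _ _ _ U2) h1 // scalerN.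
have Uj : uniq [:: p; j; i; l] by neqs U; simpneq.
have hu k : k != 0 -> trif p i j l (k * u) v t = (k * k) *: trif p i j l u v t.
  move=> nk; apply: (scalerI nv).
  have := trif_swap (k * u) v t U; rewrite h2 // scaleNr => /(congr1 -%R).
  rewrite opprK => <-; rewrite !scalerA (_ : k * u * k = k * k * u); last by ring.
  by rewrite -scalerA (trif_swap u v t U) scalerA -scaleNr; congr (_ *: _); ring.
have E16 : trif p i j l (2 * u) (2 * v) (2 * t) = 16 *: trif p i j l u v t.
  rewrite h1 ?mulf_neq0 // h2 ?mulf_neq0 // hu // !scalerA.
  by congr (_ *: _); ring.
have E8 : trif p i j l (2 * u) (2 * v) (2 * t) = 8 *: trif p i j l u v t.
  rewrite /trif.
  have -> : (2 * u) *: e i + (2 * v) *: e j + (2 * t) *: e l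
     = 2 *: (u *: e i + v *: e j + t *: e l) by veql.
  have -> : (2 * u) *: f j - (2 * v) *: f i = 2 *: (u *: f j - v *: f i) by veqr.
  have -> : (2 * u) *: f l - (2 * t) *: f i = 2 *: (u *: f l - t *: f i) by veqr.
  rewrite (orthlinZ2 bb olF) ?(orthlinZ3 bb olF) ?(orthlinZ4 bb olF) ?scalerA //.
  - by pp.
  - by pp.
apply/eqP; move/eqP: E16; rewrite E8 -subr_eq0 -scalerBl scaler_eq0.
have -> : ((8 - 16 : rat) == 0) = false by [].
by rewrite orFb.
Qed.

(** With [y_p = 0], both right arguments expand in vectors [y_i f_j - y_j f_i] for one common [i].
    The part of [y] along [e i], [e j], [e l] gives [trif], which vanishes; the other components
    involve only disjoint indices. *)
Lemma basis_goodl p : goodl b F (e p).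
Proof.
move=> y z w; wlog yp : y / b y (f p) = 0.
  move=> wl /and4P[/eqP pz /eqP pw /eqP yz /eqP yw].
  apply: basis_reduce => //; apply: wl.
    by rewrite !(pairE bb) (frameE fr) eqxx mulr1 subrr.
  by rewrite /perp4 pz pw !basis_perp // yz yw eqxx.
move=> /and4P[/eqP pz /eqP pw /eqP yz /eqP yw].
have [i /= nzi|y0] := pickP [pred i | b y (f i) != 0]; last first.
  have -> : y = 0.
    by rewrite (framel fr y) big1 // => i _; have /= /negbFE/eqP-> := y0 i; rewrite scale0r.
  exact/(null4l olF)/(null40l bb olF).
have nip : i != p by apply: contraNneq nzi => ->; rewrite yp.
have dp j : j != p -> b (e p) (b y (f i) *: f j - b y (f j) *: f i) = 0.
  move=> njp; rewrite !(pairE bb) !(frameE fr) ![p == _]eq_sym (negPf nip) (negPf njp) /=.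
  by ring.
have yd j : b y (b y (f i) *: f j - b y (f j) *: f i) = 0.
  by rewrite !(pairE bb); ring.
rewrite (frame_perpr bb fr yz nzi); apply: (null4_sum3 bb olF) => // j _.
have [->|nji] := eqVneq j i; first by right; rewrite subrr; apply: (null40r bb olF).
have [->|njp] := eqVneq j p; first by left; rewrite pz mul0r.
right; apply/(null4r olF); rewrite (frame_perpr bb fr yw nzi).
apply: (null4_sum3 bb olF); rewrite ?dp ?yd // => l _.
have [->|nli] := eqVneq l i.
  by right; rewrite subrr; apply: (null40r bb olF); rewrite ?dp ?yd.
have [->|nlp] := eqVneq l p; first by left; rewrite pw mul0r.
right; have [->|nlj] := eqVneq l j.
  by apply: (null4_altr olF); rewrite ?dp ?yd.
apply/(null4r olF).
have U : uniq [:: p; i; j; l].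
  rewrite /= !inE !negb_or [p == i]eq_sym [p == j]eq_sym [p == l]eq_sym.
  by rewrite [i == j]eq_sym [i == l]eq_sym [j == l]eq_sym nip njp nlp nji nli nlj.
have Uc : uniq [:: i; j; l] by move: U; rewrite cons_uniq => /andP[].
rewrite {1}[y](framel fr y) (bigID (fun m => m \in [:: i; j; l])) /=.
rewrite -big_uniq // !big_cons big_nil /= addr0 addrA.
apply: (lin2 (k := 1) (k' := 1)); first by rewrite !scale1r.
  by split; [exact: trif_perp | exact: trif_eq0].
apply: (null4_sum2 bb olF); rewrite ?dp // => m.
rewrite !inE !negb_or => /and3P[nmi nmj nml].
right; have [->|nmp] := eqVneq m p; first by apply: (null4_altl olF); rewrite dp.
apply: (lin3 (k := b y (f i)) (k' := - b y (f j)) (z := f j) (z' := f i));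
  first by rewrite scaleNr.
all: apply: (lin4 (k := b y (f i)) (k' := - b y (f l)) (z := f l) (z' := f i));
  first by rewrite scaleNr.
all: by apply: H1 => //; rewrite eq_sym.
Qed.

End BasisGood.

(** * Extension of functions of orthogonal quadruples to forms *)

Section FrameCombination.
Variables (n : nat) (M : lmodType rat).

Definition fcomb (p : 'I_n -> rat) (phi : 'I_n -> M) := \sum_i p i *: phi i.

Lemma fcombPl k p q r phi : (forall i, r i = k * p i + q i) ->
  fcomb r phi = k *: fcomb p phi + fcomb q phi.
Proof.
move=> E; rewrite /fcomb scaler_sumr -big_split /=; apply: eq_bigr => i _.
by rewrite E scalerDl scalerA.
Qed.

Lemma fcombPr k p phi psi chi : (forall i, chi i = k *: phi i + psi i) ->
  fcomb p chi = k *: fcomb p phi + fcomb p psi.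
Proof.
move=> E; rewrite /fcomb scaler_sumr -big_split /=; apply: eq_bigr => i _.
by rewrite E scalerDr !scalerA mulrC.
Qed.

Lemma fcomb_delta p phi j : (forall i, p i = (i == j)%:R) -> fcomb p phi = phi j.
Proof.
move=> E; rewrite /fcomb (bigD1 j) //= big1; first by rewrite E eqxx scale1r addr0.
by move=> i /negPf nij; rewrite E nij scale0r.
Qed.

Lemma fcomb_delta' p phi j : (forall i, p i = (j == i)%:R) -> fcomb p phi = phi j.
Proof. by move=> E; apply: fcomb_delta => i; rewrite E eq_sym. Qed.

Lemma fcombN p phi psi : (forall i, psi i = - phi i) -> fcomb p psi = - fcomb p phi.
Proof.
by move=> E; rewrite /fcomb -sumrN; apply: eq_bigr => i _; rewrite E scalerN.
Qed.

Lemma fcomb_exchange p q phi :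
  fcomb p (fun i => fcomb q (phi i)) = fcomb q (fun j => fcomb p (phi^~ j)).
Proof.
rewrite /fcomb; under eq_bigr do rewrite scaler_sumr.
rewrite exchange_big; apply: eq_bigr => i _ /=; rewrite scaler_sumr.
by apply: eq_bigr => j _; rewrite !scalerA mulrC.
Qed.

End FrameCombination.

Section Extension.
Variables (A C M : lmodType rat) (b : A -> C -> rat).
Hypothesis bb : (forall z, scalar (b^~ z)) /\ (forall x, scalar (b x)).
Variables (n : nat) (e : 'I_n -> A) (f : 'I_n -> C).
Hypothesis fr : frame b e f.
Hypothesis n8 : (7 < n)%N.

Record alt4 (B : A -> A -> C -> C -> M) : Prop := Alt4 {
  alt4l : forall k x x' y z w, B (k *: x + x') y z w = k *: B x y z w + B x' y z w;
  alt4lC : forall x y z w, B y x z w = - B x y z w;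
  alt4r : forall k x y z z' w, B x y (k *: z + z') w = k *: B x y z w + B x y z' w;
  alt4rC : forall x y z w, B x y w z = - B x y z w }.

Lemma alt4_add B B' : alt4 B -> alt4 B' -> alt4 (fun x y z w => B x y z w + B' x y z w).
Proof.
case=> h1 h2 h3 h4 [k1 k2 k3 k4]; split=> *.
- by rewrite h1 k1 scalerDr addrACA.
- by rewrite h2 k2 opprD.
- by rewrite h3 k3 scalerDr addrACA.
- by rewrite h4 k4 opprD.
Qed.

Lemma orthlin_sub F B : orthlin b F -> alt4 B ->
  orthlin b (fun x y z w => F x y z w - B x y z w).
Proof.
case=> h1 h2 h3 h4 [k1 k2 k3 k4]; split=> *.
- by rewrite h1 // k1 scalerBr opprD addrACA.
- by rewrite h2 // k2 opprD.
- by rewrite h3 // k3 scalerBr opprD addrACA.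
- by rewrite h4 // k4 opprD.
Qed.

Definition tens4 (c : 'I_n -> 'I_n -> 'I_n -> 'I_n -> M) x y z w :=
  fcomb (b x \o f) (fun i => fcomb (b y \o f) (fun j =>
    fcomb (fun k => b (e k) z) (fun k => fcomb (fun l => b (e l) w) (c i j k)))).

Definition alt4_coef (c : 'I_n -> 'I_n -> 'I_n -> 'I_n -> M) :=
  (forall i j k l, c j i k l = - c i j k l) /\ (forall i j k l, c i j l k = - c i j k l).

Lemma tens4_alt c : alt4_coef c -> alt4 (tens4 c).
Proof.
move=> [c1 c2]; split=> [k x x' y z w|x y z w|k x y z z' w|x y z w]; rewrite /tens4.
- by apply: fcombPl => i /=; rewrite bb.1.
- rewrite fcomb_exchange; apply: fcombN => i; apply: fcombN => j.
  by apply: fcombN => k; apply: fcombN => l; apply: c1.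
- apply: fcombPr => i /=; apply: fcombPr => j /=.
  by apply: fcombPl => l /=; rewrite bb.2.
- apply: fcombN => i; apply: fcombN => j; rewrite fcomb_exchange.
  by apply: fcombN => k; apply: fcombN => l; apply: c2.
Qed.

Lemma tens4E c i j k l : tens4 c (e i) (e j) (f k) (f l) = c i j k l.
Proof.
rewrite /tens4 (@fcomb_delta' _ _ _ _ i) => [|a]; last exact: (frameE fr).
rewrite (@fcomb_delta' _ _ _ _ j) => [|a]; last exact: (frameE fr).
rewrite (@fcomb_delta _ _ _ _ k) => [|a]; last exact: (frameE fr).
by rewrite (@fcomb_delta _ _ _ _ l) => [//|a]; exact: (frameE fr).
Qed.

Section Alt4Theory.
Variable B : A -> A -> C -> C -> M.
Hypothesis aB : alt4 B.

Lemma alt4Dl x x' y z w : B (x + x') y z w = B x y z w + B x' y z w.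
Proof. by rewrite -{1}[x]scale1r (alt4l aB) scale1r. Qed.
Lemma alt4Dl2 x y y' z w : B x (y + y') z w = B x y z w + B x y' z w.
Proof. by rewrite (alt4lC aB) alt4Dl opprD -!(alt4lC aB). Qed.
Lemma alt4Br x y z z' w : B x y (z - z') w = B x y z w - B x y z' w.
Proof. by rewrite addrC -scaleN1r (alt4r aB) scaleN1r addrC. Qed.
Lemma alt4Br2 x y z w w' : B x y z (w - w') = B x y z w - B x y z w'.
Proof.
rewrite (alt4rC aB x y (w - w') z) alt4Br (alt4rC aB x y z w) (alt4rC aB x y z w').
by rewrite opprB opprK addrC.
Qed.
End Alt4Theory.

Section Cocycle.
Variable F : A -> A -> C -> C -> M.
Hypothesis olF : orthlin b F.
Local Notation N := (null4 b F).

Variables (y : A) (w : C).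
Local Notation X a c := (F (e a + e c) y (f a - f c) w).
Local Notation Nac s := (forall a c, a \in s -> c \in s -> a != c -> N (e a) y (f c) w).

Lemma shift_perp i k : i != k -> Nac [:: i; k] -> perp4 b (e i + e k) y (f i - f k) w.
Proof.
move=> nik Na; have nki : k != i by rewrite eq_sym.
have [ik iw yk yw] : [/\ _, _, _ & _] := null4_perp (Na i k (mem_head _ _) ltac:(by rewrite !inE eqxx orbT) nik).
have [ki kw yi _] : [/\ _, _, _ & _] := null4_perp (Na k i ltac:(by rewrite !inE eqxx orbT) (mem_head _ _) nki).
rewrite /perp4 !(pairE bb); apply/and4P; split; apply/eqP;
  by rewrite ?iw ?kw ?yk ?yi ?yw ?ik ?ki ?(frameE fr) ?eqxx /=; ring.
Qed.

Lemma shiftC i k : i != k -> Nac [:: i; k] -> X k i = - X i k.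
Proof.
move=> nik Na; have -> : f k - f i = (-1) *: (f i - f k) by rewrite scaleN1r opprB.
rewrite [e k + _]addrC (orthlinZ3 bb olF) ?scaleN1r //.
exact: shift_perp.
Qed.

(** Adding the third frame vector to [e a + e c] does not change the value, since its contribution
    is null. All three values thus have the left argument [e i + e k + e m], and the right arguments
    add up. *)
Lemma shift_cocycle i k m : uniq [:: i; k; m] -> Nac [:: i; k; m] -> X i m = X i k + X k m.
Proof.
move=> U Na; have sub2 s : {subset s <= [:: i; k; m]} -> Nac s.
  by move=> Hs a c /Hs ha /Hs hc; apply: Na.
have si : i \in [:: i; k; m] by rewrite inE eqxx.
have sk : k \in [:: i; k; m] by rewrite !inE eqxx orbT.
have sm : m \in [:: i; k; m] by rewrite !inE eqxx !orbT.
have h a c d : uniq [:: a; c; d] -> a \in [:: i; k; m] -> c \in [:: i; k; m] ->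
    d \in [:: i; k; m] -> N (e d) y (f a - f c) w /\ perp4 b (e a + e c) y (f a - f c) w.
  move=> Ud sa sc sd; have := Ud; rewrite /= !inE !negb_or => /andP[/andP[nac nad] /andP[ncd _]].
  split.
    apply: (null4_lin3 bb olF (k := 1) (k' := -1) (z := f a) (z' := f c)).
    - by rewrite scaleN1r scale1r.
    - by apply: Na; rewrite // eq_sym.
    - by apply: Na; rewrite // eq_sym.
  apply: shift_perp => //; apply: sub2 => x.
  by rewrite in_cons => /orP[/eqP->//|]; rewrite mem_seq1 => /eqP->.
have E a c d : uniq [:: a; c; d] -> a \in [:: i; k; m] -> c \in [:: i; k; m] ->
    d \in [:: i; k; m] -> X a c = F ((e a + e c) + e d) y (f a - f c) w
    /\ perp4 b ((e a + e c) + e d) y (f a - f c) w.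
  move=> U3 sa sc sd; have [[od Fd] o] := h a c d U3 sa sc sd.
  split; first by rewrite -[e a + e c]scale1r (orthlinl olF) // Fd addr0 !scale1r.
  rewrite /perp4; move: od o => /and4P[/eqP a1 /eqP a2 _ _] /and4P[/eqP b1 /eqP b2 b3 b4].
  by rewrite ![b (_ + e d) _](pairDl bb) a1 a2 b1 b2 b3 b4 addr0 eqxx.
have U1 : uniq [:: i; m; k] by neqs U; simpneq.
have U2 : uniq [:: k; m; i] by neqs U; simpneq.
have [-> o1] := E _ _ _ U1 si sm sk.
have [-> o2] := E _ _ _ U si sk sm.
have [-> o3] := E _ _ _ U2 sk sm si.
have E1 : e k + e m + e i = e i + e k + e m by rewrite addrC addrA.
have E2 : e i + e m + e k = e i + e k + e m by rewrite addrAC.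
rewrite E1 E2 in o1 o3 *.
rewrite -[F _ _ (f i - f k) w]scale1r -(orthlinr olF) //.
by congr (F _ _ _ _); rewrite scale1r addrA subrK.
Qed.

End Cocycle.

(** The test quadruples come in three types: no index shared between the two sides, one plane
    shared, two planes shared. Each type has its own normalization, which must not disturb the
    previous ones. *)
Definition frame_null1 (F : A -> A -> C -> C -> M) := forall i j k l,
  i != k -> i != l -> j != k -> j != l -> F (e i) (e j) (f k) (f l) = 0.

Definition frame_null2 (F : A -> A -> C -> C -> M) := forall i m j l,
  uniq [:: i; m; j; l] -> F (e i + e m) (e j) (f i - f m) (f l) = 0.

Definition frame_null3 (F : A -> A -> C -> C -> M) := forall i k j l,
  uniq [:: i; k; j; l] -> F (e i + e k) (e j + e l) (f i - f k) (f j - f l) = 0.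

Lemma frame_null1P F i j k l : frame_null1 F ->
  i != k -> i != l -> j != k -> j != l -> null4 b F (e i) (e j) (f k) (f l).
Proof.
move=> H1 h1 h2 h3 h4; split; last exact: H1.
by rewrite /perp4 !(frameE fr) (negPf h1) (negPf h2) (negPf h3) (negPf h4) !eqxx.
Qed.

Lemma frame_null2P F i m j l : frame_null2 F ->
  uniq [:: i; m; j; l] -> null4 b F (e i + e m) (e j) (f i - f m) (f l).
Proof.
move=> H2 U; split; last exact: H2.
neqs U; rewrite /perp4 !(pairE bb) !(frameE fr).
by apply/and4P; split; apply/eqP; simpneq; ring.
Qed.

Lemma frame_null3P F i k j l : frame_null3 F ->
  uniq [:: i; k; j; l] -> null4 b F (e i + e k) (e j + e l) (f i - f k) (f j - f l).
Proof. by move=> H3 U; split; [exact: frame_perp4 | exact: H3]. Qed.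

(** The first two conditions are self-dual up to signs, which [mid_scale] absorbs. So [basis_goodl]
    applies to both sides, and the third condition is [twisted]. *)
Lemma frame_null_vanish F : orthlin b F -> frame_null1 F -> frame_null2 F ->
  frame_null3 F -> forall x y z w, perp4 b x y z w -> F x y z w = 0.
Proof.
move=> olF H1 H2 H3; apply: (good_frame_vanish bb olF n8 fr).
have N1 i j k l := @frame_null1P F i j k l H1.
have N2 i m j l := @frame_null2P F i m j l H2.
split=> [i|i|i k j l]; last exact: frame_null3P.
  exact: (basis_goodl bb olF fr n8).
move=> x y w o; apply/null4_tr.
have bt := conj bb.2 bb.1 : (forall z, scalar ((tpair b)^~ z)) /\ (forall x, scalar (tpair b x)).
apply: (basis_goodl bt (orthlin_tr olF) (frame_tr fr) n8); last by rewrite perp4_tr.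
  move=> a c d k n1 n2 n3 n4; apply/null4_tr; apply: N1; by rewrite eq_sym.
move=> a m c l U; apply/null4_tr.
have U' : uniq [:: a; m; l; c] by neqs U; simpneq.
have := mid_scale bb olF fr n8 N1 N2 1 (-1) U'.
rewrite !scale1r !scaleN1r => /(null4Zr bb olF (-1)).
by rewrite scaleN1r opprD !opprK.
Qed.

End Extension.

(** * Correcting a function by multilinear forms *)

Section Normalization.
Variables (A C M : lmodType rat) (b : A -> C -> rat).
Hypothesis bb : (forall z, scalar (b^~ z)) /\ (forall x, scalar (b x)).
Variables (n : nat) (e : 'I_n -> A) (f : 'I_n -> C).
Hypothesis fr : frame b e f.
Hypothesis n8 : (7 < n)%N.
Implicit Type F : A -> A -> C -> C -> M.

Lemma normalize1 F : orthlin b F -> exists2 B, alt4 B &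
  frame_null1 e f (fun x y z w => F x y z w - B x y z w).
Proof.
move=> olF; pose P (i j k l : 'I_n) := [&& i != k, i != l, j != k & j != l].
have oP i j k l : P i j k l -> perp4 b (e i) (e j) (f k) (f l).
  by rewrite /perp4 !(frameE fr) => /and4P[/negPf-> /negPf-> /negPf-> /negPf->].
have PCl i j k l : P j i k l = P i j k l.
  by rewrite /P; apply/idP/idP => /and4P[-> -> -> ->].
have PCr i j k l : P i j l k = P i j k l.
  by rewrite /P; apply/idP/idP => /and4P[-> -> -> ->].
pose c i j k l := if P i j k l then F (e i) (e j) (f k) (f l) else 0.
have ac : alt4_coef c.
  split=> i j k l; rewrite /c.
    by rewrite [P j i k l]PCl; case: ifP => [/oP/(orthlinlC olF)|_]; rewrite ?oppr0.
  by rewrite [P i j l k]PCr; case: ifP => [/oP/(orthlinrC olF)|_]; rewrite ?oppr0.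
exists (tens4 b e f c); first exact: (tens4_alt bb).
move=> i j k l h1 h2 h3 h4; rewrite (tens4E fr) /c.
by rewrite (_ : P i j k l) ?subrr // /P h1 h2 h3.
Qed.

(** For fixed [j, l] the values [X i m j l] form an antisymmetric cocycle in [i, m], hence a
    coboundary [D i - D m], where [D] is the value towards a base point. The form with [D] at the
    coefficients having a common index, alternated on both sides, has the same values. *)
Lemma normalize2 F : orthlin b F -> frame_null1 e f F -> exists B, [/\ alt4 B,
  frame_null1 e f (fun x y z w => F x y z w - B x y z w) &
  frame_null2 e f (fun x y z w => F x y z w - B x y z w)].
Proof.
move=> olF H1; have N1 i j k l := @frame_null1P _ _ _ _ _ _ _ fr F i j k l H1.
pose X i m j l := F (e i + e m) (e j) (f i - f m) (f l).
have m0ex (p : 'I_n * 'I_n) : exists m, m \notin [:: p.1; p.2].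
  exact: (@fresh_ord n [:: p.1; p.2] (leq_trans (isT : (2 < 8)%N) n8)).
have [m0 m0P] := fin_all_exists m0ex.
pose D i j l := X i (m0 (j, l)) j l.
pose d (i k : 'I_n) := (i == k)%:R : rat.
pose E i j k l := d i k *: D i j l - d i l *: D i j k.
pose c i j k l := E i j k l - E j i k l.
have EC i j k l : E i j l k = - E i j k l by rewrite opprB.
have ac : alt4_coef c.
  by split=> i j k l; rewrite /c; [rewrite [RHS]opprB | rewrite (EC i j k l) (EC j i k l) [RHS]opprD].
have aB := tens4_alt bb e f ac.
exists (tens4 b e f c); split => //.
  move=> i j k l h1 h2 h3 h4; rewrite (tens4E fr) H1 // /c /E /d.
  by rewrite (negPf h1) (negPf h2) (negPf h3) (negPf h4) !scale0r !subr0.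
have XD i m j l : uniq [:: i; m; j; l] -> X i m j l = D i j l - D m j l.
  move=> U; have := m0P (j, l); rewrite /= !inE negb_or => /andP[nmj nml].
  have U' := U; neqs U'.
  have N a k : k != j -> a != l -> j != l -> a != k ->
      null4 b F (e a) (e j) (f k) (f l).
    by move=> *; apply: N1; rewrite // eq_sym.
  rewrite /D; set m' := m0 (j, l) in nmj nml *.
  have NN s : j \notin s -> l \notin s -> forall a k, a \in s -> k \in s -> a != k ->
      null4 b F (e a) (e j) (f k) (f l).
    move=> js ls a k sa sk nak; apply: N => //.
    - by apply: contraNneq js => <-.
    - by apply: contraNneq ls => <-.
    - by apply/negbT.
  (* The base point depends only on [j, l] and may coincide with [i] or [m]; there the value [X]
     from the base point to itself is 0, as its third argument vanishes. *)
  have [mi|nmi] := eqVneq m' i.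
    rewrite mi (_ : X i i j l = 0) ?sub0r; last first.
      rewrite /X subrr; suff [] : null4 b F (e i + e i) (e j) 0 (f l) by [].
      by apply: (null40r bb olF); rewrite ?(pairE bb) ?(frameE fr); simpneq; ring.
    rewrite -(shiftC bb fr olF) //; first by simpneq.
    by apply: NN; rewrite !inE; simpneq.
  have [mm|nmm] := eqVneq m' m.
    rewrite mm (_ : X m m j l = 0) ?subr0 //.
    rewrite /X subrr; suff [] : null4 b F (e m + e m) (e j) 0 (f l) by [].
    by apply: (null40r bb olF); rewrite ?(pairE bb) ?(frameE fr); simpneq; ring.
  have EX : X i m' j l = X i m j l + X m m' j l.
    apply: (shift_cocycle bb fr olF).
      by rewrite /= !inE; simpneq; rewrite [i == m']eq_sym [m == m']eq_sym (negPf nmi) (negPf nmm).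
    by apply: NN; rewrite !inE ?[j == m']eq_sym ?[l == m']eq_sym ?(negPf nmj) ?(negPf nml); simpneq.
  by rewrite EX addrK.
move=> i m j l U; rewrite -/(X i m j l) XD //.
rewrite (alt4Dl aB) !(alt4Br aB) !(tens4E fr) /c /E /d; neqs U; simpneq.
rewrite !scale1r !scale0r ?subr0 ?sub0r ?oppr0 ?addr0 ?add0r.
by rewrite subrr.
Qed.

End Normalization.

(** * Functions of two disjoint edges *)

Section SquareFunctions.
Variables (n : nat) (M : lmodType rat).
Hypothesis n8 : (7 < n)%N.
Implicit Type R : 'I_n -> 'I_n -> 'I_n -> 'I_n -> M.

(* Combinatorial shadow of [F (e i + e k) (e j + e l) (f i - f k) (f j - f l)]. *)
Record square_fun R : Prop := SquareFun {
  squareP : forall i k j l, uniq [:: i; k; j; l] -> R j l i k = R i k j l;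
  squareN : forall i k j l, uniq [:: i; k; j; l] -> R k i j l = - R i k j l;
  squareD : forall i k m j l, uniq [:: i; k; m; j; l] ->
    R i m j l = R i k j l + R k m j l }.

Section Theory.
Variable R : 'I_n -> 'I_n -> 'I_n -> 'I_n -> M.
Hypothesis sR : square_fun R.

Lemma squareN2 i k j l : uniq [:: i; k; j; l] -> R i k l j = - R i k j l.
Proof.
move=> U; have U' := U; neqs U'.
by rewrite (squareP sR (i := l) (k := j)) ?(squareN sR (i := j)) ?(squareP sR (i := i)) //; uq.
Qed.

Lemma squareD2 i k m j l : uniq [:: i; k; m; j; l] ->
    R j l i m = R j l i k + R j l k m.
Proof.
move=> U; have U' := U; neqs U'.
rewrite (squareP sR (i := i) (k := m)); last by uq.
rewrite (squareP sR (i := i) (k := k)); last by uq.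
rewrite (squareP sR (i := k) (k := m)); last by uq.
by rewrite (squareD sR (k := k)) //; uq.
Qed.

(** [R] is additive in each of its two edges, so an edge can be broken at [o] or at [p]. The case
    distinctions treat edges that already contain [o] or [p]; for the edge [o, p] itself a fresh
    vertex is needed. *)
Lemma square_vanish o p : o != p ->
  (forall i j, uniq [:: o; p; i; j] -> R i o j p = 0) ->
  forall i k j l, uniq [:: i; k; j; l] -> R i k j l = 0.
Proof.
move=> nop R0.
move/negPf in nop; have Ra i k j : uniq [:: o; p; i; k; j] -> R i k j p = 0.
  move=> U; neqs U.
  rewrite (squareD sR (k := o)); last by uq.
  rewrite R0; last by uq.
  rewrite (squareN sR (i := k)); last by uq.
  by rewrite R0 ?oppr0 ?addr0 //; uq.
have Rb i k j : uniq [:: o; p; i; k; j] -> R i k j o = 0.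
  move=> U; neqs U.
  rewrite -(squareP sR); last by uq.
  rewrite (squareD2 (k := p)); last by uq.
  rewrite R0; last by uq.
  rewrite (squareN2 (j := k)); last by uq.
  by rewrite R0 ?oppr0 ?addr0 //; uq.
have Rc i k j l : uniq [:: o; p; i; k; j; l] -> R i k j l = 0.
  move=> U; neqs U.
  rewrite (squareD2 (k := p)); last by uq.
  rewrite Ra; last by uq.
  rewrite (squareN2 (j := l)); last by uq.
  by rewrite Ra ?oppr0 ?addr0 //; uq.
have Rd j l : uniq [:: o; p; j; l] -> R o p j l = 0.
  move=> U; fresh_index m [:: o; p; j; l] => Um.
  have U2 : uniq [:: m; o; p; j; l] by rewrite cons_uniq Um U.
  clear Um; neqs U2.
  rewrite (squareD sR (k := m)); last by uq.
  rewrite (squareN sR (i := m)); last by uq.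
  rewrite -(squareP sR); last by uq.
  rewrite Rb; last by uq.
  by rewrite -(squareP sR) ?Ra ?oppr0 ?addr0 //; uq.
have Zo i k j : uniq [:: i; k; j; o] -> R i k j o = 0.
  move=> U; have U' := U; neqs U'.
  have [jp|/negPf njp] := eqVneq j p.
    subst j; rewrite (squareN2 (j := o)); last by uq.
    by rewrite -(squareP sR) ?Rd ?oppr0 //; uq.
  have [ip|/negPf nip] := eqVneq i p.
    subst i; rewrite -(squareP sR); last by uq.
    by rewrite (squareN2 (j := k)) ?R0 ?oppr0 //; uq.
  have [kp|/negPf nkp] := eqVneq k p.
    by subst k; rewrite -(squareP sR) ?R0 //; uq.
  by apply: Rb; bothneq; uq.
move=> i k j l U; have U' := U; neqs U'.
have [lo|/negPf nlo] := eqVneq l o; first by subst l; exact: Zo.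
have [jo|/negPf njo] := eqVneq j o.
  by subst j; rewrite (squareN2 (j := l)) ?Zo ?oppr0 //; uq.
have [ko|/negPf nko] := eqVneq k o.
  by subst k; rewrite -(squareP sR) ?Zo //; uq.
have [io|/negPf nio] := eqVneq i o.
  subst i; rewrite (squareN sR (i := k)); last by uq.
  by rewrite -(squareP sR) ?Zo ?oppr0 //; uq.
have Zp i' k' j' : uniq [:: i'; k'; j'; p] -> i' != o -> k' != o -> j' != o -> R i' k' j' p = 0.
  by move=> V /negPf n1 /negPf n2 /negPf n3; neqs V; apply: Ra; bothneq; uq.
have [lp|/negPf nlp] := eqVneq l p; first by subst l; apply: Zp; rewrite ?nio ?nko ?njo.
have [jp|/negPf njp] := eqVneq j p.
  by subst j; rewrite (squareN2 (j := l)) ?Zp ?nio ?nko ?nlo ?oppr0 //; uq.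
have [kp|/negPf nkp] := eqVneq k p.
  by subst k; rewrite -(squareP sR) ?Zp ?nio ?njo ?nlo //; uq.
have [ip|/negPf nip] := eqVneq i p.
  subst i; rewrite (squareN sR (i := k)); last by uq.
  by rewrite -(squareP sR) ?Zp ?njo ?nlo ?nko ?oppr0 //; uq.
by apply: Rc; bothneq; uq.
Qed.

End Theory.

(* [s i j] measures the failure of symmetry of [R i o j p].  Its sums along
   4-cycles vanish by [squareP], hence so do those along 3-cycles, so [s] is
   itself a coboundary and can be absorbed in [c]. *)
Lemma square_coboundary R : square_fun R -> exists2 c : 'I_n -> 'I_n -> M, (forall i j, c i j = c j i) &
  forall i k j l, uniq [:: i; k; j; l] -> R i k j l = c i j - c i l - c k j + c k l.
Proof.
move=> sR; fresh_index o (Nil 'I_n) => _; fresh_index p [:: o] => Up; fresh_index q [:: p; o] => Uq.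
have U : uniq [:: q; p; o] by rewrite !cons_uniq Uq Up.
clear Up Uq; neqs U.
pose s i j := R i o j p - R j o i p.
have sC i j : s j i = - s i j by rewrite opprB.
have s4 i j k l : uniq [:: o; p; i; j; k; l] -> s i j + s j k + s k l + s l i = 0.
  move=> V; neqs V.
  have e1 : R i o j p = R i k j p + R k o j p by rewrite (squareD sR (k := k)) //; uq.
  have e2 : R i o l p = R i k l p + R k o l p by rewrite (squareD sR (k := k)) //; uq.
  have e3 : R j o i p = R j l i p + R l o i p by rewrite (squareD sR (k := l)) //; uq.
  have e4 : R j o k p = R j l k p + R l o k p by rewrite (squareD sR (k := l)) //; uq.
  have e5 : R i k j p = R i k j l + R i k l p by rewrite (squareD2 sR (k := l)) //; uq.
  have e6 : R j l i p = R i k j l + R j l k p.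
    rewrite (squareD2 sR (k := k)); last by uq.
    by rewrite (squareP sR (i := i)) //; uq.
  rewrite /s e1 e2 e3 e4 e5 e6; lmod.
have t4 i j k l : uniq [:: o; p; i; j; k; l] ->
    s i j + s j k + s k i = - (s i k + s k l + s l i).
  move=> V; apply/eqP; rewrite -addr_eq0 -[X in _ == X](s4 i j k l) // (sC k i).
  apply/eqP; lmod.
have t3 i j k : uniq [:: o; p; i; j; k] -> s i j + s j k + s k i = 0.
  move=> V; fresh_index l [:: o; p; i; j; k] => Ul.
  have W : uniq [:: l; o; p; i; j; k] by rewrite cons_uniq Ul V.
  clear Ul; neqs W.
  (* The triangles [i j k], [i k l], [i l j] have sums each opposite to the next, cyclically. After
     three steps the sum equals its own opposite. *)
  have /eqP : s i j + s j k + s k i = - (s i j + s j k + s k i).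
    rewrite {1}(t4 i j k l); last by uq.
    rewrite (t4 i k l j); last by uq.
    by rewrite (t4 i l j k) ?opprK //; uq.
  rewrite -addr_eq0 -mulr2n -scaler_nat scaler_eq0 pnatr_eq0.
  by move/eqP.
(* [R i o j p] is its symmetric half plus half of [s i j], and that half is [h i - h j] since
   triangle sums vanish. The symmetric half defines [c] away from [o, p]; the entries of [c] at [o]
   and at [p] provide the rest. *)
pose h i := 2^-1 *: s i q.
pose c i j := if i == o then (if j == p then 0 else h j)
  else if i == p then (if j == o then 0 else - h j)
  else if j == o then h i else if j == p then - h i
  else 2^-1 *: (R i o j p + R j o i p).
have cC i j : c i j = c j i.
  rewrite /c; case: (eqVneq i o) => [io|_]; case: (eqVneq j o) => [jo|_].
  - by rewrite io jo.
  - by [].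
  - by [].
  case: (eqVneq i p) => [ip|_]; case: (eqVneq j p) => [jp|_] //.
    by rewrite ip jp.
  by rewrite addrC.
exists c => // i k j l V; apply/eqP; rewrite -subr_eq0; apply/eqP.
pose R' i k j l := R i k j l - (c i j - c i l - c k j + c k l).
rewrite -/(R' i k j l).
have sR' : square_fun R'.
  split=> [i' k' j' l' V'|i' k' j' l' V'|i' k' m' j' l' V']; rewrite /R'.
  - rewrite (squareP sR) // (cC j' i') (cC j' k') (cC l' i') (cC l' k'); congr (_ - _).
    by lmod.
  - by rewrite (squareN sR) //; lmod.
  - by rewrite (squareD sR V'); lmod.
have nop : o != p by apply/negbT.
apply: (square_vanish sR' nop) => // i' j' W.
neqs W; rewrite /R' /c; simpneq.
have -> : R i' o j' p - (2^-1 *: (R i' o j' p + R j' o i' p) - - h i' - h j' + 0)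
   = 2^-1 *: (s i' j' + s j' q + s q i').
  by rewrite /h (sC i' q) /s; lmod.
suff -> : s i' j' + s j' q + s q i' = 0 by rewrite scaler0.
have s0 a : s a a = 0 by rewrite /s subrr.
have [iq|/negPf niq] := eqVneq i' q; first by rewrite iq s0 addr0 (sC q j') addrN.
have [jq|/negPf njq] := eqVneq j' q; first by rewrite jq s0 addr0 (sC i' q) addrN.
by apply: t3; bothneq; uq.
Qed.

End SquareFunctions.

(** * The last normalization and the extension theorem *)

Section ExtensionTheorem.
Variables (A C M : lmodType rat) (b : A -> C -> rat).
Hypothesis bb : (forall z, scalar (b^~ z)) /\ (forall x, scalar (b x)).
Variables (n : nat) (e : 'I_n -> A) (f : 'I_n -> C).
Hypothesis fr : frame b e f.
Hypothesis n8 : (7 < n)%N.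
Implicit Type F : A -> A -> C -> C -> M.

(** On twisted quadruples [F] is a square function by the cocycle identity, hence given by a
    symmetric [d]. The symmetry makes the coefficients supported on [i = k, j = l] and on
    [i = l, j = k] alternating on both sides, and such a form vanishes on the first two types of
    test quadruples. *)
Lemma normalize3 F : orthlin b F -> frame_null1 e f F -> frame_null2 e f F ->
  exists B, [/\ alt4 B,
    frame_null1 e f (fun x y z w => F x y z w - B x y z w),
    frame_null2 e f (fun x y z w => F x y z w - B x y z w) &
    frame_null3 e f (fun x y z w => F x y z w - B x y z w)].
Proof.
move=> olF H1 H2; have N2 i m j l := @frame_null2P _ _ _ _ bb _ _ _ fr F i m j l H2.
pose R i k j l := F (e i + e k) (e j + e l) (f i - f k) (f j - f l).
have NN s j l : uniq [:: j, l & s] -> forall a c, a \in s -> c \in s -> a != c ->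
    null4 b F (e a) (e j + e l) (f c) (f j - f l).
  rewrite /= inE negb_or => /and3P[/andP[/negPf njl js] ls _] a c sa sc /negPf nac.
  have [/negPf nja /negPf njc] : j != a /\ j != c by split; apply: contraNneq js => ->.
  have [/negPf nla /negPf nlc] : l != a /\ l != c by split; apply: contraNneq ls => ->.
  by apply/(null4l olF)/(null4r olF)/N2; rewrite /= !inE; simpneq.
have sR : square_fun R.
  split=> [i k j l U|i k j l U|i k m j l U]; have U' := U; neqs U'.
  - have o := frame_perp4 bb fr U.
    have o' : perp4 b (e i + e k) (e j + e l) (f j - f l) (f i - f k).
      by rewrite perp4Cr.
    by rewrite /R (orthlinlC olF o') (orthlinrC olF o) opprK.
  - by apply: (shiftC bb fr olF); [uq | apply: NN; uq].
  - by apply: (shift_cocycle bb fr olF); [uq | apply: NN; uq].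
have [d dC dE] := square_coboundary n8 sR.
pose D (i k : 'I_n) := (i == k)%:R : rat.
pose c i j k l := (D i k * D j l) *: d i j - (D i l * D j k) *: d i j.
have ac : alt4_coef c.
  split=> i j k l; rewrite /c; last by rewrite opprB.
  by rewrite (dC j i) (mulrC (D j k)) (mulrC (D j l)) opprB.
have aB := tens4_alt bb e f ac.
exists (tens4 b e f c); split => //.
- move=> i j k l h1 h2 h3 h4; rewrite (tens4E fr) H1 // /c /D.
  by rewrite (negPf h1) (negPf h2) !mul0r !scale0r !subr0.
- move=> i m j l U; rewrite H2 // (alt4Dl aB) !(alt4Br aB) !(tens4E fr) /c /D.
  by neqs U; simpneq; rewrite ?mulr0 ?mul0r !scale0r ?subr0 ?addr0 ?subrr.
- move=> i k j l U; rewrite -/(R i k j l) dE //.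
  rewrite (alt4Dl aB) !(alt4Dl2 aB) !(alt4Br aB) !(alt4Br2 aB) !(tens4E fr) /c /D.
  by neqs U; simpneq; lmod.
Qed.

Theorem orthlin_extend F : orthlin b F -> exists2 B, alt4 B &
  forall x y z w, perp4 b x y z w -> F x y z w = B x y z w.
Proof.
move=> olF; have [B1 a1 N11] := normalize1 bb fr olF.
have ol1 := orthlin_sub olF a1.
have [B2 [a2 N21 N22]] := normalize2 bb fr n8 ol1 N11.
have ol2 := orthlin_sub ol1 a2.
have [B3 [a3 N31 N32 N33]] := normalize3 ol2 N21 N22.
have ol3 := orthlin_sub ol2 a3.
exists (fun x y z w => (B1 x y z w + B2 x y z w) + B3 x y z w).
  exact: alt4_add (alt4_add a1 a2) a3.
move=> x y z w o; apply/eqP; rewrite -subr_eq0 !opprD !addrA; apply/eqP.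
exact: (frame_null_vanish bb fr n8 ol3 N31 N32 N33).
Qed.

End ExtensionTheorem.

(** * Integral symplectic pairs *)

Section Arithmetic.
Variable g : nat.
Local Notation H := (H g).
Local Notation om := (@omega g).
Local Notation int_ := (@integral g).

Definition omE := pairE (omega_bilin g).

Lemma omegaxx (x : H) : om x x = 0.
Proof. by rewrite /omega big1 // => i _; ring. Qed.

Lemma omega_int x y : x \in int_ -> y \in int_ -> om x y \in Num.int.
Proof.
move=> /mxOverP ix /mxOverP iy; apply: rpred_sum => i _.
by rewrite rpredB ?rpredM.
Qed.

Lemma integralZ c x : c \in Num.int -> x \in int_ -> c *: x \in int_.
Proof. by move=> ic /mxOverP ix; apply/mxOverP => i j; rewrite mxE rpredM. Qed.
Lemma integralD x y : x \in int_ -> y \in int_ -> x + y \in int_.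
Proof. by move=> /mxOverP ix /mxOverP iy; apply/mxOverP => i j; rewrite mxE rpredD. Qed.
Lemma integralN x : x \in int_ -> - x \in int_.
Proof. by move=> /mxOverP ix; apply/mxOverP => i j; rewrite mxE rpredN. Qed.
Lemma integral_baseA i : baseA i \in int_.
Proof. by apply/mxOverP => a j; rewrite mxE. Qed.
Lemma integral_baseB i : baseB i \in int_.
Proof. by apply/mxOverP => a j; rewrite mxE. Qed.

Definition ipair p q := [/\ p \in int_, q \in int_ & om p q = 1].

Definition orth (L : seq H) z := all (fun s => om z s == 0) L.

Lemma orth0 L : orth L 0.
Proof. by apply/allP => s _; rewrite omE. Qed.
Lemma orthP k L z z' : orth L z -> orth L z' -> orth L (k *: z + z').
Proof.
move=> /allP oz /allP oz'; apply/allP => s Ls.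
by rewrite !omE (eqP (oz s Ls)) (eqP (oz' s Ls)) mulr0 addr0.
Qed.
Lemma orthZ k L z : orth L z -> orth L (k *: z).
Proof. by move=> oz; rewrite -[_ *: _]addr0 orthP ?orth0. Qed.
Lemma orthD L z z' : orth L z -> orth L z' -> orth L (z + z').
Proof. by move=> oz oz'; rewrite -[z]scale1r orthP. Qed.
Lemma orthN L z : orth L z -> orth L (- z).
Proof. by move=> oz; rewrite -scaleN1r orthZ. Qed.

Lemma common_denominator (x : H) : exists2 k : rat, k != 0 & k *: x \in int_.
Proof.
exists (\prod_j (denq (x 0 j))%:~R).
  by apply/prodf_neq0 => j _; rewrite intr_eq0 denq_neq0.
apply/mxOverP => i j; rewrite mxE (bigD1 j) //= mulrAC ord1 rpredM //.
  by rewrite mulrC -numqE rpred_int_num.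
by apply: rpred_prod => l _; rewrite rpred_int_num.
Qed.

(** The lattice is unimodular: up to sign, the coordinates of [x] are its products with the basis
    vectors. *)
Lemma integral_omegaP x : (forall h, h \in int_ -> om x h \in Num.int) -> x \in int_.
Proof.
move=> ix; apply/mxOverP => i j; rewrite ord1 -[j]splitK.
case: (split j) => a /=.
  by rewrite -omega_baseB ix ?integral_baseB.
by rewrite -[x _ _]opprK -omega_baseA rpredN ix ?integral_baseA.
Qed.

(* The dual vector realizes the least positive value of [om x] on the lattice,
   which divides all the other ones. *)
Lemma primitive_multiple u : u != 0 ->
  exists2 c : rat, c != 0 & exists h, ipair (c *: u) h.
Proof.
move=> nu; have [k nk iku] := common_denominator u.
move: (erefl (k *: u)) iku; move: {-1}(k *: u) => x xE ix.
have nx : x != 0 by rewrite -xE scaler_eq0 negb_or nk.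
have [h [ih nh]] : exists h, h \in int_ /\ om x h != 0.
  case/rV0Pn: nx => j; rewrite -[j]splitK; case: (split j) => a /= na.
    by exists (baseB a); rewrite integral_baseB omega_baseB.
  by exists (baseA a); rewrite integral_baseA omega_baseA oppr_eq0.
pose P m := `[< exists2 h, h \in int_ & om x h = m.+1%:R >].
have exP : exists m, P m.
  have [z zE] := intrP (omega_int ix ih).
  have nz : z != 0 by apply: contraNneq nh => z0; rewrite zE z0.
  exists `|z|.-1; apply/asboolP.
  have z0 : (0 < `|z|)%N by rewrite absz_gt0.
  case: z zE nz z0 => m zE nz z0; first by exists h; rewrite // zE prednK.
  exists (- h); first exact: integralN.
  by rewrite omE zE NegzE rmorphN opprK /= .
case: (ex_minnP exP) => m /asboolP[h0 ih0 E0] minm.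
have divm h' : h' \in int_ -> om x h' / m.+1%:R \in Num.int.
  move=> ih'; have [z zE] := intrP (omega_int ix ih').
  have m0 : (m.+1%:R : rat) != 0 by rewrite pnatr_eq0.
  pose r := (z %% m.+1%:Z)%Z; pose q := (z %/ m.+1%:Z)%Z.
  have zq : z = q * m.+1%:Z + r := divz_eq z m.+1.
  have r0 : r = 0.
    have : (0 <= r) by apply: modz_ge0.
    have : (r < m.+1%:Z) by apply: ltz_pmod.
    have : om x (h' - q%:~R *: h0) = r%:~R.
      by rewrite !omE zE zq E0 rmorphD rmorphM /=; ring.
    case: r {zq} => // -[|s] // sE lts _.
    have : P s by apply/asboolP; exists (h' - q%:~R *: h0) => //;
      rewrite integralD // integralN // integralZ // rpred_int_num.
    by move/minm; rewrite leqNgt; move: lts; rewrite ltz_nat ltnS => ->.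
  by rewrite zE zq r0 addr0 rmorphM /= mulfK // rpred_int_num.
exists (m.+1%:R^-1 * k); first by rewrite mulf_neq0 // invr_eq0 pnatr_eq0.
exists h0; rewrite -scalerA xE; split => //.
  by apply: integral_omegaP => h' /divm; rewrite omE mulrC.
by rewrite omE E0 mulVf // pnatr_eq0.
Qed.

Lemma ex_orth L : (size L < g + g)%N -> exists2 v : H, v != 0 & orth L v.
Proof.
move=> ltL; pose A := \matrix_(i < g + g, j < size L) om (delta_mx 0 i) (nth 0 L j).
have mulA (v : H) j : (v *m A) 0 j = om v (nth 0 L j).
  rewrite mxE {2}[v]row_sum_delta (pair_suml (omega_bilin g)).
  by apply: eq_bigr => i _; rewrite mxE omE.
have : kermx A != 0.
  rewrite -mxrank_eq0 mxrank_ker subn_eq0 -ltnNge.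
  by apply: leq_ltn_trans ltL; exact: rank_leq_col.
move=> /rowV0Pn[v /sub_kermxP vA nv]; exists v => //.
apply/(all_nthP 0) => i lti.
by have := mulA v (Ordinal lti); rewrite vA mxE /= => <-.
Qed.

Definition flat (C : seq (H * H)) := foldr (fun c s => c.1 :: c.2 :: s) [::] C.

Fixpoint opairs (C : seq (H * H)) : Prop :=
  if C is c :: C' then
    [/\ ipair c.1 c.2, orth (flat C') c.1, orth (flat C') c.2 & opairs C']
  else True.

(** The projection onto the orthogonal of the hyperbolic plane spanned by [c]. As the two vectors of
    an integral pair have product 1, no denominators arise. *)
Definition proj (c : H * H) z := z - om z c.2 *: c.1 + om z c.1 *: c.2.

Lemma proj_orth c z : om c.1 c.2 = 1 -> orth [:: c.1; c.2] (proj c z).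
Proof.
move=> c1; rewrite /orth /proj /= !omE !omegaxx (omegaC c.1 c.2) c1.
by apply/and3P; split=> //; apply/eqP; ring.
Qed.

Definition projs C z := foldr proj z C.

Lemma orth_proj L c z : orth L z -> orth L c.1 -> orth L c.2 -> orth L (proj c z).
Proof. by move=> *; rewrite !orthD ?orthN ?orthZ. Qed.

Lemma projs_orth C z : opairs C -> orth (flat C) (projs C z).
Proof.
elim: C => //= c C IHC [[_ _ c1] oC1 oC2 /IHC oC].
have /and3P[h1 h2 _] := proj_orth (projs C z) c1.
by apply/and3P; split=> //; exact: orth_proj.
Qed.

Lemma proj_integral c z : ipair c.1 c.2 -> z \in int_ -> proj c z \in int_.
Proof.
move=> [i1 i2 _] iz.
by rewrite !integralD ?integralN ?integralZ ?omega_int.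
Qed.

Lemma projs_integral C z : opairs C -> z \in int_ -> projs C z \in int_.
Proof.
by elim: C => //= c C IHC [ic _ _ oC] iz; apply: proj_integral => //; exact: IHC.
Qed.

Lemma omega_projs C u z : orth (flat C) u -> om u (projs C z) = om u z.
Proof.
elim: C => //= c C IHC /and3P[/eqP u1 /eqP u2 /IHC E].
by rewrite /proj !omE E u1 u2 !mulr0 subr0 addr0.
Qed.

Lemma primitive_multiple_orth C u : opairs C -> orth (flat C) u -> u != 0 ->
  exists2 c : rat, c != 0 & exists h, ipair (c *: u) h /\ orth (flat C) h.
Proof.
move=> oC ou nu; have [c nc [h [iu ih uh]]] := primitive_multiple nu.
exists c => //; exists (projs C h); split; last exact: projs_orth.
by split; rewrite ?projs_integral ?omega_projs ?orthZ.
Qed.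

(* Gram-Schmidt: each vector of [S] is projected off [C] and completed to a new
   pair. *)
Lemma ex_ipair S C : opairs C -> (size C + size S < g)%N ->
  exists p q, [/\ ipair p q, orth (flat C ++ S) p & orth (flat C ++ S) q].
Proof.
elim: S C => [|s S IHS] C oC ltg.
  have size_flat : (size (flat C) = size C + size C)%N.
    by elim: (C) => //= c C' ->; rewrite addSn addnS.
  rewrite addn0 in ltg; rewrite cats0.
  have [|v nv ov] := @ex_orth (flat C).
    by rewrite size_flat -addSn leq_add // ltnW.
  have [c nc [h [ih oh]]] := primitive_multiple_orth oC ov nv.
  by exists (c *: v), h; split => //; exact: orthZ.
have ocat L L' z : orth (L ++ L') z = orth L z && orth L' z by rewrite /orth all_cat.
(* If the projection of [s] vanishes, orthogonality to [C] already implies orthogonality to [s];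
   otherwise [s] costs one more pair. *)
have [s0|ns] := eqVneq (projs C s) 0.
  have [|p [q [ipq]]] := IHS C oC; first by apply: leq_ltn_trans ltg; rewrite leq_add2l.
  rewrite !ocat => /andP[pC pS] /andP[qC qS].
  exists p, q; rewrite !ocat pC qC /= pS qS -(omega_projs s pC) -(omega_projs s qC).
  by rewrite s0 !omE eqxx.
have [c nc [h [ih oh]]] := primitive_multiple_orth oC (projs_orth s oC) ns.
have [||p [q [ipq]]] := IHS ((c *: projs C s, h) :: C).
- by split=> //=; exact/orthZ/projs_orth.
- by move: ltg; rewrite /= addSn addnS.
rewrite !ocat /= => /andP[/and3P[ps _ pC] pS] /andP[/and3P[qs _ qC] qS].
move: ps qs; rewrite !omE !mulf_eq0 (negPf nc) /=.
rewrite (omega_projs s pC) (omega_projs s qC) => ps qs.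
by exists p, q; split=> //; rewrite ocat; apply/andP; split=> //; apply/andP; split.
Qed.

Section Span.
Variables (M : lmodType rat) (L : seq H) (D : H -> H -> M) (h k : H).
Hypotheses (ihk : ipair h k) (oh : orth L h) (ok : orth L k).
Hypothesis Dl : forall c x x' y, orth L x -> orth L x' -> orth L y ->
  D (c *: x + x') y = c *: D x y + D x' y.
Hypothesis DC : forall x y, orth L x -> orth L y -> D y x = - D x y.
Hypothesis D0 : forall p q, ipair p q -> orth L p -> orth L q -> D p q = 0.

(* For [z, w] integral and orthogonal to [h, k], apply [D0] to the integral pair
   [h + z, (1 - om z w) k + w]. *)
Lemma span_ipair x y : orth L x -> orth L y -> D x y = 0.
Proof.
have [ih ik hk] := ihk.
have Dr c z y' y'' : orth L z -> orth L y' -> orth L y'' ->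
    D z (c *: y' + y'') = c *: D z y' + D z y''.
  move=> oz o1 o2; rewrite DC ?orthP // Dl // (DC oz) // (DC oz o2).
  by rewrite scalerN opprD !opprK.
have D0l z : orth L z -> D 0 z = 0.
  move=> oz; have := Dl 1 oh oh oz; have := Dl (-1) oh oh oz.
  by rewrite scaleN1r addNr => ->; rewrite scaleN1r addNr.
have DZl c z y' : orth L z -> orth L y' -> D (c *: z) y' = c *: D z y'.
  by move=> oz oy; rewrite -[c *: z]addr0 Dl ?orth0 // D0l // addr0.
have hh : D h h = 0.
  by have /eqP := DC oh oh; rewrite -addr_eq0 -mulr2n -scaler_nat scaler_eq0 pnatr_eq0 => /eqP.
have kk : D k k = 0.
  by have /eqP := DC ok ok; rewrite -addr_eq0 -mulr2n -scaler_nat scaler_eq0 pnatr_eq0 => /eqP.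
have hkD : D h k = 0 by exact: D0.
have Dh z : z \in int_ -> orth L z -> om z h = 0 -> om z k = 0 -> D h z = 0.
  move=> iz oz zh zk; have : D h (1 *: k + z) = 0.
    apply: D0 => //; last exact: orthP.
    by split; rewrite ?scale1r ?integralD // omE hk (omegaC z) zh; ring.
  by rewrite Dr // hkD scaler0 add0r.
have Dk z : z \in int_ -> orth L z -> om z h = 0 -> om z k = 0 -> D z k = 0.
  move=> iz oz zh zk; have : D (1 *: h + z) k = 0.
    apply: D0 => //; last exact: orthP.
    by split; rewrite ?scale1r ?integralD // omE hk zk; ring.
  by rewrite Dl // hkD scaler0 add0r.
have Dint z w : z \in int_ -> orth L z -> om z h = 0 -> om z k = 0 ->
    w \in int_ -> orth L w -> om w h = 0 -> om w k = 0 -> D z w = 0.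
  move=> iz oz zh zk iw ow wh wk; pose d := om z w.
  have : D (1 *: h + z) ((1 - d) *: k + w) = 0.
    apply: D0; rewrite ?orthP //; split; rewrite ?scale1r ?integralD ?integralZ //.
      by rewrite rpredB ?omega_int.
    by rewrite !omE hk zk (omegaC w) wh /d; ring.
  rewrite Dr ?orthP // !Dl // hkD (Dh w) // (Dk z) //.
  by rewrite !(scaler0, add0r).
have Dorth z w : orth L z -> om z h = 0 -> om z k = 0 ->
    orth L w -> om w h = 0 -> om w k = 0 -> D z w = 0.
  move=> oz zh zk ow wh wk.
  have [a na iz] := common_denominator z; have [c nc iw] := common_denominator w.
  apply: (scalerI na); apply: (scalerI nc); rewrite !scaler0 -DZl //.
  rewrite (DC ow) ?orthZ // scalerN -DZl ?orthZ // (DC (orthZ a oz)) ?orthZ // opprK.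
  by apply: Dint; rewrite ?orthZ // omE ?zh ?zk ?wh ?wk mulr0.
have Dhr z : orth L z -> om z h = 0 -> om z k = 0 -> D h z = 0 /\ D z k = 0.
  move=> oz zh zk; have [a na iz] := common_denominator z.
  split; apply: (scalerI na); rewrite scaler0.
    rewrite (DC oz) // scalerN -DZl // (DC oh) ?orthZ // opprK.
    by apply: Dh; rewrite ?orthZ // omE ?zh ?zk mulr0.
  rewrite -DZl //; apply: Dk; rewrite ?orthZ // omE ?zh ?zk mulr0 //.
have split z : orth L z -> exists a c z', [/\ z = a *: h + (c *: k + 1 *: z'), orth L z',
    om z' h = 0 & om z' k = 0].
  move=> oz; exists (om z k), (- om z h), (proj (h, k) z); split.
  - by rewrite /proj /=; lmod.
  - exact: (orth_proj (c := (h, k)) oz oh ok).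
  - by have /and3P[/eqP] := @proj_orth (h, k) z hk.
  - by have /and3P[_ /eqP] := @proj_orth (h, k) z hk.
move=> ox oy; have [a [c [z [-> oz zh zk]]]] := split x ox.
have [a' [c' [w [-> ow wh wk]]]] := split y oy.
have oz1 : orth L (1 *: z) by exact: orthZ.
have ow1 : orth L (1 *: w) by exact: orthZ.
have oz2 := orthP c ok oz1; have ow2 := orthP c' ok ow1.
have [hz zkD] := Dhr z oz zh zk; have [hw wkD] := Dhr w ow wh wk.
rewrite !scale1r in oz1 oz2 ow1 ow2 *.
have oY := orthP a' oh ow2.
rewrite Dl // (Dl c ok oz oY) (Dr a' h) // (Dr c' h) // (Dr a' k) // (Dr c' k) //.
rewrite (Dr a' z) // (Dr c' z) // hh hkD hw kk zkD (Dorth z w) // (DC oh ok) hkD (DC ow ok) (DC oh oz) hz wkD.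
lmod.
Qed.

End Span.

End Arithmetic.

(** * Gluing alternating forms *)

Section AltForms.
Variables (g : nat) (M : lmodType rat).
Local Notation H := (H g).
Local Notation om := (@omega g).
Implicit Types (L : seq H) (D : H -> H -> M).

Record altform L D : Prop := AltForm {
  altl : forall c x x' y, orth L x -> orth L x' -> orth L y ->
    D (c *: x + x') y = c *: D x y + D x' y;
  altC : forall x y, orth L x -> orth L y -> D y x = - D x y }.

Lemma orth_cons v L z : orth (v :: L) z = (om z v == 0) && orth L z.
Proof. by []. Qed.

Lemma orth_sub L L' z : {subset L' <= L} -> orth L z -> orth L' z.
Proof. by move=> sub /allP oz; apply/allP => s /sub /oz. Qed.

Section Theory.
Variables (L : seq H) (D : H -> H -> M).
Hypothesis aD : altform L D.

Lemma altform_sub L' : {subset L <= L'} -> altform L' D.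
Proof.
move=> sub; have sub' z := @orth_sub L' L z sub.
by split=> *; [apply: (altl aD) | apply: (altC aD)]; apply: sub'.
Qed.

Lemma altr c z x y : orth L z -> orth L x -> orth L y ->
  D z (c *: x + y) = c *: D z x + D z y.
Proof.
move=> oz ox oy; rewrite (altC aD (orthP c ox oy)) // (altl aD) //.
by rewrite (altC aD oz) // (altC aD oz) // scalerN opprD !opprK.
Qed.

Lemma altxx x : orth L x -> D x x = 0.
Proof.
move=> ox; have /eqP := altC aD ox ox.
by rewrite -addr_eq0 -mulr2n -scaler_nat scaler_eq0 pnatr_eq0 => /eqP.
Qed.

Lemma alt0l y : orth L y -> D 0 y = 0.
Proof.
move=> oy; have := altl aD (-1) oy oy oy.
by rewrite scaleN1r addNr scaleN1r addNr.
Qed.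

Lemma altZl c x y : orth L x -> orth L y -> D (c *: x) y = c *: D x y.
Proof. by move=> ox oy; rewrite -[c *: x]addr0 (altl aD) ?orth0 // alt0l // addr0. Qed.

Lemma altZr c x y : orth L x -> orth L y -> D x (c *: y) = c *: D x y.
Proof. by move=> ox oy; rewrite (altC aD) ?orthZ // altZl // (altC aD ox) // scalerN opprK. Qed.

Lemma altDl x x' y : orth L x -> orth L x' -> orth L y -> D (x + x') y = D x y + D x' y.
Proof. by move=> *; rewrite -{1}[x]scale1r (altl aD) // scale1r. Qed.

Lemma altDr x y y' : orth L x -> orth L y -> orth L y' -> D x (y + y') = D x y + D x y'.
Proof. by move=> *; rewrite -{1}[y]scale1r altr // scale1r. Qed.

End Theory.

Lemma altform_lin L D D' (k k' : rat) : altform L D -> altform L D' ->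
  altform L (fun x y => k *: D x y + k' *: D' x y).
Proof.
move=> [l1 c1] [l2 c2]; split=> [c x x' y ox ox' oy|x y ox oy].
  by rewrite l1 // l2 //; lmod.
by rewrite (c1 x) // (c2 x) //; lmod.
Qed.

(** The uniqueness principle. The existence of one integral pair in the orthogonal of [L] is
    essential, because [span_ipair] obtains everything else by perturbing it. *)
Lemma altform_eq L D D' : altform L D -> altform L D' ->
  (exists p q, [/\ @ipair g p q, orth L p & orth L q]) ->
  (forall p q, @ipair g p q -> orth L p -> orth L q -> D p q = D' p q) ->
  forall x y, orth L x -> orth L y -> D x y = D' x y.
Proof.
move=> aD aD' [p [q [ipq op oq]]] E x y ox oy.
have aE := altform_lin 1 (-1) aD aD'.
have /eqP : 1 *: D x y + (-1) *: D' x y = 0.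
  apply: (span_ipair (D := fun x y => 1 *: D x y + (-1) *: D' x y) ipq op oq) => //.
  - exact: (altl aE).
  - exact: (altC aE).
  - by move=> a c iac oa oc; rewrite E //; lmod.
by rewrite scale1r scaleN1r subr_eq0 => /eqP.
Qed.

Record dual3 L (v1 v2 v3 f1 f2 f3 : H) : Prop := Dual3 {
  dual3o : [/\ orth L f1, orth L f2 & orth L f3];
  dual31 : [/\ om f1 v1 = 1, om f1 v2 = 0 & om f1 v3 = 0];
  dual32 : [/\ om f2 v1 = 0, om f2 v2 = 1 & om f2 v3 = 0];
  dual33 : [/\ om f3 v1 = 0, om f3 v2 = 0 & om f3 v3 = 1] }.

Section Three.
Variables (L : seq H) (v1 v2 v3 f1 f2 f3 : H).
Hypothesis d3 : dual3 L v1 v2 v3 f1 f2 f3.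

Let r z := z - om z v1 *: f1 - om z v2 *: f2 - om z v3 *: f3.

Lemma residueE z :
  z = 1 *: r z + (om z v1 *: f1 + (om z v2 *: f2 + om z v3 *: f3)).
Proof. by rewrite /r; lmod. Qed.

Lemma residue_lin c z z' : r (c *: z + z') = c *: r z + r z'.
Proof. by rewrite /r !omE; lmod. Qed.

Lemma residue_orth z : orth L z -> orth [:: v1, v2, v3 & L] (r z).
Proof.
case: d3 => [[o1 o2 o3] [e11 e12 e13] [e21 e22 e23] [e31 e32 e33]] oz.
rewrite !orth_cons /r !omE e11 e12 e13 e21 e22 e23 e31 e32 e33.
apply/and4P; split; try by [apply/eqP; ring].
by rewrite !orthD ?orthN ?orthZ.
Qed.

(** Any two of the summands [f1], [f2], [f3] and the residue are orthogonal to a common [v]. Two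
    vectors would not be enough: the value at [f1, f2] would remain undetermined. *)
Lemma altform_tri D : altform L D ->
  (forall x y, orth (v1 :: L) x -> orth (v1 :: L) y -> D x y = 0) ->
  (forall x y, orth (v2 :: L) x -> orth (v2 :: L) y -> D x y = 0) ->
  (forall x y, orth (v3 :: L) x -> orth (v3 :: L) y -> D x y = 0) ->
  forall x y, orth L x -> orth L y -> D x y = 0.
Proof.
move=> aD D1 D2 D3.
case: d3 => [[o1 o2 o3] [e11 e12 e13] [e21 e22 e23] [e31 e32 e33]].
have dec y : orth L y -> D f1 y = 0 -> D f2 y = 0 -> D f3 y = 0 ->
    (forall x, orth [:: v1, v2, v3 & L] x -> D x y = 0) ->
    forall x, orth L x -> D x y = 0.
  move=> oy h1 h2 h3 h x ox; rewrite [x]residueE.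
  have oR := residue_orth ox; have oR' := oR.
  move: oR' => /and4P[_ _ _ oR'].
  have oz : orth L (om x v3 *: f3) by exact: orthZ.
  have oz2 := orthP (om x v2) o2 oz; have oz1 := orthP (om x v1) o1 oz2.
  rewrite !(altl aD) // (altZl aD) // h1 h2 h3 h //; lmod.
have oL x : orth [:: v1, v2, v3 & L] x -> orth L x by move=> /and4P[].
have oc v z : om z v = 0 -> orth L z -> orth (v :: L) z.
  by move=> zv oz; rewrite orth_cons zv eqxx.
have i1 x : orth [:: v1, v2, v3 & L] x -> orth (v1 :: L) x.
  by rewrite /orth /= => /and4P[-> _ _ ->].
have i2 x : orth [:: v1, v2, v3 & L] x -> orth (v2 :: L) x.
  by rewrite /orth /= => /and4P[_ -> _ ->].
have F1 y : orth [:: v1, v2, v3 & L] y -> [/\ D f1 y = 0, D f2 y = 0 & D f3 y = 0].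
  move=> oy; split; [apply: D2 | apply: D1 | apply: D1];
  first [by apply: oc | by apply: i1 | by apply: i2].
have F12 : D f1 f2 = 0 by apply: D3; apply: oc.
have F13 : D f1 f3 = 0 by apply: D2; apply: oc.
have F23 : D f2 f3 = 0 by apply: D1; apply: oc.
have N x y : orth L x -> orth L y -> D x y = 0 -> D y x = 0.
  by move=> ox oy E; rewrite (altC aD ox oy) E oppr0.
have Ff1 := dec f1 o1 (altxx aD o1) (N _ _ o1 o2 F12) (N _ _ o1 o3 F13)
  (fun y oy => let: And3 h _ _ := F1 y oy in N _ _ o1 (oL y oy) h).
have Ff2 := dec f2 o2 F12 (altxx aD o2) (N _ _ o2 o3 F23)
  (fun y oy => let: And3 _ h _ := F1 y oy in N _ _ o2 (oL y oy) h).
have Ff3 := dec f3 o3 F13 F23 (altxx aD o3)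
  (fun y oy => let: And3 _ _ h := F1 y oy in N _ _ o3 (oL y oy) h).
move=> x y ox oy; apply: (dec y oy _ _ _ _ x ox).
- exact: N oy o1 (Ff1 y oy).
- exact: N oy o2 (Ff2 y oy).
- exact: N oy o3 (Ff3 y oy).
move=> z oz; apply: (N y z oy (oL z oz)); have [k1 k2 k3] := F1 z oz.
apply: (dec z (oL z oz) k1 k2 k3 _ y oy) => t ot.
by apply: D1; apply: i1.
Qed.

Variables (P1 P2 P3 : H -> H -> M).
Hypotheses (a1 : altform (v1 :: L) P1) (a2 : altform (v2 :: L) P2)
  (a3 : altform (v3 :: L) P3).
Hypothesis P12 : forall x y, orth [:: v1, v2 & L] x -> orth [:: v1, v2 & L] y ->
  P1 x y = P2 x y.
Hypothesis P13 : forall x y, orth [:: v1, v3 & L] x -> orth [:: v1, v3 & L] y ->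
  P1 x y = P3 x y.
Hypothesis P23 : forall x y, orth [:: v2, v3 & L] x -> orth [:: v2, v3 & L] y ->
  P2 x y = P3 x y.

Definition glue3 z w :=
  P1 (r z) (r w)
  + (om z v1 *: P2 f1 (r w) - om w v1 *: P2 f1 (r z))
  + (om z v2 *: P3 f2 (r w) - om w v2 *: P3 f2 (r z))
  + (om z v3 *: P1 f3 (r w) - om w v3 *: P1 f3 (r z))
  + (om z v1 * om w v2 - om z v2 * om w v1) *: P3 f1 f2
  + (om z v2 * om w v3 - om z v3 * om w v2) *: P1 f2 f3
  + (om z v1 * om w v3 - om z v3 * om w v1) *: P2 f1 f3.

Lemma orth_pick v z L' : om z v = 0 -> orth L' z -> orth (v :: L') z.
Proof. by move=> zv oz; rewrite orth_cons zv eqxx. Qed.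

Ltac op := repeat (apply: orth_pick; first by []); by [].

Lemma glue3_alt : altform L glue3.
Proof.
case: d3 => [[o1 o2 o3] [e11 e12 e13] [e21 e22 e23] [e31 e32 e33]].
have R z : orth L z -> [/\ orth (v1 :: L) (r z), orth (v2 :: L) (r z) & orth (v3 :: L) (r z)].
  move=> /residue_orth; rewrite /orth /= => /and4P[-> -> -> E].
  by split; exact: E.
split=> [c z z' w oz oz' ow|z w oz ow]; rewrite /glue3.
  have [z1 z2 z3] := R z oz; have [z1' z2' z3'] := R z' oz'; have [w1 w2 w3] := R w ow.
  have f12 : orth (v2 :: L) f1 by apply: orth_pick.
  have f23 : orth (v3 :: L) f2 by apply: orth_pick.
  have f31 : orth (v1 :: L) f3 by apply: orth_pick.
  rewrite residue_lin (altl a1 c z1 z1' w1) (altr a1 c f31 z1 z1').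
  rewrite (altr a2 c f12 z2 z2') (altr a3 c f23 z3 z3').
  by rewrite !omE; lmod.
have [z1 z2 z3] := R z oz; have [w1 w2 w3] := R w ow.
by rewrite (altC a1 z1 w1); lmod.
Qed.

Lemma glue3E :
  [/\ forall z w, orth (v1 :: L) z -> orth (v1 :: L) w -> glue3 z w = P1 z w,
      forall z w, orth (v2 :: L) z -> orth (v2 :: L) w -> glue3 z w = P2 z w &
      forall z w, orth (v3 :: L) z -> orth (v3 :: L) w -> glue3 z w = P3 z w].
Proof.
case: d3 => [[o1 o2 o3] [e11 e12 e13] [e21 e22 e23] [e31 e32 e33]].
have R z : orth L z -> [/\ om (r z) v1 = 0, om (r z) v2 = 0, om (r z) v3 = 0 & orth L (r z)].
  move=> /residue_orth; rewrite /orth /= => /and4P[/eqP-> /eqP-> /eqP-> E].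
  by split.
split=> z w /andP[/eqP zv oz] /andP[/eqP wv ow]; rewrite /glue3 zv wv;
  have [z1 z2 z3 zL] := R z oz; have [w1 w2 w3 wL] := R w ow.
- have Ez : z = 1 *: r z + (om z v2 *: f2 + om z v3 *: f3).
    by rewrite {1}[z]residueE zv; lmod.
  have Ew : w = 1 *: r w + (om w v2 *: f2 + om w v3 *: f3).
    by rewrite {1}[w]residueE wv; lmod.
  rewrite [in RHS]Ez [in RHS]Ew.
  have q1 : orth (v1 :: L) (r z) by op.
  have q2 : orth (v1 :: L) (r w) by op.
  have q3 : orth (v1 :: L) f2 by op.
  have q4 : orth (v1 :: L) f3 by op.
  rewrite !(altl a1, altr a1, altZl a1, altZr a1) ?orthP ?orthZ //.
  rewrite !(altxx a1) // (altC a1 q3 q4) (altC a1 q3 q1) (altC a1 q4 q1).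
  rewrite -(P13 (x := f2) (y := r w)) -?(P13 (x := f2) (y := r z)); try op.
  by lmod.
- have Ez : z = 1 *: r z + (om z v1 *: f1 + om z v3 *: f3).
    by rewrite {1}[z]residueE zv; lmod.
  have Ew : w = 1 *: r w + (om w v1 *: f1 + om w v3 *: f3).
    by rewrite {1}[w]residueE wv; lmod.
  rewrite [in RHS]Ez [in RHS]Ew.
  have q1 : orth (v2 :: L) (r z) by op.
  have q2 : orth (v2 :: L) (r w) by op.
  have q3 : orth (v2 :: L) f1 by op.
  have q4 : orth (v2 :: L) f3 by op.
  rewrite !(altl a2, altr a2, altZl a2, altZr a2) ?orthP ?orthZ //.
  rewrite !(altxx a2) // (altC a2 q3 q4) (altC a2 q3 q1) (altC a2 q4 q1).
  rewrite (P12 (x := r z) (y := r w)) ?(P12 (x := f3) (y := r w))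
    ?(P12 (x := f3) (y := r z)); try op.
  by lmod.
- have Ez : z = 1 *: r z + (om z v1 *: f1 + om z v2 *: f2).
    by rewrite {1}[z]residueE zv; lmod.
  have Ew : w = 1 *: r w + (om w v1 *: f1 + om w v2 *: f2).
    by rewrite {1}[w]residueE wv; lmod.
  rewrite [in RHS]Ez [in RHS]Ew.
  have q1 : orth (v3 :: L) (r z) by op.
  have q2 : orth (v3 :: L) (r w) by op.
  have q3 : orth (v3 :: L) f1 by op.
  have q4 : orth (v3 :: L) f2 by op.
  rewrite !(altl a3, altr a3, altZl a3, altZr a3) ?orthP ?orthZ //.
  rewrite !(altxx a3) // (altC a3 q3 q4) (altC a3 q3 q1) (altC a3 q4 q1).
  rewrite (P13 (x := r z) (y := r w)) ?(P23 (x := f1) (y := r w))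
    ?(P23 (x := f1) (y := r z)); try op.
  by lmod.
Qed.

End Three.
End AltForms.

Section Gluing.
Variables (g : nat) (M : lmodType rat).
Local Notation H := (H g).
Local Notation om := (@omega g).
Variables (L : seq H) (V : H -> Prop) (P : H -> H -> H -> M).
Hypothesis aP : forall v, V v -> altform (v :: L) (P v).
Hypothesis PP : forall v v', V v -> V v' -> forall x y,
  orth [:: v, v' & L] x -> orth [:: v, v' & L] y -> P v x y = P v' x y.
Variables vs fs : seq H.
Hypothesis Vvs : forall i, (i < 6)%N -> V vs`_i.
Hypothesis ofs : forall i, (i < 6)%N -> orth L fs`_i.
Hypothesis dual : forall i j, (i < 6)%N -> (j < 6)%N -> om fs`_i vs`_j = (i == j)%:R.

(* Through any three of the vectors [vs] the forms [P v] glue to a form on the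
   whole of [orth L]; the other three give enough room to compare the result
   with an arbitrary [P v]. *)
Lemma glue_family : exists2 D, altform L D & forall v, V v ->
  forall x y, orth (v :: L) x -> orth (v :: L) y -> D x y = P v x y.
Proof.
have PPi i j : (i < 6)%N -> (j < 6)%N -> forall x y,
    orth [:: vs`_i, vs`_j & L] x -> orth [:: vs`_i, vs`_j & L] y ->
    P vs`_i x y = P vs`_j x y.
  by move=> hi hj; apply: PP; apply: Vvs.
have D3 i j k : (i < 6)%N -> (j < 6)%N -> (k < 6)%N -> uniq [:: i; j; k] ->
    dual3 L vs`_i vs`_j vs`_k fs`_i fs`_j fs`_k.
  move=> hi hj hk; rewrite /= !inE !negb_or => /andP[/andP[/negPf n1 /negPf n2] /andP[/negPf n3 _]].
  split; rewrite ?ofs ?dual // ?eqxx ?n1 ?n2 ?n3 ?[j == i]eq_sym ?[k == i]eq_sym ?[k == j]eq_sym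
    ?n1 ?n2 ?n3 //.
have d123 : dual3 L vs`_0 vs`_1 vs`_2 fs`_0 fs`_1 fs`_2 by apply: D3.
have d456 : dual3 L vs`_3 vs`_4 vs`_5 fs`_3 fs`_4 fs`_5 by apply: D3.
have aPi i : (i < 6)%N -> altform (vs`_i :: L) (P vs`_i) by move=> /Vvs; apply: aP.
pose D := glue3 vs`_0 vs`_1 vs`_2 fs`_0 fs`_1 fs`_2 (P vs`_0) (P vs`_1) (P vs`_2).
have aD : altform L D by apply: (glue3_alt d123); apply: aPi.
have [E1 E2 E3] : [/\ _, _ & _] := glue3E d123 (aPi 0%N isT) (aPi 1%N isT) (aPi 2%N isT)
  (PPi 0%N 1%N isT isT) (PPi 0%N 2%N isT isT) (PPi 1%N 2%N isT isT).
exists D => //.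
(* [altform_tri] is applied to [D - P v] on the orthogonal of [v], which requires the three dual
   vectors to be orthogonal to [v] too. *)
have match3 v v1 v2 v3 f1 f2 f3 : V v -> V v1 -> V v2 -> V v3 ->
    dual3 (v :: L) v1 v2 v3 f1 f2 f3 ->
    (forall x y, orth (v1 :: L) x -> orth (v1 :: L) y -> D x y = P v1 x y) ->
    (forall x y, orth (v2 :: L) x -> orth (v2 :: L) y -> D x y = P v2 x y) ->
    (forall x y, orth (v3 :: L) x -> orth (v3 :: L) y -> D x y = P v3 x y) ->
    forall x y, orth (v :: L) x -> orth (v :: L) y -> D x y = P v x y.
  move=> Vv V1 V2 V3 d3 F1 F2 F3 x y ox oy.
  have aDv : altform (v :: L) D.
    by apply: (altform_sub aD) => z zL; rewrite inE zL orbT.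
  have aE := altform_lin 1 (-1) aDv (aP Vv).
  have K u : V u -> (forall x y, orth (u :: L) x -> orth (u :: L) y -> D x y = P u x y) ->
      forall x y, orth [:: u, v & L] x -> orth [:: u, v & L] y ->
      1 *: D x y + (-1) *: P v x y = 0.
    move=> Vu Fu s t os ot; rewrite Fu ?(PP Vu Vv) //.
    - by lmod.
    - by move: os => /and3P[h1 _ h2]; apply/andP.
    - by move: ot => /and3P[h1 _ h2]; apply/andP.
  have /eqP := altform_tri d3 aE (K v1 V1 F1) (K v2 V2 F2) (K v3 V3 F3) ox oy.
  by rewrite scale1r scaleN1r subr_eq0 => /eqP.
have E456 j : (2 < j < 6)%N -> forall x y, orth (vs`_j :: L) x -> orth (vs`_j :: L) y ->
    D x y = P vs`_j x y.
  move=> /andP[j2 j6]; apply: (match3 _ _ _ _ fs`_0 fs`_1 fs`_2 (Vvs j6) (Vvs _) (Vvs _) (Vvs _) _ E1 E2 E3) => //.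
  split; try by rewrite !dual.
  by split; rewrite orth_cons ofs // dual //; case: j j2 {j6} => [|[|[|j]]].
(* If the last three dual vectors are orthogonal to [v], they serve directly. Otherwise one of them,
   [fs_j], has a nonzero product with [v] and corrects the first three: it is orthogonal to the
   first three [vs], so duality is preserved. *)
move=> v Vv; pose c j := om fs`_j v.
have [/and3P[/eqP c3 /eqP c4 /eqP c5]|nc] := boolP [&& c 3%N == 0, c 4%N == 0 & c 5%N == 0].
  apply: (match3 _ _ _ _ fs`_3 fs`_4 fs`_5 Vv (Vvs _) (Vvs _) (Vvs _) _ (E456 3%N isT) (E456 4%N isT) (E456 5%N isT)) => //.
  split; try by rewrite !dual.
  by split; rewrite orth_cons ofs // andbT; apply/eqP.
have [j /andP[j2 j6] ncj] : exists2 j, (2 < j < 6)%N & c j != 0.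
  have [c3|?] := eqVneq (c 3%N) 0; last by exists 3%N.
  have [c4|?] := eqVneq (c 4%N) 0; last by exists 4%N.
  by exists 5%N => //; apply: contraNneq nc => c5; rewrite c3 c4 c5.
pose f i := 1 *: fs`_i - (c i / c j) *: fs`_j.
apply: (match3 _ _ _ _ (f 0%N) (f 1%N) (f 2%N) Vv (Vvs _) (Vvs _) (Vvs _) _ E1 E2 E3) => //.
have fE i u : om (f i) u = om fs`_i u - (c i / c j) * om fs`_j u by rewrite /f !omE mul1r.
have fo i : (i < 6)%N -> orth (v :: L) (f i).
  move=> hi; rewrite orth_cons fE orthP ?orthN ?orthZ ?ofs // andbT.
  by rewrite -/(c i) -/(c j) divfK // subrr.
have fj i : (i < 3)%N -> om fs`_j vs`_i = 0.
  by move=> hi; rewrite dual ?(leq_trans hi) // gtn_eqF // (leq_trans hi).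
split; rewrite ?fo // !fE !fj // !dual // ?mulr0 ?subr0 //.
Qed.

End Gluing.

(** * Extension of forms given on integral pairs *)

Section PairForms.
Variables (g : nat) (M : lmodType rat).
Hypothesis g4 : (3 < g)%N.
Local Notation H := (H g).
Local Notation om := (@omega g).
Local Notation int_ := (@integral g).
Variable ph : H -> H -> H -> H -> M.
Hypothesis phF : forall p q, ipair p q -> altform [:: p; q] (ph p q).
Hypothesis phA : forall p q z w, ipair p q -> ipair z w ->
  orth [:: p; q] z -> orth [:: p; q] w -> ph z w p q = - ph p q z w.

Lemma orth2_sym (x y p q : H) : orth [:: x; y] p -> orth [:: x; y] q ->
  orth [:: p; q] x /\ orth [:: p; q] y.
Proof.
rewrite /orth /= !andbT => /andP[h1 h2] /andP[h3 h4].
by rewrite !(omegaC p) !(omegaC q) !oppr_eq0 h1 h2 h3 h4.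
Qed.

(** [D p q] plays the part of a symbol with [[x, y]] in first position, whence the sign. *)
Definition extends (x y : H) D := altform [:: x; y] D /\
  forall p q, ipair p q -> orth [:: x; y] p -> orth [:: x; y] q -> D p q = - ph p q x y.

Lemma ex_ipair0 (L : seq H) : (size L < g)%N ->
  exists p q, [/\ ipair p q, orth L p & orth L q].
Proof. exact: (@ex_ipair g L [::]). Qed.

Definition extendable x y := exists D, extends x y D.

Lemma altform_equiv L L' (D : H -> H -> M) : (forall z, orth L' z = orth L z) ->
  altform L D -> altform L' D.
Proof.
move=> E [l a]; split=> [c x x' y|x y]; rewrite !E; [exact: l | exact: a].
Qed.

Lemma extendable_scale (c d : rat) x y : c != 0 -> d != 0 -> extendable x y ->
  extendable (c *: x) (d *: y).
Proof.
move=> nc nd [D [aD ED]].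
have E z : orth [:: c *: x; d *: y] z = orth [:: x; y] z.
  by rewrite /orth /= !omE !mulf_eq0 (negPf nc) (negPf nd).
exists (fun z w => (c * d) *: D z w + 0 *: D z w).
split=> [|p q ipq]; first exact: altform_equiv E (altform_lin _ _ aD aD).
rewrite !E => op oq; rewrite ED //; have [ox oy] := orth2_sym op oq.
rewrite (altZr (phF ipq)) ?orthZ // (altZl (phF ipq)) ?orthZ //.
by rewrite scale0r addr0 scalerN scalerA mulrC.
Qed.

Lemma extendable_shift (s : rat) x y : extendable x y -> extendable x (y + s *: x).
Proof.
move=> [D [aD ED]].
have E z : orth [:: x; y + s *: x] z = orth [:: x; y] z.
  by rewrite /orth /= !omE; case: eqP => //= ->; rewrite mulr0 addr0.
exists D; split=> [|p q ipq]; first exact: altform_equiv E aD.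
rewrite !E => op oq; rewrite ED //; have [ox oy] := orth2_sym op oq.
rewrite (altDr (phF ipq)) ?orthZ // (altZr (phF ipq)) //.
by rewrite (altxx (phF ipq)) // scaler0 addr0.
Qed.

Lemma extendable0 x y : x = 0 \/ y = 0 -> extendable x y.
Proof.
move=> xy0; exists (fun _ _ => 0).
split; first by split=> *; rewrite ?scaler0 ?addr0 ?oppr0.
move=> p q ipq op oq; have [ox oy] := orth2_sym op oq.
case: xy0 ox oy => ->.
  by move=> _ oy; rewrite (alt0l (phF ipq)) // oppr0.
move=> ox _; rewrite -(scale0r (0 : H)) (altZr (phF ipq)) ?orth0 //.
by rewrite scale0r oppr0.
Qed.

Lemma extendable_pair x y : ipair x y -> extendable x y.
Proof.
move=> ixy; exists (ph x y); split; first exact: phF.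
by move=> p q ipq op oq; have [ox oy] := orth2_sym op oq; exact: phA.
Qed.

Section Generic.
Variables x y b1 a2 b2 a3 b3 a4 b4 : H.
Variables k : rat.
Hypotheses (i1 : ipair x b1) (iy : y \in int_) (nk : k != 0).
Hypothesis y_def : y = om x y *: b1 + k *: a2.
Hypothesis oC : opairs [:: (a4, b4); (a3, b3); (a2, b2); (x, b1)].

Let beta := om x y.
Let V v := v \in int_ /\ om x v = 1.
(** With [r = y - beta v] one has [y = (beta - 1) v + (v + r)]. Both [v] and [v + r] are integral
    and have product 1 with [x], so both symbols exist. *)
Let P v z w := (beta - 1) *: ph x v z w + 1 *: ph x (v + (y - beta *: v)) z w.

Lemma generic_pair v : V v -> ipair x v /\ ipair x (v + (y - beta *: v)).
Proof.
move=> [iv xv]; have [ix _ _] := i1; split; first by split.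
have ib : beta \in Num.int by exact: omega_int.
split; rewrite ?integralD ?integralN ?integralZ //.
by rewrite !omE xv -/beta; ring.
Qed.

Lemma generic_alt v : V v -> altform [:: v; x; y] (P v).
Proof.
move=> Vv; have [p1 p2] := generic_pair Vv.
apply: altform_lin.
  by apply: (altform_sub (phF p1)) => z; rewrite !inE => /orP[]->; rewrite ?orbT.
have [l a] := phF p2.
have E z : orth [:: v; x; y] z -> orth [:: x; v + (y - beta *: v)] z.
  rewrite /orth /= => /and4P[/eqP h1 /eqP h2 /eqP h3 _].
  by rewrite !omE h1 h2 h3 !(mulr0, subr0, addr0, add0r) eqxx.
by split=> [c z z' w /E oz /E oz' /E ow|z w /E oz /E ow]; [exact: l | exact: a].
Qed.

Lemma generic_ext v : V v -> forall p q, ipair p q -> orth [:: v; x; y] p ->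
  orth [:: v; x; y] q -> P v p q = - ph p q x y.
Proof.
move=> Vv p q ipq; have [p1 p2] := generic_pair Vv.
rewrite {1 2}/orth /= => /and4P[/eqP h1 /eqP h2 /eqP h3 _] /and4P[/eqP h4 /eqP h5 /eqP h6 _].
have ov : orth [:: p; q] v by rewrite /orth /= !(omegaC _ v) h1 h4 oppr0 eqxx.
have ox : orth [:: p; q] x by rewrite /orth /= !(omegaC _ x) h2 h5 oppr0 eqxx.
have oy : orth [:: p; q] y by rewrite /orth /= !(omegaC _ y) h3 h6 oppr0 eqxx.
pose r := y - beta *: v.
have or : orth [:: p; q] r by rewrite orthD ?orthN ?orthZ.
rewrite -/r in p2; rewrite /P -/r.
have rE : r = y - beta *: v by [].
clearbody r; rewrite (phA ipq p1) // (phA ipq p2) //; last by rewrite orthD.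
have -> : ph p q x y = beta *: ph p q x v + ph p q x r.
  by rewrite -(altr (phF ipq)) //; congr (ph _ _ _ _); rewrite rE; lmod.
by rewrite (altDr (phF ipq)) //; lmod.
Qed.
(** On integral pairs both forms are prescribed by [generic_ext], and uniqueness does the rest. An
    integral pair orthogonal to [v, v', x, y] costs one plane for [[x, v]] and one for each of [v']
    and [y], which needs exactly [3 < g]. *)
Lemma generic_agree v v' : V v -> V v' -> forall z w,
  orth [:: v, v' & [:: x; y]] z -> orth [:: v, v' & [:: x; y]] w -> P v z w = P v' z w.
Proof.
move=> Vv Vv' z w oz ow.
have s1 : {subset [:: v; x; y] <= [:: v; v'; x; y]}.
  by move=> s; rewrite !inE => /or3P[]->; rewrite ?orbT.
have s2 : {subset [:: v'; x; y] <= [:: v; v'; x; y]}.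
  by move=> s; rewrite !inE => /or3P[]->; rewrite ?orbT.
apply: (altform_eq (altform_sub (generic_alt Vv) s1) (altform_sub (generic_alt Vv') s2)) => //.
  have [|p [q [ipq op oq]]] := @ex_ipair g [:: v'; y] [:: (x, v)] _ g4.
    by split; have [] := generic_pair Vv.
  exists p, q; split=> //.
    by move: op; rewrite /orth /= => /and5P[-> -> -> -> _].
  by move: oq; rewrite /orth /= => /and5P[-> -> -> -> _].
move=> p q ipq op oq.
rewrite !generic_ext //.
- exact: orth_sub s2 op.
- exact: orth_sub s2 oq.
- exact: orth_sub s1 op.
- exact: orth_sub s1 oq.
Qed.

Ltac intro_omega :=
  repeat match goal with
  | |- is_true (_ && _) -> _ => let H := fresh in let K := fresh in
      move=> /andP[H K]; move: H K
  | |- is_true true -> _ => move=> _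
  | |- is_true (om ?u ?v == 0) -> _ => let H := fresh "e" in let K := fresh "e" in
      move=> /eqP H; have K := omegaC u v; rewrite H oppr0 in K
  | |- om ?u ?v = 1 -> _ => let H := fresh "e" in let K := fresh "e" in
      move=> H; have K := omegaC u v; rewrite H in K
  end.
Ltac omega_table :=
  rewrite ?omE ?omegaxx;
  repeat match goal with E : om ?u ?v = _ |- context[om ?u ?v] => rewrite E end.

(* The vectors [b1 + l] and [b1] are dual to [x]; the dual family is chosen in the
   orthogonal of [x] and [y]. *)
Lemma extendable_generic : extendable x y.
Proof.
have [ix ib1 e11] := i1.
(* The term in [b2] cancels the product of [x] with [y], so [r] is orthogonal to [x] and [y] and has
   product 1 with [b1]. The sixth entry of [fs] is [r] corrected so as to be orthogonal to the first
   five [vs]. *)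
pose r := x + (beta / k) *: b2.
pose vs := [:: b1 + b2; b1 + a3; b1 + b3; b1 + a4; b1 + b4; b1].
pose fs := [:: a2; - b3; a3; - b4; a4; r - a2 + b3 - a3 + b4 - a4].
move: oC => /= [[ia4 ib4 e44] oa4 ob4 [[ia3 ib3 e33] oa3 ob3 [[ia2 ib2 e22] oa2 ob2 _]]].
move: oa4 ob4 oa3 ob3 oa2 ob2 e11 e22 e33 e44; rewrite /orth /=.
intro_omega.
have yE u : om u y = beta * om u b1 + k * om u a2.
  by rewrite {1}y_def !omE.
have Vvs i : (i < 6)%N -> V vs`_i.
  case: i => [|[|[|[|[|[|i]]]]]] //= _; split; rewrite ?integralD //; omega_table; ring.
have ofs i : (i < 6)%N -> orth [:: x; y] fs`_i.
  case: i => [|[|[|[|[|[|i]]]]]] //= _; rewrite /orth /= andbT; apply/andP; split;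
    apply/eqP; rewrite ?yE /r; omega_table; by field.
have dual i j : (i < 6)%N -> (j < 6)%N -> om fs`_i vs`_j = (i == j)%:R.
  case: i => [|[|[|[|[|[|i]]]]]] //; case: j => [|[|[|[|[|[|j]]]]]] //= _ _; rewrite /r;
    omega_table; by field.
have [D aD ED] := glue_family generic_alt generic_agree Vvs ofs dual.
exists D; split=> // p q ipq op oq.
(* Every integral pair orthogonal to [x, y] is orthogonal to some dual vector of [x]: projecting
   [b1] off the pair does not change its product with [x]. *)
pose v := proj (p, q) b1.
have [ip iq epq] := ipq.
have Vv : V v.
  split; first exact: proj_integral.
  move: op oq => /andP[/eqP px _] /andP[/eqP qx _].
  have [_ _ xb] := i1.
  by rewrite /v /proj /= !omE (omegaC p x) (omegaC q x) px qx xb; ring.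
have /and3P[/eqP vp /eqP vq _] : orth [:: p; q] v by apply: (@proj_orth g (p, q)).
have opv : orth [:: v; x; y] p by rewrite orth_cons op omegaC vp oppr0 eqxx.
have oqv : orth [:: v; x; y] q by rewrite orth_cons oq omegaC vq oppr0 eqxx.
by rewrite (ED v) // generic_ext.
Qed.
End Generic.

(** Scaling makes [x] primitive and [y] integral, and a multiple of [x] added to [y] makes [y]
    orthogonal to [b1]. Then [y] is either a multiple of [b1], where the symbol itself is the form,
    or has a component off the plane of [x, b1] that begins a second plane: the generic case. *)
Lemma all_extendable x y : extendable x y.
Proof.
have [x0|nx] := eqVneq x 0; first by apply: extendable0; left.
have [c nc [b1 ixb]] := primitive_multiple nx.
have [d nd idy] := common_denominator y.
suff E : extendable (c *: x) (d *: y).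
  have nc' : c^-1 != 0 by rewrite invr_eq0.
  have nd' : d^-1 != 0 by rewrite invr_eq0.
  by have := extendable_scale nc' nd' E; rewrite !scalerA !mulVf // !scale1r.
move: (c *: x) (d *: y) ixb idy => {c nc d nd nx y} {}x y ixb iy.
have [ix ib xb] := ixb.
pose y1 := y - om y b1 *: x.
suff E : extendable x y1.
  by have := extendable_shift (om y b1) E; rewrite subrK.
have iy1 : y1 \in int_ by rewrite integralD ?integralN ?integralZ ?omega_int.
have y1b : om y1 b1 = 0 by rewrite /y1 !omE xb; ring.
clearbody y1.
pose y2 := y1 - om x y1 *: b1.
have y1E : y1 = om x y1 *: b1 + y2 by rewrite /y2 addrC subrK.
have oC1 : opairs [:: (x, b1)] by split.
have oy2 : orth (flat [:: (x, b1)]) y2.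
  apply/and3P; split=> //; apply/eqP; rewrite /y2 !omE ?y1b ?omegaxx ?(omegaC x b1) ?xb.
    by rewrite (omegaC x y1); ring.
  by ring.
have [y20|ny2] := eqVneq y2 0.
  rewrite y1E y20 addr0; have [->|nb] := eqVneq (om x y1) 0.
    by rewrite scale0r; apply: extendable0; right.
  have := extendable_scale (oner_neq0 _) nb (extendable_pair ixb).
  by rewrite scale1r.
have [c nc [b2 [ip2 ob2]]] := primitive_multiple_orth oC1 oy2 ny2.
have oC2 : opairs [:: (c *: y2, b2); (x, b1)] by exact: (And4 ip2 (orthZ c oy2) ob2 oC1).
have [|a3 [b3 [ip3 oa3 ob3]]] := @ex_ipair g [::] _ oC2; first exact: ltnW.
rewrite !cats0 in oa3 ob3.
have oC3 : opairs [:: (a3, b3); (c *: y2, b2); (x, b1)] by exact: (And4 ip3 oa3 ob3 oC2).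
have [|a4 [b4 [ip4 oa4 ob4]]] := @ex_ipair g [::] _ oC3; first exact: g4.
rewrite !cats0 in oa4 ob4.
apply: (@extendable_generic x y1 b1 (c *: y2) b2 a3 b3 a4 b4 c^-1) => //.
  by rewrite invr_eq0.
by rewrite scalerA mulVf // scale1r.
Qed.

End PairForms.

(** * From symbols of integral pairs to a form on all quadruples *)

Section OmegaFrame.
Variable g : nat.
Local Notation H := (H g).
Local Notation om := (@omega g).

Definition omega_e (i : 'I_(g + g)) : H := delta_mx 0 i.
Definition omega_f (i : 'I_(g + g)) : H :=
  match split i with inl a => baseB a | inr a => - baseA a end.

Lemma omega_f_coord x i : om x (omega_f i) = x 0 i.
Proof.
rewrite /omega_f -[in RHS](splitK i); case: (split i) => a /=.
  exact: omega_baseB.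
by rewrite omE omega_baseA opprK.
Qed.

Lemma omega_frame : frame om omega_e omega_f.
Proof.
split=> [i j|x|z].
- by rewrite omega_f_coord /omega_e mxE eqxx /= eq_sym.
- rewrite {1}[x]row_sum_delta; apply: eq_bigr => i _.
  by rewrite omega_f_coord.
rewrite big_split_ord /= {1}[z]base_sum big_split /= addrC.
congr (_ + _); apply: eq_bigr => a _; rewrite /omega_f /omega_e.
  have -> : split (lshift g a) = inl a by apply: (unsplitK (inl a)).
  by rewrite -/(baseA a) omegaC omega_baseA opprK.
have -> : split (rshift g a) = inr a by apply: (unsplitK (inr a)).
by rewrite -/(baseB a) omegaC omega_baseB scalerN scaleNr opprK.
Qed.

End OmegaFrame.

Section PairExtension.
Variables (g : nat) (M : lmodType rat).
Hypothesis g4 : (3 < g)%N.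
Local Notation H := (H g).
Local Notation om := (@omega g).
Variable ph : H -> H -> H -> H -> M.
Hypothesis phF : forall p q, ipair p q -> altform [:: p; q] (ph p q).
Hypothesis phA : forall p q z w, ipair p q -> ipair z w ->
  orth [:: p; q] z -> orth [:: p; q] w -> ph z w p q = - ph p q z w.

Lemma perp4_orth x y z w : perp4 om x y z w -> orth [:: x; y] z /\ orth [:: x; y] w.
Proof.
rewrite /perp4 /orth /= => /and4P[/eqP h1 /eqP h2 /eqP h3 /eqP h4].
by rewrite (omegaC x z) (omegaC y z) (omegaC x w) (omegaC y w) h1 h2 h3 h4 oppr0 eqxx.
Qed.

Lemma orth_perp4 x y z w : orth [:: x; y] z -> orth [:: x; y] w -> perp4 om x y z w.
Proof.
rewrite /perp4 /orth /= => /and3P[/eqP h1 /eqP h2 _] /and3P[/eqP h3 /eqP h4 _].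
by rewrite (omegaC z x) (omegaC z y) (omegaC w x) (omegaC w y) h1 h2 h3 h4 oppr0 eqxx.
Qed.

(** The forms are chosen independently for each [[x, y]]; uniqueness makes the choice linear and
    alternating. Linearity in [x] compares forms on the orthogonal of [x, x', y], which contains an
    integral pair as [3 < g]. *)
Lemma pair_orthlin : exists F : H -> H -> H -> H -> M, [/\ orthlin om F,
  forall p q u w, ipair p q -> orth [:: p; q] u -> orth [:: p; q] w ->
    F p q u w = ph p q u w &
  forall p q u w, ipair p q -> orth [:: p; q] u -> orth [:: p; q] w ->
    F u w p q = - ph p q u w].
Proof.
have ex_D xy : exists D, extends ph xy.1 xy.2 D by apply: all_extendable.
have [F0 F0P] := choice ex_D.
pose F x y := F0 (x, y).
have FP x y : extends ph x y (F x y) := F0P (x, y).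
have aF x y : altform [:: x; y] (F x y) by case: (FP x y).
have FE x y p q : ipair p q -> orth [:: x; y] p -> orth [:: x; y] q ->
    F x y p q = - ph p q x y by case: (FP x y) => _; apply.
have F1 p q u w : ipair p q -> orth [:: p; q] u -> orth [:: p; q] w ->
    F p q u w = ph p q u w.
  move=> ipq; apply: (altform_eq (aF p q) (phF ipq)).
    by apply: ex_ipair0; apply: ltn_trans g4.
  move=> a c iac oa oc; rewrite FE // -(phA iac ipq) //.
    by have [] := orth2_sym oa oc.
  by have [] := orth2_sym oa oc.
exists F; split=> [|//|p q u w ipq ou ow]; last first.
  by have [op oq] := orth2_sym ou ow; rewrite FE.
split=> [k x x' y z w o o'|x y z w o|k x y z z' w o o'|x y z w o].
- have [oz ow] := perp4_orth o; have [oz' ow'] := perp4_orth o'.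
  pose L := [:: x; x'; y].
  have s1 : {subset [:: x; y] <= L} by move=> s; rewrite !inE => /orP[]->; rewrite ?orbT.
  have s2 : {subset [:: x'; y] <= L} by move=> s; rewrite !inE => /orP[]->; rewrite ?orbT.
  have oL t : orth [:: x; y] t -> orth [:: x'; y] t -> orth L t.
    by rewrite /orth /= => /and3P[-> -> _] /and3P[-> _ _].
  have oL1 t : orth L t -> orth [:: k *: x + x'; y] t.
    by rewrite /orth /= => /and4P[/eqP h1 /eqP h2 -> _]; rewrite !omE h1 h2 mulr0 addr0 eqxx.
  have aL : altform L (F (k *: x + x') y).
    have [l a] := aF (k *: x + x') y.
    by split=> [c t t' u /oL1 ? /oL1 ? /oL1 ?|t u /oL1 ? /oL1 ?]; [exact: l | exact: a].
  have aR := altform_lin k 1 (altform_sub (aF x y) s1) (altform_sub (aF x' y) s2).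
  have := altform_eq aL aR (ex_ipair0 _ : exists p q, [/\ ipair p q, orth L p & orth L q]).
  rewrite g4 => /(_ isT) E; rewrite E ?scale1r //; [|exact: oL|exact: oL].
  move=> p q ipq op oq; rewrite !FE ?oL1 ?(orth_sub s1) ?(orth_sub s2) //.
  have [ox oy] := orth2_sym (orth_sub s1 op) (orth_sub s1 oq).
  have [ox' _] := orth2_sym (orth_sub s2 op) (orth_sub s2 oq).
  by rewrite (altl (phF ipq)) //; lmod.
- have [oz ow] := perp4_orth o.
  have sC : {subset [:: y; x] <= [:: x; y]} by move=> s; rewrite !inE orbC.
  have sC' : {subset [:: x; y] <= [:: y; x]} by move=> s; rewrite !inE orbC.
  have aR := altform_lin (-1) 0 (aF x y) (aF x y).
  have := altform_eq (altform_sub (aF y x) sC) aR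
    (ex_ipair0 _ : exists p q, [/\ ipair p q, orth _ p & orth _ q]).
  rewrite (ltn_trans _ g4) // => /(_ isT) E.
  rewrite E //; first by lmod.
  move=> p q ipq op oq; rewrite !FE ?(orth_sub sC) //.
  by have [ox oy] := orth2_sym op oq; rewrite (altC (phF ipq) ox oy); lmod.
- have [oz ow] := perp4_orth o; have [oz' _] := perp4_orth o'.
  exact: (altl (aF x y)).
- by have [oz ow] := perp4_orth o; exact: (altC (aF x y)).
Qed.

Lemma pair_extension : exists2 B : H -> H -> H -> H -> M, alt4 B &
  forall p q u w, ipair p q -> orth [:: p; q] u -> orth [:: p; q] w ->
    B p q u w = ph p q u w /\ B u w p q = - ph p q u w.
Proof.
have [F [olF F1 F2]] := pair_orthlin.
have n8 : (7 < g + g)%N by rewrite (leq_add g4 g4).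
have [B aB BE] := orthlin_extend (omega_bilin g) (omega_frame g) n8 olF.
exists B => // p q u w ipq ou ow; have [op oq] := orth2_sym ou ow.
by split; [rewrite -BE ?F1 // | rewrite -BE ?F2 //]; exact: orth_perp4.
Qed.

End PairExtension.

(** * The left inverse *)

Section Descent.
Variables (g : nat) (U : lmodType rat).
Local Notation H := (H g).
Local Notation om := (@omega g).

Lemma altform_bilin (D : H -> H -> U) : altform [::] D -> bilin D /\ forall x, D x x = 0.
Proof.
move=> aD; split; last by move=> x; exact: (altxx aD).
by split=> [y a x x'|x a y y']; [exact: (altl aD) | exact: (altr aD)].
Qed.

Lemma altform_sum I (r : seq I) (X : I -> H) y (D : H -> H -> U) : altform [::] D ->
  \sum_(i <- r) D (X i) y = D (\sum_(i <- r) X i) y.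
Proof.
move=> aD; elim/big_rec2: _ => [|i a z _ ->]; first by rewrite (alt0l aD).
by rewrite (altDl aD).
Qed.

(** The bivector of the form does not depend on the symplectic basis: it splits into the wedge of
    [p] and [q] and the bivector of their orthogonal complement. *)
Lemma omega2_proj p q (D : H -> H -> U) : om p q = 1 -> altform [::] D ->
  \sum_i D (baseA i) (baseB i) =
  D p q + \sum_i D (proj (p, q) (baseA i)) (proj (p, q) (baseB i)).
Proof.
move=> pq aD.
pose X (z : H) i := z 0 (lshift g i) *: baseA i + z 0 (rshift g i) *: baseB i.
have sX z : \sum_i X z i = z by rewrite -base_sum.
transitivity (\sum_i D (proj (p, q) (baseA i)) (proj (p, q) (baseB i))
  + \sum_i (D (X p i) q - D (X q i) p - (p 0 (lshift g i) * q 0 (rshift g i)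
       - p 0 (rshift g i) * q 0 (lshift g i)) *: D p q)).
  rewrite -big_split; apply: eq_bigr => i _; rewrite /proj /X /=.
  rewrite !(omegaC _ (baseA i)) !(omegaC _ (baseB i)) !omega_baseA !omega_baseB.
  rewrite !opprK -!scaleNr !(altDl aD) // !(altDr aD) // !(altZl aD) // !(altZr aD) //.
  rewrite !(altxx aD) // (altC aD (_ : orth [::] p) (_ : orth [::] q)) //.
  rewrite (altC aD (_ : orth [::] (baseB i)) (_ : orth [::] p)) //.
  rewrite (altC aD (_ : orth [::] (baseB i)) (_ : orth [::] q)) //.
  by lmod.
rewrite !sumrB -scaler_suml -/(omega p q) pq !altform_sum // !sX.
by rewrite (altC aD (_ : orth [::] p) (_ : orth [::] q)) //; lmod.
Qed.

Lemma W2_lift (D : H -> H -> U) : altform [::] D ->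
  \sum_i D (baseA i) (baseB i) = 0 ->
  exists f : {linear W2 g -> U}, forall x y, f (wedgeW x y) = D x y.
Proof.
move=> aD D0; have [bD D1] := altform_bilin aD.
have kill r : [set omega2 g]%classic r -> wlift bD D1 r = 0.
  by move=> ->; rewrite linear_sum -[RHS]D0; apply: eq_bigr => i _; exact: wliftE.
exists (qlift kill) => x y.
exact: etrans (qliftE _ _) (wliftE _ _ _ _).
Qed.

Lemma sym2_lift (V : lmodType rat) (D : V -> V -> U) : bilin D -> (forall x y, D x y = D y x) ->
  exists f : {linear sym2 V -> U}, forall x y, f (smul x y) = D x y.
Proof.
move=> bD DC.
have kill r : sym2_rel r -> tlift bD r = 0.
  by case=> x y; rewrite linearB /= !tliftE DC subrr.
exists (qlift kill) => x y.
exact: etrans (qliftE _ _) (tliftE _ _ _).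
Qed.

End Descent.

Section Descent2.
Variables (g : nat) (M : lmodType rat).
Local Notation H := (H g).
Variable B : H -> H -> H -> H -> M.
Hypothesis aB : alt4 B.
Hypothesis BC : forall x y z w, B z w x y = - B x y z w.
Hypothesis B0 : forall x y, \sum_i B x y (baseA i) (baseB i) = 0.

Lemma alt4_form x y : altform [::] (B x y).
Proof. by split=> *; [exact: (alt4r aB) | exact: (alt4rC aB)]. Qed.

(** The descent is done one pair at a time: [B0] kills [omega2] in the second pair, and [BC]
    transfers this to the first. *)
Lemma W2_lift2 : exists f : {linear wedge2 (W2 g) -> M}, forall x y z w,
  f (wedge (wedgeW x y) (wedgeW z w)) = B x y z w.
Proof.
have ex1 xy : exists f : {linear W2 g -> M}, forall z w, f (wedgeW z w) = B xy.1 xy.2 z w.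
  exact: (W2_lift (alt4_form xy.1 xy.2)).
have [f fE] := choice ex1.
have fl k c x x' y : f (c *: x + x', y) k = c *: f (x, y) k + f (x', y) k.
  elim/W2_ind: k => [|b u v Pu Pv|z w].
  - by rewrite !linear0 ?scaler0 ?addr0.
  - by rewrite ![f _ (b *: u + v)]linearP Pu Pv; lmod.
  - by rewrite !fE /= (alt4l aB).
have fC k x y : f (y, x) k = - f (x, y) k.
  elim/W2_ind: k => [|b u v Pu Pv|z w].
  - by rewrite !linear0 ?oppr0.
  - by rewrite ![f _ (b *: u + v)]linearP Pu Pv; lmod.
  - by rewrite !fE /= (alt4lC aB).
have af k : altform [::] (fun x y => f (x, y) k).
  by split=> *; [exact: fl | exact: fC].
have f0 k : \sum_i f (baseA i, baseB i) k = 0.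
  elim/W2_ind: k => [|b u v Pu Pv|z w].
  - by rewrite big1 // => i _; rewrite linear0.
  - under eq_bigr do rewrite linearP.
    by rewrite big_split /= -scaler_sumr Pu Pv scaler0 addr0.
  - under eq_bigr do rewrite fE /= BC.
    by rewrite sumrN B0 oppr0.
have ex2 k : exists h : {linear W2 g -> M}, forall x y, h (wedgeW x y) = f (x, y) k.
  exact: W2_lift (af k) (f0 k).
have [h hE] := choice ex2.
have hl k : linear (h k) by move=> c u v; rewrite linearP.
have hr k : linear (h^~ k).
  move=> c u v; elim/W2_ind: k => [|b s t Ps Pt|z w].
  - by rewrite !linear0 ?scaler0 ?addr0.
  - by rewrite ![h _ (b *: s + t)]linearP Ps Pt; lmod.
  - by rewrite !hE linearP.
have hC k k' : h k k' = - h k' k.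
  elim/W2_ind: k => [|b s t Ps Pt|x y].
  - have := hr k' (-1) 0 0; rewrite scaler0 addr0 scaleN1r addNr => ->.
    by rewrite linear0 ?oppr0.
  - by rewrite hr hl Ps Pt; lmod.
  elim/W2_ind: k' => [|b s t Ps Pt|z w].
  - have := hr (wedgeW x y) (-1) 0 0; rewrite scaler0 addr0 scaleN1r addNr => ->.
    by rewrite linear0 ?oppr0.
  - by rewrite hr hl Ps Pt; lmod.
  - by rewrite !hE !fE BC.
have hB : bilin (fun k k' => h k' k) by split=> [k|k]; [exact: hl | exact: hr].
have hA k : h k k = 0.
  have /eqP := hC k k; rewrite -addr_eq0 -mulr2n -scaler_nat scaler_eq0.
  by rewrite pnatr_eq0 => /eqP.
exists (wlift hB hA) => x y z w.
by apply: etrans (wliftE _ _ _ _) _; rewrite hE fE.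
Qed.

End Descent2.

Lemma eq_opp_eq0 (U : lmodType rat) (x : U) : x = - x -> x = 0.
Proof.
move=> /eqP; rewrite -addr_eq0 -mulr2n -scaler_nat scaler_eq0 pnatr_eq0.
by move/eqP.
Qed.

(** * Injectivity *)

Section Injectivity.
Variable g : nat.
Hypothesis g4 : (3 < g)%N.
Local Notation H := (H g).
Local Notation om := (@omega g).
Local Notation M := (Kpres g).

(* Junk value 0 off the generators. *)
Definition symb0 (k1 k2 : W2 g) : M :=
  if pselect (is_gen k1 k2) is left h then symb h else 0.

Lemma symb0E k1 k2 (h : is_gen k1 k2) : symb0 k1 k2 = symb h.
Proof.
rewrite /symb0; case: pselect => // h'.
by rewrite (Prop_irrelevance h' h).
Qed.

Lemma symb0C k1 k2 : is_gen k1 k2 -> symb0 k2 k1 = - symb0 k1 k2.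
Proof.
move=> h; have h' : is_gen k2 k1.
  case: h => o s; split; last by case: s; [right | left].
  by rewrite /sym_orthogonal contrC o oppr0.
rewrite (symb0E h) (symb0E h').
have := qpi_rel (KrelAnti h h').
by rewrite (linearB (qpi _)) (linearN (qpi _)) => /subr0_eq.
Qed.

Lemma contr_r0 (s : W2 g) : contr s 0 = 0.
Proof. by have := contr_linr s (-1) 0 0; rewrite scaler0 addr0 scaleN1r addNr. Qed.

Lemma contr_r_lin0 (s k1 k2 : W2 g) a c : contr s k1 = 0 -> contr s k2 = 0 ->
  contr s (a *: k1 + c *: k2) = 0.
Proof.
move=> c1 c2; rewrite (contr_linr s a k1) c1 scaler0 add0r.
have := contr_linr s c k2 0; rewrite contr_r0 c2 scaler0 !addr0; exact.
Qed.

Lemma symb0_lin s k1 k2 (l1 l2 : rat) : symplectic_pair s ->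
  contr s k1 = 0 -> contr s k2 = 0 ->
  symb0 s (l1 *: k1 + l2 *: k2) = l1 *: symb0 s k1 + l2 *: symb0 s k2.
Proof.
move=> sp c1 c2; have h1 : is_gen s k1 by split; [|left].
have h2 : is_gen s k2 by split; [|left].
have h : is_gen s (l1 *: k1 + l2 *: k2).
  by split; [exact: contr_r_lin0 | left].
rewrite (symb0E h1) (symb0E h2) (symb0E h).
have := qpi_rel (KrelLin h1 h2 h sp).
by rewrite (linearB (qpi _)) (linearP (qpi _)) (linearZ_LR (qpi _)) => /subr0_eq.
Qed.

Lemma ipair_symplectic p q : @ipair g p q -> symplectic_pair (wedgeW p q).
Proof. by case=> ip iq pq; exists p, q. Qed.

Lemma contr_orth (p q u w : H) : orth [:: p; q] u -> orth [:: p; q] w ->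
  contr (wedgeW p q) (wedgeW u w) = 0.
Proof.
rewrite /orth /= => /and3P[/eqP pu /eqP qu _] /and3P[/eqP pw /eqP qw _].
rewrite contrE (omegaC u p) (omegaC u q) (omegaC w p) (omegaC w q) pu qu pw qw.
by rewrite oppr0 !scale0r !subr0 addr0.
Qed.

Lemma wedgeW_lin c (x x' y : H) : wedgeW (c *: x + x') y = c *: wedgeW x y + 1 *: wedgeW x' y.
Proof. by rewrite (wedgeW_bilin g).1 scale1r. Qed.

Lemma wedgeW_alt : altform [::] (@wedgeW g).
Proof.
split=> [c x x' y _ _ _|x y _ _]; first exact: (wedgeW_bilin g).1.
by rewrite /wedgeW wedgeC linearN.
Qed.

Let ph p q u w := symb0 (wedgeW p q) (wedgeW u w).

Lemma symb0_form p q : @ipair g p q -> altform [:: p; q] (ph p q).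
Proof.
move=> ipq; have sp := ipair_symplectic ipq; split=> [c x x' y ox ox' oy|x y ox oy].
  by rewrite /ph wedgeW_lin symb0_lin ?contr_orth // scale1r.
rewrite /ph (altC wedgeW_alt (_ : orth [::] x) (_ : orth [::] y)) //.
have -> : - wedgeW x y = (-1) *: wedgeW x y + 0 *: wedgeW x y by lmod.
by rewrite symb0_lin ?contr_orth // scaleN1r scale0r addr0.
Qed.

Lemma symb0_formC p q z w : @ipair g p q -> ipair z w ->
  orth [:: p; q] z -> orth [:: p; q] w -> ph z w p q = - ph p q z w.
Proof.
move=> ipq izw oz ow; apply: symb0C; split; first exact: contr_orth.
by left; apply: ipair_symplectic.
Qed.

Lemma symb0_self s : symplectic_pair s -> symb0 s s = 0.
Proof.
move=> sp; have h : is_gen s s by split; [exact: contr_alt | left].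
exact/eq_opp_eq0/symb0C.
Qed.

Lemma sum_orth_proj p q : @ipair g p q ->
  \sum_i wedgeW (proj (p, q) (baseA i)) (proj (p, q) (baseB i)) = - wedgeW p q.
Proof.
move=> [_ _ pq]; have := omega2_proj pq wedgeW_alt.
have -> : \sum_i wedgeW (baseA i) (baseB i) = 0 :> W2 g.
  transitivity (qpi [set omega2 g]%classic (omega2 g)); last exact: qpi_rel.
  by rewrite linear_sum.
by move/esym/eqP; rewrite addrC addr_eq0 => /eqP.
Qed.

Lemma symb0_sum s I (r : seq I) (k : I -> W2 g) : symplectic_pair s ->
  (forall i, contr s (k i) = 0) ->
  symb0 s (\sum_(i <- r) k i) = \sum_(i <- r) symb0 s (k i)
  /\ contr s (\sum_(i <- r) k i) = 0.
Proof.
move=> sp ck; elim: r => [|i r [IHr cr]].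
  rewrite !big_nil contr_r0; split=> //.
  have := @symb0_lin s s s 0 0 sp (contr_alt s) (contr_alt s).
  by rewrite !scale0r !addr0.
rewrite !big_cons -[k i]scale1r -[\sum_(j <- r) k j]scale1r.
rewrite symb0_lin // !scale1r IHr; split=> //.
by have := contr_r_lin0 1 1 (ck i) cr; rewrite !scale1r.
Qed.

(** Antisymmetrizing does not change the prescribed values, which are already antisymmetric. That
    [B] kills [omega2] need only be seen with an integral pair [p, q] in the other slot. There
    [omega2] is the wedge of [p] and [q], where [B] vanishes by antisymmetry, plus a sum on the
    orthogonal, where [B] is the symbol; in [W2] that sum is [- wedgeW p q], and a symplectic pair
    has zero symbol with itself. *)
Lemma ex_form : exists B : H -> H -> H -> H -> M, [/\ alt4 B,
  forall x y z w, B z w x y = - B x y z w,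
  forall x y, \sum_i B x y (baseA i) (baseB i) = 0 &
  forall p q u w, ipair p q -> orth [:: p; q] u -> orth [:: p; q] w ->
    B p q u w = ph p q u w].
Proof.
have [B0 aB0 B0E] := pair_extension g4 symb0_form symb0_formC.
pose B x y z w := 2^-1 *: B0 x y z w - 2^-1 *: B0 z w x y.
have BC x y z w : B z w x y = - B x y z w by rewrite /B; lmod.
have BE p q u w : ipair p q -> orth [:: p; q] u -> orth [:: p; q] w ->
    B p q u w = ph p q u w.
  by move=> ipq ou ow; have [e1 e2] := B0E p q u w ipq ou ow; rewrite /B e1 e2; lmod.
have aB : alt4 B.
  case: aB0 => h1 h2 h3 h4; split=> [k x x' y z w|x y z w|k x y z z' w|x y z w]; rewrite /B.
  - by rewrite h1 h3; lmod.
  - by rewrite (h2 x y z w) (h4 z w x y); lmod.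
  - by rewrite h1 h3; lmod.
  - by rewrite (h4 x y z w) (h2 z w x y); lmod.
exists B; split=> // x y.
have [h [k [ihk oh ok]]] := @ex_ipair0 g [::] (ltn_trans (isT : 0 < 3)%N g4).
apply: (span_ipair (L := [::]) (D := fun x y => \sum_i B x y (baseA i) (baseB i)) ihk) => //.
- move=> c u u' v _ _ _; rewrite scaler_sumr -big_split; apply: eq_bigr => i _ /=.
  exact: (alt4l aB).
- move=> u v _ _; rewrite -sumrN; apply: eq_bigr => i _; exact: (alt4lC aB).
move=> p q ipq _ _; have [ip iq pq] := ipq.
rewrite (omega2_proj pq (alt4_form aB p q)).
have -> : B p q p q = 0 by exact/eq_opp_eq0/BC.
have op z : orth [:: p; q] (proj (p, q) z) by apply: (@proj_orth g (p, q)).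
rewrite add0r; under eq_bigr do rewrite BE //.
have sp := ipair_symplectic ipq.
have [<- _] := symb0_sum (index_enum _) sp
  (fun i => contr_orth (op (baseA i)) (op (baseB i))).
rewrite sum_orth_proj //.
have -> : - wedgeW p q = (-1) *: wedgeW p q + 0 *: wedgeW p q by lmod.
by rewrite symb0_lin ?contr_alt // symb0_self // !scaler0 addr0.
Qed.

Lemma smul_eq0 p q (m n : H) : om p q = 1 -> orth [:: p; q] m -> orth [:: p; q] n ->
  smul p m + smul q n = 0 -> m = 0 /\ n = 0.
Proof.
move=> pq om_ on E.
have key (l : H) : forall t, om p l * om m t + om p t * om m l
     + (om q l * om n t + om q t * om n l) = 0.
  (* The symmetric product of the functionals given by [l] and [t]; taking [l] to be [q], then [p],
     isolates [m], then [n]. *)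
  move=> t; pose D (x y : H) : rat^o := om x l * om y t + om x t * om y l.
  have bD : bilin D.
    by split=> [y a u v|x a u v]; rewrite /D !omE /GRing.scale /=; ring.
  have DC x y : D x y = D y x by rewrite /D; ring.
  have [f fE] := sym2_lift bD DC.
  have := congr1 f E; rewrite linear0 linearD !fE; exact.
move: om_ on; rewrite /orth /= => /and3P[/eqP mp /eqP mq _] /and3P[/eqP np /eqP nq _].
have z0 (z : H) : (forall t, om z t = 0) -> z = 0.
  by move=> h; rewrite (framel (omega_frame g) z) big1 // => i _; rewrite h scale0r.
split; apply: z0 => t.
  by have := key q t; rewrite pq omegaxx mq nq !mulr0 !addr0 mul1r mul0r addr0.
have := key p t; rewrite omegaxx mp np (omegaC p q) pq !mulr0 mul0r !addr0 add0r.
by rewrite mulN1r => /eqP; rewrite oppr_eq0 => /eqP.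
Qed.

Lemma pair_decomposition p q (P : W2 g -> Prop) : @ipair g p q -> P 0 -> P (wedgeW p q) ->
  (forall u w, orth [:: p; q] u -> orth [:: p; q] w -> P (wedgeW u w)) ->
  (forall a u v, P u -> P v -> P (a *: u + v)) ->
  forall k, exists m n k0, [/\ orth [:: p; q] m, orth [:: p; q] n, P k0 &
     k = wedgeW p m + wedgeW q n + k0].
Proof.
move=> [ip iq pq] P0 Ps Po PD k.
have W0 (x : H) : wedgeW x 0 = 0 by rewrite /wedgeW linear0 linear0.
elim/W2_ind: k => [|a k l [m [n [k0 [om_ on Pk ->]]]] [m' [n' [k0' [om' on' Pk' ->]]]]|x y].
- by exists 0, 0, 0; rewrite orth0 !W0 !addr0.
- exists (a *: m + m'), (a *: n + n'), (a *: k0 + k0').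
  rewrite !orthP //; split=> //; first exact: PD.
  by rewrite !(wedgeW_bilin g).2; lmod.
have op z : orth [:: p; q] (proj (p, q) z) by apply: (@proj_orth g (p, q)).
have dec z : z = om z q *: p + ((- om z p) *: q + proj (p, q) z).
  by rewrite /proj /=; lmod.
move: (op x) (op y) (dec x) (dec y).
move: (proj _ x) (proj _ y) (om x q) (- om x p) (om y q) (- om y p).
move=> x' y' a b c d ox oy -> ->.
exists (a *: y' + (- c) *: x'), (b *: y' + (- d) *: x').
exists ((a * d - b * c) *: wedgeW p q + wedgeW x' y').
rewrite !orthP ?orthZ //; split=> //; first by apply: PD => //; exact: Po.
have aW := wedgeW_alt.
rewrite !(altl aW) // !(altr aW) // !(altZr aW) //.
rewrite !(altxx aW) // (altC aW (_ : orth [::] p) (_ : orth [::] q)) //.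
rewrite (altC aW (_ : orth [::] p) (_ : orth [::] x')) //.
rewrite (altC aW (_ : orth [::] q) (_ : orth [::] x')) //.
by lmod.
Qed.

(** Contraction with [wedgeW p q] sends [wedgeW p m + wedgeW q n] to [smul p m + smul q n], which
    vanishes only for [m = n = 0]. So the elements sym-orthogonal to the pair are spanned by the
    pair and the wedges of vectors orthogonal to it. The closure hypothesis is restricted to them,
    since symbols are linear only there. *)
Lemma centralizer_ind p q (P : W2 g -> Prop) : @ipair g p q -> P 0 -> P (wedgeW p q) ->
  (forall u w, orth [:: p; q] u -> orth [:: p; q] w -> P (wedgeW u w)) ->
  (forall a u v, contr (wedgeW p q) u = 0 -> contr (wedgeW p q) v = 0 ->
     P u -> P v -> P (a *: u + v)) ->
  forall k, contr (wedgeW p q) k = 0 -> P k.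
Proof.
move=> ipq P0 Ps Po PD k ck; have [ip iq pq] := ipq.
have [||||m [n [k0 [om_ on [ck0 Pk0] E]]]] :=
  @pair_decomposition p q (fun u => contr (wedgeW p q) u = 0 /\ P u) ipq _ _ _ _ k.
- by rewrite linear0.
- by rewrite contr_alt.
- by move=> u w ou ow; rewrite contr_orth //; split=> //; exact: Po.
- move=> a u v [cu Pu] [cv Pv]; rewrite (contr_linr _ a u v) cu cv scaler0 addr0.
  by split=> //; exact: PD.
have o0 : orth [:: p; q] 0 by exact: orth0.
have E0 : smul p m + smul q n = 0.
  move: (om_) (on); rewrite /orth /= => /and3P[/eqP mp /eqP mq _] /and3P[/eqP np /eqP nq _].
  have cm : contr (wedgeW p q) (wedgeW p m) = smul p m.
    rewrite contrE omegaxx (omegaC m p) (omegaC m q) mp mq (omegaC p q) pq.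
    by lmod.
  have cn : contr (wedgeW p q) (wedgeW q n) = smul q n.
    rewrite contrE omegaxx (omegaC n p) (omegaC n q) np nq pq.
    by lmod.
  have E1 : k = 1 *: wedgeW p m + (1 *: wedgeW q n + k0) by rewrite E; lmod.
  have := ck; rewrite E1 (contr_linr _ 1 (wedgeW p m)) (contr_linr _ 1 (wedgeW q n)).
  by rewrite ck0 cm cn !scale1r addr0.
have [m0 n0] := smul_eq0 pq om_ on E0.
rewrite E m0 n0; have W0 (x : H) : wedgeW x 0 = 0 by rewrite /wedgeW linear0 linear0.
by rewrite !W0 !add0r.
Qed.

Theorem Phi0_injective : injective (@Phi0 g).
Proof.
have [B [aB BC B0 BE]] := ex_form.
have [L LE] := W2_lift2 aB BC B0.
have L2 k1 k2 : L (wedge k2 k1) = - L (wedge k1 k2) by rewrite wedgeC linearN.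
have Lsp s k : symplectic_pair s -> contr s k = 0 -> L (wedge s k) = symb0 s k.
  move=> [p [q [ip iq pq ->]]] ck; have ipq : ipair p q by [].
  have sp := ipair_symplectic ipq.
  apply: (@centralizer_ind p q (fun k => L (wedge (wedgeW p q) k) = symb0 (wedgeW p q) k)
    ipq _ _ _ _ k ck) => [||u w ou ow|a u v cu cv Eu Ev].
  - have -> : wedge (wedgeW p q) 0 = 0 by exact: linear0.
    have := @symb0_lin (wedgeW p q) 0 0 0 0 sp (contr_r0 _) (contr_r0 _).
    by rewrite (linear0 L) !scale0r !addr0 => ->.
  - by rewrite wedgexx (symb0_self sp); exact: linear0.
  - by rewrite LE BE.
  - rewrite (wedge_bilin _).2 linearP Eu Ev -[v in RHS]scale1r symb0_lin //.
    by rewrite scale1r.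
have Lgen k1 k2 (h : is_gen k1 k2) : L (wedge k1 k2) = symb h.
  rewrite -symb0E; case: (h) => o [s1|s2]; first exact: Lsp.
  have h' : is_gen k2 k1 by split; [rewrite /sym_orthogonal contrC o oppr0 | left].
  by rewrite (L2 k2 k1) (Lsp _ _ s2 h'.1) (symb0C h) opprK.
suff K : cancel (@Phi0 g) L by exact: can_inj K.
move=> u; have [v ->] := qpi_surj u.
elim/malg_lin_ind: v => [|a v w Pv Pw|[[k1 k2] h]].
- by rewrite !linear0.
- rewrite (linearP (qpi (@Krel g))) (linearP (@Phi0 g)) linearP Pv Pw //.
have -> : << (exist _ (k1, k2) h : gen g) >> = fsymb (asboolW h) :> {malg rat[gen g]}.
  by rewrite fsymb.unlock; congr (<< exist _ _ _ >>); exact: bool_irrelevance.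
by rewrite -[qpi _ _]/(symb (asboolW h)) Phi0E; exact: Lgen.
Qed.

End Injectivity.

(** * The image *)

Section Alt4Frame.
Variables (A C M : lmodType rat) (b : A -> C -> rat).
Variables (n : nat) (e : 'I_n -> A) (f : 'I_n -> C).
Hypothesis fr : frame b e f.
Variable E : A -> A -> C -> C -> M.
Hypothesis aE : alt4 E.

Lemma alt40l y z w : E 0 y z w = 0.
Proof. by have := alt4l aE (-1) 0 0 y z w; rewrite scaler0 addr0 scaleN1r addNr. Qed.

Lemma alt40r x y w : E x y 0 w = 0.
Proof. by have := alt4r aE (-1) x y 0 0 w; rewrite scaler0 addr0 scaleN1r addNr. Qed.

Lemma alt4_suml I (r : seq I) (c : I -> rat) (X : I -> A) y z w :
  (forall i, E (X i) y z w = 0) -> E (\sum_(i <- r) c i *: X i) y z w = 0.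
Proof.
move=> E0; elim/big_rec: _ => [|i u _ Eu]; first exact: alt40l.
by rewrite (alt4l aE) E0 Eu scaler0 addr0.
Qed.

Lemma alt4_sumr I (r : seq I) (c : I -> rat) x y (Z : I -> C) w :
  (forall i, E x y (Z i) w = 0) -> E x y (\sum_(i <- r) c i *: Z i) w = 0.
Proof.
move=> E0; elim/big_rec: _ => [|i u _ Eu]; first exact: alt40r.
by rewrite (alt4r aE) E0 Eu scaler0 addr0.
Qed.

Lemma alt4_frame0 : (forall i j k l, i != j -> k != l -> E (e i) (e j) (f k) (f l) = 0) ->
  forall x y z w, E x y z w = 0.
Proof.
move=> E0 x y z w.
have El y' z' w' : E y' y' z' w' = 0 by exact/eq_opp_eq0/(alt4lC aE).
have Er x' y' z' : E x' y' z' z' = 0 by exact/eq_opp_eq0/(alt4rC aE).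
rewrite (framel fr x); apply: alt4_suml => i; rewrite (alt4lC aE).
rewrite (framel fr y) alt4_suml ?oppr0 // => j.
rewrite (framer fr z); apply: alt4_sumr => k; rewrite (alt4rC aE).
rewrite (framer fr w) alt4_sumr ?oppr0 // => l.
have [->|nij] := eqVneq j i; first by rewrite El.
have [->|nkl] := eqVneq l k; first by rewrite Er.
exact: E0.
Qed.

End Alt4Frame.

(** * Antisymmetric forms vanishing on orthogonal quadruples *)

Section Contraction.
Variables (g : nat) (M : lmodType rat).
Hypothesis g4 : (3 < g)%N.
Local Notation H := (H g).
Local Notation om := (@omega g).
Variable B : H -> H -> H -> H -> M.
Hypothesis aB : alt4 B.
Hypothesis BC : forall x y z w, B z w x y = - B x y z w.
Hypothesis Bperp : forall x y z w, perp4 om x y z w -> B x y z w = 0.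
Local Notation e := (@omega_e g).
Local Notation f := (@omega_f g).
Local Notation fr := (omega_frame g).
Local Notation n := (g + g)%N.

(** The tensor [sum e_i (x) f_i] of the frame is antisymmetric, being the sum of the
    [a (x) b - b (x) a] over the symplectic basis. *)
Lemma sum_frame_swap (P : H -> H -> M) : bilin P ->
  \sum_i P (f i) (e i) = - \sum_i P (e i) (f i).
Proof.
move=> bP; have PNl x y : P (- x) y = - P x y.
  have P0 : P 0 y = 0.
    by have := bP.1 y (-1) 0 0; rewrite scaler0 addr0 scaleN1r addNr.
  by have := bP.1 y (-1) x 0; rewrite P0 !addr0 !scaleN1r.
have PNr x y : P x (- y) = - P x y.
  have P0 : P x 0 = 0.
    by have := bP.2 x (-1) 0 0; rewrite scaler0 addr0 scaleN1r addNr.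
  by have := bP.2 x (-1) y 0; rewrite P0 !addr0 !scaleN1r.
rewrite !big_split_ord /= opprD addrC -!sumrN /omega_f /omega_e.
have sl a : split (lshift g a) = inl a by apply: (unsplitK (inl a)).
have sr a : split (rshift g a) = inr a by apply: (unsplitK (inr a)).
congr (_ + _); apply: eq_bigr => a _; rewrite ?sl ?sr -?/(baseA a) -?/(baseB a).
  by rewrite PNl.
by rewrite PNr opprK.
Qed.

Definition partial_trace y w := \sum_i B (e i) y (f i) w.
Local Notation D0 := partial_trace.

Lemma alt4l2 c x y y' z w : B x (c *: y + y') z w = c *: B x y z w + B x y' z w.
Proof. by rewrite (alt4lC aB) (alt4l aB) !(alt4lC aB x); lmod. Qed.

Lemma alt4r2 c x y z w w' : B x y z (c *: w + w') = c *: B x y z w + B x y z w'.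
Proof. by rewrite (alt4rC aB) (alt4r aB) (alt4rC aB x y z w) (alt4rC aB x y z w'); lmod. Qed.

Lemma partial_trace_bilin : bilin D0.
Proof.
split=> [w c y y'|y c w w']; rewrite /D0 scaler_sumr -big_split; apply: eq_bigr => i _ /=.
  exact: alt4l2.
exact: alt4r2.
Qed.

Lemma partial_traceC y w : D0 y w = D0 w y.
Proof.
have bP : bilin (fun s t => B s y t w).
  by split=> [t c s s'|s c t t']; [exact: (alt4l aB) | exact: (alt4r aB)].
have := sum_frame_swap bP; rewrite -/(D0 y w) => E.
rewrite -[LHS]opprK -E -sumrN; apply: eq_bigr => i _.
by rewrite [RHS]BC.
Qed.

Lemma trace_partial_trace : \sum_j D0 (e j) (f j) = 0.
Proof.
apply: eq_opp_eq0; rewrite -(sum_frame_swap partial_trace_bilin).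
by apply: eq_bigr => j _; exact: partial_traceC.
Qed.

Local Notation b4 i j k l := (B (e i) (e j) (f k) (f l)).
Local Notation c2 i j := (b4 i j i j).

Lemma b4_null i j k l : i != k -> i != l -> j != k -> j != l -> b4 i j k l = 0.
Proof.
move=> /negPf h1 /negPf h2 /negPf h3 /negPf h4; apply: Bperp.
by rewrite /perp4 !(frameE fr) h1 h2 h3 h4 !eqxx.
Qed.

Lemma b4_ll i k l : b4 i i k l = 0.
Proof. exact/eq_opp_eq0/(alt4lC aB). Qed.

Lemma b4_rr i j k : b4 i j k k = 0.
Proof. exact/eq_opp_eq0/(alt4rC aB). Qed.

Lemma b4_move i m j l : i != m -> uniq [:: i; j; l] -> uniq [:: m; j; l] ->
  b4 i j i l = b4 m j m l.
Proof.
move=> /negPf nim U1 U2; neqs U1; neqs U2.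
have nmi := etrans (eq_sym m i) nim.
have /Bperp : perp4 om (e i + e m) (e j) (f i - f m) (f l).
  rewrite /perp4 !(pairE (omega_bilin g)) !(frameE fr).
  by apply/and4P; split; apply/eqP; simpneq; ring.
rewrite (alt4Dl aB) !(alt4Br aB).
have -> : b4 i j m l = 0 by apply: b4_null; simpneq.
have -> : b4 m j i l = 0 by apply: b4_null; simpneq.
by rewrite subr0 sub0r => /eqP; rewrite subr_eq0 => /eqP.
Qed.

(** The terms [m = j] and [m = l] vanish by alternation and the others are equal by [b4_move],
    whence the factor [n - 2]. *)
Lemma partial_trace_offdiag i j l : uniq [:: i; j; l] ->
  D0 (e j) (f l) = (n%:R - 2) *: b4 i j i l.
Proof.
move=> U; have U' := U; neqs U'.
transitivity (\sum_m (1 - (m == j)%:R - (m == l)%:R) *: b4 i j i l).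
  apply: eq_bigr => m _.
  have [->|nmj] := eqVneq m j.
    by rewrite b4_ll; simpneq; lmod.
  have [->|nml] := eqVneq m l.
    by rewrite b4_rr; simpneq; lmod.
  rewrite /= !mulr0n !subr0 scale1r; have [->//|nmi] := eqVneq m i.
  by apply: b4_move => //; rewrite /= !inE negb_or nmj nml; simpneq.
rewrite -scaler_suml !sumrB sumr_const card_ord; congr (_ *: _).
have sd (k : 'I_n) : \sum_(m < n) (m == k)%:R = 1 :> rat.
  by rewrite (bigD1 k) //= eqxx big1 ?addr0 // => m /negPf->.
by rewrite !sd; ring.
Qed.

Lemma c2C i j : c2 i j = c2 j i.
Proof. by rewrite (alt4lC aB) (alt4rC aB) opprK. Qed.

(** This is the expansion of a twisted quadruple: terms with exactly one shared index cancel in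
    pairs by [b4_move], those with none vanish. *)
Lemma c2_square i k j l : uniq [:: i; k; j; l] ->
  c2 i j - c2 i l - c2 k j + c2 k l = 0.
Proof.
move=> U; have /Bperp := frame_perp4 (omega_bilin g) fr U; neqs U.
have sw a c d t : b4 a c d t = b4 c a t d by rewrite (alt4lC aB) (alt4rC aB) opprK.
rewrite (alt4Dl aB) !(alt4Dl2 aB) !(alt4Br aB) !(alt4Br2 aB).
rewrite (b4_move (i := i) (m := k) (j := j) (l := l)); try uq.
rewrite (b4_move (i := i) (m := k) (j := l) (l := j)); try uq.
rewrite (sw i j k j) (b4_move (i := j) (m := l) (j := i) (l := k)) -?(sw i l k l); try uq.
rewrite (sw k j i j) (b4_move (i := j) (m := l) (j := k) (l := i)) -?(sw k l i l); try uq.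
have -> : b4 i j k l = 0 by apply: b4_null; simpneq.
have -> : b4 i l k j = 0 by apply: b4_null; simpneq.
have -> : b4 k j i l = 0 by apply: b4_null; simpneq.
have -> : b4 k l i j = 0 by apply: b4_null; simpneq.
by move=> E; rewrite -[RHS]E; lmod.
Qed.

(** Let [X i j] be the difference of the two sides. Summing [c2_square] over its last index shows
    that [X i j] does not depend on [i] different from [j]. Summing over [i], where
    [trace_partial_trace] makes the total of the [S i] vanish, then gives [(n - 1) X i j = 0]. *)
Lemma partial_trace_diag i j : i != j ->
  (n%:R - 2) *: c2 i j = D0 (e i) (f i) + D0 (e j) (f j).
Proof.
move=> nij.
pose S j := D0 (e j) (f j).
pose X i j := (n%:R - 2) *: c2 i j - S i - S j.
have c0 a : c2 a a = 0 by exact: b4_ll.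
have sd (k : 'I_n) (v : M) : \sum_(m < n) (m == k)%:R *: v = v.
  rewrite (bigD1 k) //= eqxx scale1r big1 ?addr0 // => m /negPf->.
  by rewrite scale0r.
have X1 a c d : uniq [:: a; c; d] -> X a d = X c d.
  move=> U; have U' := U; neqs U'.
  (* [c2_square] needs distinct indices. The two terms on the right are the defects at [l = a] and
     [l = c]; at [l = d] the identity holds by symmetry of [c2]. *)
  have E l : c2 a d - c2 l a - c2 c d + c2 l c =
      (l == a)%:R *: (c2 a d + c2 c a - c2 c d) + (l == c)%:R *: (c2 a d - c2 a c - c2 c d).
    have [->|nla] := eqVneq l a; first by rewrite c0 (c2C a c); simpneq; lmod.
    have [->|nlc] := eqVneq l c; first by rewrite c0 (c2C c a); simpneq; lmod.
    have [->|nld] := eqVneq l d.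
      by rewrite (c2C d a) (c2C d c) /=; lmod.
    rewrite (c2C l a) (c2C l c) /= !mulr0n !scale0r addr0.
    rewrite -[RHS](@c2_square a c d l); last first.
      by rewrite /= !inE ![_ == l]eq_sym (negPf nla) (negPf nlc) (negPf nld); simpneq.
    by lmod.
  have : \sum_l (c2 a d - c2 l a - c2 c d + c2 l c) =
     (c2 a d + c2 c a - c2 c d) + (c2 a d - c2 a c - c2 c d).
    by under eq_bigr do rewrite E; rewrite big_split /= !sd.
  rewrite big_split /= !sumrB !sumr_const card_ord -!scaler_nat.
  rewrite -/(D0 (e a) (f a)) -/(D0 (e c) (f c)) -/(S a) -/(S c) (c2C c a) => E1.
  apply/eqP; rewrite -subr_eq0; apply/eqP.
  transitivity ((n%:R *: c2 a d - S a - n%:R *: c2 c d + S c)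
    - (c2 a d + c2 a c - c2 c d + (c2 a d - c2 a c - c2 c d))).
    by rewrite /X; lmod.
  by rewrite E1 subrr.
have Xi a : a != j -> X a j = X i j.
  move=> naj; have [->//|nai] := eqVneq a i.
  by apply: X1; rewrite /= !inE negb_or nai naj nij.
have Xj : X j j = - S j - S j by rewrite /X c0 scaler0 add0r.
have EX a : X a j = X i j + (a == j)%:R *: (X j j - X i j).
  have [->|naj] := eqVneq a j; first by rewrite scale1r addrC subrK.
  by rewrite scale0r addr0 Xi.
have : \sum_a X a j = n%:R *: X i j + (X j j - X i j).
  by under eq_bigr do rewrite EX; rewrite big_split /= sd sumr_const card_ord scaler_nat.
rewrite {1}/X !sumrB -scaler_sumr -/(D0 (e j) (f j)) -/(S j) trace_partial_trace.
rewrite sumr_const card_ord -scaler_nat Xj => E1.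
have : (n%:R - 1) *: X i j = 0.
  apply/eqP; rewrite -subr_eq0; apply/eqP.
  transitivity (n%:R *: X i j + (- S j - S j - X i j)
    - ((n%:R - 2) *: S j - 0 - n%:R *: S j)); first by lmod.
  by rewrite E1 subrr.
move/eqP; rewrite scaler_eq0 subr_eq0 -[1]/(1%:R) eqr_nat.
have -> : (n == 1)%N = false by case: (g) g4 => [|[|]] // m _; rewrite addSn addnS.
move=> /eqP Xij; apply/eqP; rewrite -subr_eq0; apply/eqP.
by rewrite -[RHS]Xij /X /S; lmod.
Qed.

(** Both sides are multilinear and alternating, so frame vectors suffice: no common index is
    [b4_null], one is [partial_trace_offdiag], two are [partial_trace_diag]. *)
Lemma form_partial_trace x y z w : (n%:R - 2) *: B x y z w =
  om x z *: D0 y w - om x w *: D0 y z - om y z *: D0 x w + om y w *: D0 x z.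
Proof.
have [Dl Dr] := partial_trace_bilin.
pose E x y z w := (n%:R - 2) *: B x y z w - (om x z *: D0 y w - om x w *: D0 y z
  - om y z *: D0 x w + om y w *: D0 x z).
have aE : alt4 E.
  split=> [k s s' t u v|s t u v|k s t u u' v|s t u v]; rewrite /E.
  - by rewrite (alt4l aB) !omE (Dl v) (Dl u); lmod.
  - by rewrite (alt4lC aB t s); lmod.
  - by rewrite (alt4r aB) !omE (Dr t) (Dr s); lmod.
  - by rewrite (alt4rC aB s t u v); lmod.
suff E0 : E x y z w = 0 by apply/eqP; rewrite -subr_eq0; apply/eqP.
apply: (alt4_frame0 fr aE) => {x y z w} i j k l nij nkl.
have N1 a c k' : a != c -> a != k' -> E (e a) (e c) (f a) (f k') = 0.
  move=> /negPf nac /negPf nak; have nca := etrans (eq_sym c a) nac.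
  rewrite /E !(frameE fr); simpneq.
  have [<-|ncl] := eqVneq c k'.
    rewrite partial_trace_diag ?nac //; lmod.
  rewrite (partial_trace_offdiag (i := a)); first by lmod.
  by rewrite /= !inE nac nak ncl.
have [ik|nik] := eqVneq i k; first by subst k; apply: N1.
have [il|nil] := eqVneq i l.
  by subst l; rewrite (alt4rC aE) N1 ?oppr0 // eq_sym.
have [jk|njk] := eqVneq j k.
  by subst k; rewrite (alt4lC aE) N1 ?oppr0 // eq_sym.
have [jl|njl] := eqVneq j l.
  by subst l; rewrite (alt4lC aE) (alt4rC aE) N1 ?oppr0 // eq_sym.
rewrite /E !(frameE fr) b4_null // (negPf nik) (negPf nil) (negPf njk) (negPf njl).
by lmod.
Qed.

End Contraction.

(** * Surjectivity *)

Section Surjectivity.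
Variable g : nat.
Hypothesis g4 : (3 < g)%N.

Definition Phi0_range : set (wedge2 (W2 g)) := [set t | exists u, Phi0 u = t]%classic.

Lemma Phi0_rangeP t : qpi Phi0_range t = 0 -> exists u, Phi0 u = t.
Proof.
move=> /eqP; rewrite -(linear0 (qpi Phi0_range)) qpi_eqE subr0 => /asboolP.
move=> /(_ (fun t => `[< exists u, Phi0 u = t >])) h; apply/asboolP/h.
  split; first by apply/asboolP; exists 0; exact: linear0.
  move=> a s t' /asboolP[u us] /asboolP[v vt]; apply/asboolP.
  have E : Phi0 (a *: u + v) = a *: Phi0 u + Phi0 v by exact: linearP.
  by exists (a *: u + v); rewrite E us vt.
by move=> s; apply: asboolT.
Qed.

Theorem Phi0_surjective t : contr2 t = 0 -> exists u, @Phi0 g u = t.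
Proof.
move=> ct; apply: Phi0_rangeP.
pose pr : {linear wedge2 (W2 g) -> _} := qpi Phi0_range.
pose B (x y z w : H g) := pr (wedge (wedgeW x y) (wedgeW z w)).
have [Wl Wr] := wedge_bilin (W2 g); have [wl wr] := wedgeW_bilin g.
have aW := wedgeW_alt g.
have WN k k' : wedge (- k) k' = - wedge k k' :> wedge2 (W2 g).
  by rewrite [LHS]wedgeC (linearN (wedge k')) opprK [LHS]wedgeC.
have aB : alt4 B.
  split=> [k x x' y z w|x y z w|k x y z z' w|x y z w]; rewrite /B.
  - by rewrite wl Wl linearP.
  - by rewrite (altC aW (_ : orth [::] x) (_ : orth [::] y)) // WN linearN.
  - by rewrite wl Wr linearP.
  - by rewrite (altC aW (_ : orth [::] z) (_ : orth [::] w)) // linearN linearN.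
have BC x y z w : B z w x y = - B x y z w by rewrite /B wedgeC linearN.
(* For fixed [z, w], [span_ipair] reduces [[x, y]] to integral pairs; for these the wedge is the
   image of a generator, hence zero in the quotient. *)
have Bperp x y z w : perp4 (@omega g) x y z w -> B x y z w = 0.
  move=> o; have [oz ow] := perp4_orth o; have [ox oy] := orth2_sym oz ow.
  have [p [q [ipq op oq]]] := @ex_ipair0 g [:: z; w] (ltn_trans (isT : 2 < 3)%N g4).
  apply: (span_ipair (L := [:: z; w]) (D := fun x y => B x y z w) ipq op oq) => //.
  - by move=> c u u' v _ _ _; exact: (alt4l aB).
  - by move=> u v _ _; exact: (alt4lC aB).
  move=> a c iac oa oc; have [oz' ow'] := orth2_sym oa oc.
  have h : is_gen (wedgeW a c) (wedgeW z w).
    by split; [exact: contr_orth | left; exact: ipair_symplectic].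
  by rewrite /B -(Phi0E h); apply: qpi_rel; exists (symb h).
have DB := partial_trace_bilin aB; have DC := partial_traceC aB BC.
have [f fE] := sym2_lift DB DC.
(* Up to the nonzero factor [n - 2], the projection modulo the image factors through the
   contraction, by the map that the symmetric partial trace induces on [sym2]. *)
have key s : ((g + g)%:R - 2) *: pr s = f (contr2 s).
  elim/wedge2_ind: s => [|a u v Eu Ev|k k'].
  - by rewrite !linear0.
  - by rewrite !linearP -Eu -Ev /=; lmod.
  rewrite contr2E; elim/W2_ind: k => [|a u v Eu Ev|x y].
  - have -> : wedge 0 k' = 0 by have := Wl k' (-1) 0 0; rewrite scaler0 addr0 scaleN1r addNr.
    have -> : contr 0 k' = 0 by rewrite contrC contr_r0 oppr0.
    by rewrite !linear0.
  - by rewrite Wl (contr_linl k' a u v) !linearP -Eu -Ev /=; lmod.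
  elim/W2_ind: k' => [|a u v Eu Ev|z w].
  - by rewrite contr_r0 !linear0.
  - by rewrite Wr (contr_linr _ a u v) !linearP -Eu -Ev /=; lmod.
  rewrite -/(B x y z w) (form_partial_trace g4 aB BC Bperp) contrE.
  by rewrite !linearD !linearN !linearZ /= !fE.
have nz : (g + g)%:R - 2 != 0 :> rat.
  rewrite subr_eq0 eqr_nat.
  by case: (g) g4 => [|[|]] // m _; rewrite addSn addnS.
apply: (scalerI nz); rewrite scaler0.
by apply: etrans (key t) _; rewrite ct; exact: linear0.
Qed.

End Surjectivity.

Theorem theorem6 (g : nat) (hg : (4 <= g)%N) :
  bijective (@Phi g : {linear Kpres g -> symker g}).
Proof.
have inj : injective (@Phi g).
  by move=> u v /(congr1 val); exact: (Phi0_injective hg).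
have surj (t : symker g) : exists u, Phi u = t.
  case: t => t kt; have ct : contr2 t = 0 by move: (kt); rewrite inE => /eqP.
  have [u ut] := Phi0_surjective hg ct.
  by exists u; apply: val_inj.
have [h hK] := choice surj.
by exists h => // u; apply: inj; rewrite hK.
Qed.
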